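(* Let $d\ge3$ and let $K_a$ and $K_b$ be two isotropic projection kernels on $\mathbb{S}^d$ with coefficient sequences $a=(a_0,a_1,\dots)$ and $b=(b_0,b_1,\dots)$ such that, for each of $c=a$ and $c=b$, $c_k=\frac{2k+d-1}{d-1}$ for finitely many $k$ and $c_k=0$ otherwise, and $\sum_{k=0}^\infty c_k\binom{d+k-2}{k}=n$ (the same $n$ for both). Let $\mathbb{E}_a$ and $\mathbb{E}_b$ denote respectively the expected value of $E_2(x)$ when $x$ is given by the determinantal point process associated to $K_a$ and $K_b$. Assume that for all nonnegative integers $i,j$: \[ \text{if } i<j,\ a_i=0 \text{ and } a_j>0,\ \text{ then } b_i=0. \] Then $\mathbb{E}_a\le\mathbb{E}_b$, with strict inequality unless $a=b$. In particular, the harmonic kernel (the one with $a_k=\frac{2k+d-1}{d-1}$ for $k\le L$ and $a_k=0$ for $k>L$, so $n=\pi_L$) is optimal, since the displayed hypothesis is trivially satisfied in that case: it has the smallest expected value of $E_2$ among all such isotropic projection kernels with the same trace.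
   Context: $\mathbb{S}^d$ is the unit sphere in $\mathbb{R}^{d+1}$ and $\mu$ its normalized (probability) surface measure. $E_2(x)=\sum_{i\ne j}\|x_i-x_j\|^{-2}$ (sum over ordered pairs). $C_k^{\alpha}$ denotes the Gegenbauer polynomial, orthogonal on $[-1,1]$ for the weight $(1-t^2)^{\alpha-1/2}$, normalized by $C_k^{(d-1)/2}(1)=\binom{d+k-2}{k}$. The kernel with coefficients $a$ is $K_a(x,y)=\sum_{k=0}^\infty a_kC_k^{(d-1)/2}(\langle x,y\rangle)$, $x,y\in\mathbb{S}^d$; when each $a_k\in\{0,\frac{2k+d-1}{d-1}\}$ with finitely many nonzero, it is the kernel of an orthogonal projection in $L^2(\mu)$ with trace $n=\sum_ka_k\binom{d+k-2}{k}$. The determinantal point process associated to such a kernel $K$ has $n$ points a.s.; $x=(x_1,\dots,x_n)$ drawn from it is the random vector with density $\frac1{n!}\det(K(x_i,x_j))_{1\le i,j\le n}$ with respect to $\mu^{\otimes n}$. Also $\pi_L=\frac{2L+d}{d}\binom{d+L-1}{L}$. *)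

(* Defs.v *)
From HB Require Import structures.
From mathcomp Require Import all_boot all_order all_algebra.
From mathcomp Require Import all_classical all_reals all_analysis.
From mathcomp Require Import measurable_realfun.

Set Implicit Arguments.
Unset Strict Implicit.
Unset Printing Implicit Defensive.

Import Order.TTheory GRing.Theory Num.Theory.
Import numFieldNormedType.Exports.

Local Open Scope classical_set_scope.
Local Open Scope ring_scope.

Lemma pushforward_semi_sigma_additive d1 d2 (T1 : measurableType d1)
    (T2 : measurableType d2) (R : realFieldType)
    (m : {measure set T1 -> \bar R}) (f : T1 -> T2) :
  measurable_fun [set: T1] f -> semi_sigma_additive (pushforward m f).
Proof.
move=> mf F mF tF mUF; rewrite /pushforward preimage_bigcup.
apply: measure_semi_sigma_additive.
- by move=> n; rewrite -[X in measurable X]setTI; exact: mf.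
- apply/trivIsetP => /= i j _ _ ij; rewrite -preimage_setI.
  by move/trivIsetP : tF => /(_ _ _ _ _ ij) ->//; rewrite preimage_set0.
- by rewrite -preimage_bigcup -[X in measurable X]setTI; exact: mf.
Qed.

Section power_measure.
Context {dT : measure_display} {T : measurableType dT} {R : realType}.

Definition cons_pair n (p : T * n.-tuple T) : n.+1.-tuple T :=
  [the n.+1.-tuple T of p.1 :: p.2].

Lemma measurable_cons_pair n :
  measurable_fun [set: T * n.-tuple T] (@cons_pair n).
Proof. exact: (measurable_cons (f := fst) (g := snd)). Qed.

Section cons_measure.
Variables (n : nat) (mu : {sigma_finite_measure set T -> \bar R}).
Variable (nu : {sigma_finite_measure set (n.-tuple T) -> \bar R}).

Definition cons_measure : set (n.+1.-tuple T) -> \bar R :=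
  pushforward (mu \x nu)%E (@cons_pair n).

Let cons_measure0 : cons_measure set0 = 0%E.
Proof. by rewrite /cons_measure /pushforward preimage_set0 measure0. Qed.

Let cons_measure_ge0 A : (0 <= cons_measure A)%E.
Proof. by rewrite /cons_measure /pushforward; exact: measure_ge0. Qed.

Let cons_measure_sigma_additive : semi_sigma_additive cons_measure.
Proof.
apply: pushforward_semi_sigma_additive; exact: measurable_cons_pair.
Qed.

HB.instance Definition _ := isMeasure.Build _ _ _ cons_measure
  cons_measure0 cons_measure_ge0 cons_measure_sigma_additive.

Let uncons (x : n.+1.-tuple T) : T * n.-tuple T :=
  (thead x, [tuple of behead x]).

Let measurable_uncons : measurable_fun [set: n.+1.-tuple T] uncons.
Proof.
apply/measurable_fun_pairP; split; first exact: measurable_tnth.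
exact: measurable_behead.
Qed.

Let cons_pairK : cancel (@cons_pair n) uncons.
Proof. by case=> t x; congr pair; apply/val_inj. Qed.

Let cons_measure_sigma_finite : sigma_finite setT cons_measure.
Proof.
have /sigma_finiteP[F [TF ndF Foo]] := sigma_finiteT mu.
have /sigma_finiteP[G [TG ndG Goo]] := sigma_finiteT nu.
exists (fun k => uncons @^-1` (F k `*` G k)) => [|k].
  rewrite -preimage_bigcup (_ : \bigcup_i _ = setT) ?preimage_setT//.
  rewrite -setXTT TF TG predeqE => -[x y]; split.
    by move=> [k _ []]; split; exists k.
  move=> [/= [i _ Fix] [k _ Gky]]; exists (maxn i k) => //; split.
    by move: x Fix; exact/subsetPset/ndF/leq_maxl.
  by move: y Gky; exact/subsetPset/ndG/leq_maxr.
have [mFk Fkoo] := Foo k; have [mGk Gkoo] := Goo k; split.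
  rewrite -[X in measurable X]setTI.
  by apply: measurable_uncons => //; exact: measurableX.
rewrite /cons_measure /pushforward -comp_preimage.
rewrite (_ : _ \o _ = id) ?preimage_id; last first.
  by apply/funext => p /=; rewrite cons_pairK.
by rewrite product_measure1E// lte_mul_pinfty// ge0_fin_numE.
Qed.

HB.instance Definition _ := Measure_isSigmaFinite.Build _ _ _ cons_measure
  cons_measure_sigma_finite.

End cons_measure.

(* The n-fold product of mu with itself, built one coordinate at a time. *)
Fixpoint power_measure (mu : {sigma_finite_measure set T -> \bar R}) (n : nat) :
    {sigma_finite_measure set (n.-tuple T) -> \bar R} :=
  match n with
  | 0 => \d_([tuple] : 0.-tuple T)
  | n'.+1 => cons_measure mu (power_measure mu n')
  end.

Lemma measurable_tnth_box n (A : set T) :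
  measurable A -> measurable [set x : n.-tuple T | forall i, A (tnth x i)].
Proof.
move=> mA.
rewrite (_ : mkset _ = \bigcap_(i in [set: 'I_n]) (@tnth n T ^~ i @^-1` A)).
  apply: fin_bigcap_measurable => // i _.
  by rewrite -[X in measurable X]setTI; exact: measurable_tnth.
by apply/seteqP; split => x /= xA => [i _|i]; exact: xA.
Qed.

Lemma power_measure_box (mu : {sigma_finite_measure set T -> \bar R}) n (A : set T) :
  measurable A ->
  power_measure mu n [set x | forall i, A (tnth x i)] = (mu A ^+ n)%E.
Proof.
move=> mA; elim: n => [|n IHn].
  by rewrite expe0 /= diracE mem_set //= => -[].
rewrite expeS /= /cons_measure /pushforward.
rewrite (_ : _ @^-1` _ = A `*` [set x : n.-tuple T | forall i, A (tnth x i)]).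
  by rewrite product_measure1E ?IHn//; exact: measurable_tnth_box.
apply/seteqP; split => -[t x] /=.
  move=> H; split; first exact: (H ord0).
  by move=> i; have := H (lift ord0 i); rewrite tnthS.
move=> [At Ax] i; case: (unliftP ord0 i) => [j ->|-> //].
by rewrite tnthS.
Qed.

End power_measure.

Section sphere.
Context {R : realType}.

Local Notation vec m := (m.-tuple (measurableTypeR R)).

Definition dot m (x y : vec m) : R := \sum_(i < m) (tnth x i : R) * (tnth y i : R).

Definition enorm m (x : vec m) : R := Num.sqrt (dot x x).

Definition euclid_dist m (x y : vec m) : R :=
  enorm [tuple (tnth x i : R) - (tnth y i : R) | i < m].

Definition direction m (x : vec m) : vec m :=
  [tuple (enorm x)^-1 * (tnth x i : R) | i < m].

Definition punctured_ball m : set (vec m) := [set x | 0 < enorm x <= 1].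
Arguments punctured_ball : clear implicits.

Lemma measurable_enorm m : measurable_fun [set: vec m] (@enorm m).
Proof.
have ms : measurable_fun [set: R] (@Num.sqrt R).
  by apply: continuous_measurable_fun; exact: sqrt_continuous.
apply: measurableT_comp => //; apply: measurable_sum => i.
by apply: measurable_funM; exact: measurable_tnth.
Qed.

Lemma measurable_direction m : measurable_fun [set: vec m] (@direction m).
Proof.
apply/measurable_fun_tnthP => i /=.
rewrite (_ : _ \o _ = fun x : vec m => (enorm x)^-1 * tnth x i); last first.
  by apply/funext => x /=; rewrite tnth_mktuple.
apply: measurable_funM; last exact: measurable_tnth.
under eq_fun do rewrite -powR_inv1 ?sqrtr_ge0//.
by apply: (measurableT_comp (measurable_powR _)); exact: measurable_enorm.
Qed.

Lemma measurable_punctured_ball m : measurable (punctured_ball m).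
Proof.
rewrite -[X in measurable X]setTI.
rewrite (_ : punctured_ball m = @enorm m @^-1` `]0, 1]); last first.
  by apply/seteqP; split => x /=; rewrite in_itv.
exact: measurable_enorm.
Qed.

Definition lebesgue_tuple m : {sigma_finite_measure set (vec m) -> \bar R} :=
  power_measure lebesgue_measure m.

(* Unnormalized surface measure: the mass of A is the Lebesgue volume of the
   cone over A, i.e. of the x with 0 < |x| <= 1 and x / |x| in A.  The origin is
   removed so that the measure is carried by the unit sphere. *)
Definition cone_measure m : set (vec m) -> \bar R :=
  pushforward (mrestr (lebesgue_tuple m)
    (@measurable_punctured_ball m)) (@direction m).
Arguments cone_measure : clear implicits.

Let cone_measure0 m : cone_measure m set0 = 0%E.
Proof. by rewrite /cone_measure /pushforward preimage_set0 measure0. Qed.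

Let cone_measure_ge0 m A : (0 <= cone_measure m A)%E.
Proof. by rewrite /cone_measure /pushforward; exact: measure_ge0. Qed.

Let cone_measure_sigma_additive m : semi_sigma_additive (cone_measure m).
Proof.
apply: pushforward_semi_sigma_additive; exact: measurable_direction.
Qed.

HB.instance Definition _ m := isMeasure.Build _ _ _ (cone_measure m)
  (@cone_measure0 m) (@cone_measure_ge0 m) (@cone_measure_sigma_additive m).

(* A probability on the ambient space carried by the unit sphere S^d of R^(d+1).
   The Dirac mass is only the fallback required by mnormalize for a measure of
   zero or infinite total mass; it is never used, see sphere_measureE. *)
Definition sphere_measure (d : nat) : probability (vec d.+1) R :=
  mnormalize (cone_measure d.+1) \d_(nseq_tuple d.+1 (0 : R) : vec d.+1).

Lemma lambda_punctured_ball_gt0 d :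
  (0 < lebesgue_tuple d.+1 (punctured_ball d.+1))%E.
Proof.
set c : R := d.+1%:R^-1.
have c0 : 0 < c by rewrite invr_gt0.
apply: (@lt_le_trans _ _ (lebesgue_tuple d.+1
    [set x | forall i, `]0, c]%classic (tnth x i)])).
  have muc : @lebesgue_measure R `]0, c] = c%:E.
    by rewrite lebesgue_measure_itv/= lte_fin c0 sube0.
  rewrite /lebesgue_tuple power_measure_box// [X in (0 < X ^+ _)%E]muc -EFin_expe.
  by rewrite lte_fin exprn_gt0.
apply: le_measure; rewrite ?inE.
- exact: measurable_tnth_box.
- exact: measurable_punctured_ball.
- move=> x /= xc; have {}xc i : 0 < tnth x i <= c by have := xc i; rewrite /= in_itv.
  have dx0 : 0 < dot x x.
    rewrite /dot big_ord_recl ltr_pwDl//; last first.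
      by apply: sumr_ge0 => i _; rewrite -expr2 sqr_ge0.
    by have /andP[? _] := xc ord0; rewrite mulr_gt0.
  rewrite /punctured_ball /= /enorm sqrtr_gt0 dx0/=.
  rewrite -sqrtr1 ler_wsqrtr// (@le_trans _ _ (\sum_(i < d.+1) c))//.
    apply: ler_sum => i _; have /andP[x0 xlec] := xc i.
    rewrite -[leRHS]mulr1 ler_pM ?(ltW x0)// (le_trans xlec)//.
    by rewrite invf_le1// ler1n.
  by rewrite sumr_const card_ord -[_ *+ _]mulr_natr mulVf.
Qed.

Lemma lambda_punctured_ball_lty m :
  (lebesgue_tuple m (punctured_ball m) < +oo)%E.
Proof.
apply: (@le_lt_trans _ _ (lebesgue_tuple m
    [set x | forall i, `[-1, 1]%classic (tnth x i)])); last first.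
  have mu11 : @lebesgue_measure R `[-1, 1] = 2%:E.
    by rewrite lebesgue_measure_itv/= lte_fin gtrN//= -EFinB opprK.
  by rewrite /lebesgue_tuple power_measure_box// [X in (X ^+ _ < _)%E]mu11 -EFin_expe ltry.
apply: le_measure; rewrite ?inE.
- exact: measurable_punctured_ball.
- exact: measurable_tnth_box.
- move=> x /= /andP[_ x1] i /=; rewrite in_itv/= -ler_norml (le_trans _ x1)//.
  rewrite -sqrtr_sqr ler_wsqrtr// /dot (bigD1 i)//= -expr2 lerDl.
  by apply: sumr_ge0 => j _; rewrite -expr2 sqr_ge0.
Qed.

Lemma sphere_measureE d (A : set (vec d.+1)) :
  let lambda := lebesgue_tuple d.+1 in
  sphere_measure d A =
    (lambda (@direction d.+1 @^-1` A `&` punctured_ball d.+1) *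
     (fine (lambda (punctured_ball d.+1)))^-1%:E)%E.
Proof.
move=> lambda.
have E : cone_measure d.+1 [set: vec d.+1] = lambda (punctured_ball d.+1).
  by rewrite /cone_measure /pushforward preimage_setT /mrestr setTI.
rewrite -E /sphere_measure /= /mnormalize /=.
rewrite ifF//; apply/negbTE; rewrite negb_or E.
by rewrite gt_eqF ?lambda_punctured_ball_gt0//= -ltey lambda_punctured_ball_lty.
Qed.

End sphere.

Section gegenbauer.
Context {R : realType}.

Definition gegenbauer_index (d : nat) : R := (d%:R - 1) / 2.

Definition gegenbauer_weight (alpha t : R) : R := (1 - t ^+ 2) `^ (alpha - 2^-1).

Definition is_gegenbauer_family (d : nat) (C : nat -> {poly R}) : Prop :=
  [/\ forall k, size (C k) = k.+1,
      forall k l, k != l ->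
        (\int[lebesgue_measure]_(t in `[(-1)%R, 1%R])
          ((C k).[t] * (C l).[t] * gegenbauer_weight (gegenbauer_index d) t)%:E
         = 0)%E
    & forall k, (C k).[1] = 'C(d + k - 2, k)%:R].

(* For d >= 2 exactly one family satisfies the three conditions. *)
Definition gegenbauer (d : nat) : nat -> {poly R} :=
  xget (fun=> 0) [set C | is_gegenbauer_family d C].

End gegenbauer.

Section determinantal.
Context {R : realType}.

Local Notation vec m := (m.-tuple (measurableTypeR R)).

Definition isotropic_kernel (d : nat) (a : nat -> R) (x y : vec d.+1) : R :=
  limn (series (fun k => a k * (gegenbauer d k).[dot x y])).

Definition projection_coef (d k : nat) : R :=
  (2 * k%:R + d%:R - 1) / (d%:R - 1).

Definition isotropic_projection (d n : nat) (c : nat -> R) : Prop :=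
  [/\ forall k, c k = projection_coef d k \/ c k = 0,
      finite_set [set k | c k != 0]
    & limn (series (fun k => c k * 'C(d + k - 2, k)%:R)) = n%:R].

Definition dpp_density (T : Type) (n : nat) (K : T -> T -> R) (x : n.-tuple T) : R :=
  (n`!%:R)^-1 * \det (\matrix_(i < n, j < n) K (tnth x i) (tnth x j)).

Definition riesz2 (m n : nat) (x : n.-tuple (vec m)) : R :=
  \sum_(i < n) \sum_(j < n | i != j) euclid_dist (tnth x i) (tnth x j) ^- 2.

(* The expectation of riesz2 under the law with density dpp_density with respect
   to the n-fold product of the normalized surface measure.  On the null set where
   two points coincide, the inverse of zero in riesz2 is harmless: the
   determinant vanishes there. *)
Definition expected_riesz2 (d n : nat) (a : nat -> R) : \bar R :=
  (\int[power_measure (sphere_measure d) n]_x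
    (riesz2 x * dpp_density (isotropic_kernel a) x)%:E)%E.

Definition gap_condition (a b : nat -> R) : Prop :=
  forall i j, (i < j)%N -> a i = 0 -> 0 < a j -> b i = 0.

Definition harmonic_coef (d L k : nat) : R :=
  if (k <= L)%N then projection_coef d k else 0.

Definition harmonic_dim (d L : nat) : R :=
  (2 * L%:R + d%:R) / d%:R * 'C(d + L - 1, L)%:R.

End determinantal.

(* Main.v *)
(* Integrating out all but two points of the determinantal process turns the
   expectation of [E_2] into the double integral of
   [(n^2 - K(x,y)^2) / |x - y|^2], and [|x - y|^2 = 2 (1 - <x,y>)] on the sphere.
   For [d >= 3] the function [C_i C_j / (1 - t)] of [t = <x,y>] is integrable, with
   mean [(d - 1) / (d - 2) * C_(min i j)(1)].  Writing [h_k = C_k(1)] and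
   [u_k = a_k h_k], so that the [u_k] sum to [n], the expectation is
     [(d - 1) / (2 (d - 2)) * (n^2 - \sum_(i, j) u_i u_j / h_(max i j))],
   and [h] is increasing.  The gap hypothesis says that [b] arises from [a] by
   moving mass to the right of the last index of [a], which decreases the double
   sum. *)
Require Import Defs.
From HB Require Import structures.
From mathcomp Require Import all_boot all_order all_algebra.
From mathcomp Require Import perm.
From mathcomp Require Import ring lra zify.
Set Implicit Arguments.
Unset Strict Implicit.
Unset Printing Implicit Defensive.
Import Order.TTheory GRing.Theory Num.Theory.
Local Open Scope ring_scope.

(** * Moving mass to the right *)

(** The density of [<x,y>] under the surface measure is never computed. The algebra asks only one
    rule of a mean [E] on polynomials, [E ((1 - X^2) p') = d E (X p)]: it makes the Gegenbauer
    operator symmetric, whence orthogonality, norms and uniqueness. The rule is verified twice: for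
    the integral against the Gegenbauer weight, to identify the family that [gegenbauer] picks by
    its defining properties, and for the mean over the sphere, to compute with the process. On the
    sphere it is a recurrence between even moments, drawn from rotation invariance. Neither
    spherical harmonics nor the addition theorem appear: the reproducing property holds because the
    convolution of two zonal polynomials is a zonal polynomial of controlled degree. Two obstacles
    shape the probabilistic part. The points are ambient vectors, where the kernel need not be
    bounded, so kernel and energy are cut off to the sphere; and the energy is singular, so
    integrability rests on a bound for its integral in one variable, uniform in the other. As a pair
    takes two points, [n <= 1] is settled apart: there the trace determines the sequence. *)

Section energy.
Variable R : realFieldType.
Variable h : nat -> R.
Hypothesis h_gt0 : forall i, 0 < h i.
Hypothesis h_incr : {homo h : i j / (i < j)%N >-> i < j}.

Definition weighted_energy (N : nat) (u : nat -> R) : R :=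
  \sum_(i < N) \sum_(j < N) u i * u j / h (maxn i j).

(** The difference of two values of a symmetric quadratic form is its bilinear form at [u + v] and
    [u - v]; the cross terms [w] cancel on exchanging the sums. *)
Lemma weighted_energyB N (u v : nat -> R) :
  weighted_energy N u - weighted_energy N v =
  \sum_(j < N) (u j + v j) * \sum_(i < N) (u i - v i) / h (maxn i j).
Proof.
pose w i j : R := u i * v j / h (maxn i j).
have wC : \sum_(j < N) \sum_(i < N) w i j = \sum_(j < N) \sum_(i < N) w j i.
  exact: exchange_big.
under [RHS]eq_bigr do rewrite mulr_sumr.
rewrite [RHS](_ : _ = \sum_(j < N) \sum_(i < N)
   (u j * u i / h (maxn j i) - v j * v i / h (maxn j i) + w i j - w j i)).
  under [RHS]eq_bigr do rewrite !(big_split, sumrN) /=.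
  by rewrite !(big_split, sumrN) /= wC addrK.
by apply: eq_bigr => j _; apply: eq_bigr => i _; rewrite /w (maxnC i j); ring.
Qed.

(* The mass that [v] does not share with [u] has been moved to the right of [J],
   where [1 / h (maxn _ j)] is smaller. *)
Lemma lt_weighted_energy N J (u v : nat -> R) :
  (forall i, 0 <= u i) -> (forall i, 0 <= v i) ->
  \sum_(i < N) u i = \sum_(i < N) v i ->
  (forall i, (i <= J)%N -> v i <= u i) -> (forall i, (J < i)%N -> u i = 0) ->
  (exists2 i, (i < N)%N & u i != v i) ->
  weighted_energy N v < weighted_energy N u.
Proof.
move=> u0 v0 uv leJ gtJ [i0 i0N neq].
rewrite -subr_gt0 weighted_energyB.
have D0 : \sum_(i < N) (u i - v i) = 0 by rewrite sumrB uv subrr.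
have hle i j : (i <= j)%N -> h i <= h j.
  by rewrite leq_eqVlt => /orP[/eqP ->//|/h_incr/ltW].
(* Since [u - v] sums to zero, the constant [1 / h (maxn J j)] may be subtracted from every weight.
   Both factors are then nonnegative for [i <= J] and nonpositive beyond. *)
have term_ge0 i j : 0 <= (u i - v i) * ((h (maxn i j))^-1 - (h (maxn J j))^-1).
  have [iJ|Ji] := leqP i J.
    apply: mulr_ge0; first by rewrite subr_ge0 leJ.
    by rewrite subr_ge0 lef_pV2 ?posrE// hle// geq_max !leq_max iJ leqnn orbT.
  apply: mulr_le0; first by rewrite subr_le0 gtJ.
  by rewrite subr_le0 lef_pV2 ?posrE// hle// geq_max !leq_max (ltnW Ji) leqnn orbT.
have sumE j : \sum_(i < N) (u i - v i) / h (maxn i j) =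
    \sum_(i < N) (u i - v i) * ((h (maxn i j))^-1 - (h (maxn J j))^-1).
  under [RHS]eq_bigr do rewrite mulrBr.
  by rewrite sumrB -mulr_suml D0 mul0r subr0.
have sum_ge0 j : 0 <= \sum_(i < N) (u i - v i) / h (maxn i j).
  by rewrite sumE; apply: sumr_ge0 => i _.
(* Strictness: [u] and [v] differ but have equal sums, so some [j] has [v j < u j] and some [l] has
   [u l < v l]. Then [j <= J < l], and the contribution of [j] and [l] is positive because
   [h J < h l]. *)
have [j jN uvj] : exists2 j : nat, (j < N)%N & 0 < u j - v j.
  have [/existsP[j uvj]|/existsPn no] :=
    boolP [exists j : 'I_N, 0 < u j - v j]; first by exists j.
  have le0 (j : 'I_N) : true -> 0 <= v j - u j.
    by move=> _; rewrite -opprB oppr_ge0 leNgt no.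
  have /eqP : \sum_(j < N) (v j - u j) = 0 by rewrite sumrB uv subrr.
  rewrite psumr_eq0// => /allP /(_ (Ordinal i0N) (mem_index_enum _)) /=.
  by rewrite subr_eq0 eq_sym (negbTE neq).
have [l lN uvl] : exists2 l : nat, (l < N)%N & u l - v l < 0.
  have [/existsP[l uvl]|/existsPn no] :=
    boolP [exists l : 'I_N, u l - v l < 0]; first by exists l.
  have ge0 (l : 'I_N) : true -> 0 <= u l - v l by move=> _; rewrite leNgt no.
  have /eqP := D0.
  rewrite psumr_eq0// => /allP /(_ (Ordinal jN) (mem_index_enum _)) /=.
  by rewrite gt_eqF.
have Jl : (J < l)%N by rewrite ltnNge; apply/negP => /leJ; rewrite -subr_ge0 leNgt uvl.
have jJ : (j <= J)%N.
  by rewrite leqNgt; apply/negP => /gtJ uj; have := v0 j; have := uvj; rewrite uj; lra.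
rewrite (bigD1 (Ordinal jN)) //= ltr_pwDl//; last first.
  by apply: sumr_ge0 => i _; rewrite mulr_ge0// addr_ge0.
rewrite mulr_gt0//; first by have := v0 j; lra.
rewrite sumE (bigD1 (Ordinal lN)) //= ltr_pwDl//; last first.
  by apply: sumr_ge0 => i _.
rewrite nmulr_rgt0// subr_lt0 (maxn_idPl _)// ?(leq_trans jJ (ltnW Jl))//.
by rewrite (maxn_idPl jJ) ltf_pV2 ?posrE// h_incr.
Qed.

End energy.

(** * Gegenbauer polynomials *)

(** Deduces a goal from a known equation [c = e] once the differences of sides agree, which [ring]
    can check. *)
Lemma eq_of_subr (V : zmodType) (a b c e : V) : c = e -> a - b = c - e -> a = b.
Proof. by move=> ->; rewrite subrr => /subr0_eq. Qed.

Lemma bin_rising i m : (i.+1 * 'C(i.+1 + m, m) = (i + m).+1 * 'C(i + m, m))%N.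
Proof.
have E n : 'C(n + m, m) = 'C(n + m, n) by rewrite -(bin_sub (leq_addr m n)) addKn.
by rewrite !E mul_bin_diag.
Qed.

Section gegenbauer_polynomials.
Variable R : realFieldType.
Variable m : nat.
(* The dimension is [d = m + 2]. *)
Local Notation d := (m%:R + 2 : R).

(** With [alpha = (m + 1) / 2] this is [2^j alpha (alpha + 1) ... (alpha + j - 1) / j!]. *)
Fixpoint gegen_scale (j : nat) : R :=
  if j is i.+1 then (2 * i%:R + m%:R + 1) / (i%:R + 1) * gegen_scale i else 1.

(** Taylor coefficient at [t = 1], in powers of [1 - t]: the [j]-th derivative of [C_k^alpha] is
    [j! * gegen_scale j] times [C_(k-j)^(alpha+j)], whose value at 1 is the binomial coefficient. *)
Definition gegen_coef (k j : nat) : R :=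
  (-1) ^+ j * 'C(k + j + m, 2 * j + m)%:R * gegen_scale j.

Arguments gegen_coef : simpl never.

(* Expansion in powers of [1 - t]; the coefficients solve the two-term recurrence
   given by the Gegenbauer differential equation. *)
Definition gegen_shifted (k : nat) : {poly R} := \poly_(j < k.+1) gegen_coef k j.

Definition gegen (k : nat) : {poly R} := gegen_shifted k \Po (1 - 'X).

Lemma binSr (n r : nat) : (r%:R + 1) * 'C(n, r.+1)%:R = (n%:R - r%:R) * 'C(n, r)%:R :> R.
Proof.
have [rn|nr] := leqP r n.
  by rewrite -natrB// -[1]/(1%:R) -natrD addn1 -!natrM mul_bin_left.
by rewrite !bin_small ?mulr0//; lia.
Qed.

Lemma gegen_coef_gt k j : (k < j)%N -> gegen_coef k j = 0.
Proof. by move=> kj; rewrite /gegen_coef bin_small ?mulr0 ?mul0r//; lia. Qed.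

Lemma coef_gegen_shifted k j : (gegen_shifted k)`_j = gegen_coef k j.
Proof. by rewrite coef_poly; case: ltnP => // /gegen_coef_gt. Qed.

Lemma gegen_scale_gt0 j : 0 < gegen_scale j.
Proof.
elim: j => [|j IH] /=; first by rewrite ltr01.
by rewrite mulr_gt0// divr_gt0// ?ltr_wpDl// ?addr_ge0// ?mulr_ge0.
Qed.

Lemma gegen_coefS k j : (j%:R + 1) * (2 * j%:R + d) * gegen_coef k j.+1 =
  - (k%:R - j%:R) * (k%:R + j%:R + d - 1) * gegen_coef k j.
Proof.
have rE : (2 * j.+1 + m = (2 * j + m).+2)%N by lia.
have nE : (k + j.+1 + m = (k + j + m).+1)%N by lia.
rewrite /gegen_coef exprS /= rE nE.
set n := (k + j + m)%N; set r := (2 * j + m)%N.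
have B1 := binSr n r; have B2 := binSr n r.+1.
have -> : 'C(n.+1, r.+2)%:R = 'C(n, r.+2)%:R + 'C(n, r.+1)%:R :> R.
  by rewrite binS natrD.
have r1 : (r%:R + 1 : R) != 0 by rewrite natr1 pnatr_eq0.
have r2 : (r%:R + 2 : R) != 0 by rewrite -natrD addn2 pnatr_eq0.
have j1 : (j%:R + 1 : R) != 0 by rewrite natr1 pnatr_eq0.
(* [C1] and [C2] express every binomial through ['C(n, r)]; what remains is an identity of rational
   functions. *)
have C1 : 'C(n, r.+1)%:R = (n%:R - r%:R) / (r%:R + 1) * 'C(n, r)%:R :> R.
  by rewrite mulrAC -B1 mulrAC divff ?mul1r.
have C2 : 'C(n, r.+2)%:R = (n%:R - r%:R - 1) / (r%:R + 2) * 'C(n, r.+1)%:R :> R.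
  apply: (mulfI r2); move: B2; rewrite -natr1 -addrA -[1 + 1]/2 => ->.
  by field.
rewrite C2 C1.
have -> : n%:R = k%:R + j%:R + m%:R :> R by rewrite !natrD.
have rr : r%:R = 2 * j%:R + m%:R :> R by rewrite natrD natrM.
rewrite rr in r1 r2 *.
by field; rewrite j1 r1 r2.
Qed.

(** Here [X] stands for [1 - t], so that [1 - t^2] becomes [2 X - X^2]. This is the Gegenbauer
    equation in that variable; its coefficient of degree [j] is [gegen_coefS]. *)
Lemma gegen_shifted_ode k :
  2 *: ('X * (gegen_shifted k)^`()^`()) - 'X * ('X * (gegen_shifted k)^`()^`())
  + d *: (gegen_shifted k)^`() - d *: ('X * (gegen_shifted k)^`())
  + (k%:R * (k%:R + d - 1)) *: gegen_shifted k = 0.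
Proof.
apply/polyP => j; have := gegen_coefS k j.
rewrite !(coefD, coefB, coefN, coefZ, coefXM, coef_deriv, coef0).
rewrite !coef_gegen_shifted; by case: j => [|[|j]] /= /eq_of_subr; apply; ring.
Qed.

Lemma deriv_comp_onem (p : {poly R}) : (p \Po (1 - 'X))^`() = - (p^`() \Po (1 - 'X)).
Proof. by rewrite deriv_comp derivB derivC derivX sub0r mulrN1. Qed.

Lemma gegen_ode k : (1 - 'X^2) * (gegen k)^`()^`() - d *: ('X * (gegen k)^`()) =
  - (k%:R * (k%:R + d - 1)) *: gegen k.
Proof.
have := congr1 (comp_poly (1 - 'X)) (gegen_shifted_ode k).
rewrite /gegen !(deriv_comp_onem, derivN, opprK) comp_poly0.
have cN p : (- p) \Po (1 - 'X) = - (p \Po (1 - 'X)) :> {poly R}.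
  by rewrite -!scaleN1r comp_polyZ.
rewrite !(comp_polyD, cN, comp_polyZ, comp_polyM, comp_polyX).
set p := (_ \Po _); set q := (_ \Po _); set r := (_ \Po _).
by rewrite -!mul_polyC => /eq_of_subr; apply; rewrite !(polyCD,polyCM,polyCN); ring.
Qed.

Lemma size_gegen k : size (gegen k) = k.+1.
Proof.
rewrite size_comp_poly2.
  rewrite size_poly_eq// /gegen_coef.
  rewrite !mulf_eq0 signr_eq0 (gt_eqF (gegen_scale_gt0 _)) orbF.
  by rewrite pnatr_eq0 -lt0n bin_gt0; lia.
by rewrite -opprB size_polyN -['X - 1]/('X - 1%:P) size_XsubC.
Qed.

Lemma horner_gegen1 k : (gegen k).[1] = 'C(k + m, m)%:R.
Proof.
rewrite horner_comp !hornerE subrr horner_coef0 coef_gegen_shifted.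
by rewrite /gegen_coef expr0 mul1r mulr1 addn0 muln0 add0n.
Qed.

Lemma gegen0 : gegen 0 = 1.
Proof.
suff E : gegen_shifted 0 = 1 by rewrite /gegen E comp_polyC.
apply/polyP => -[|j]; rewrite coef_gegen_shifted coef1 /=.
  by rewrite /gegen_coef expr0 mul1r mulr1 addn0 muln0 !add0n binn.
by rewrite gegen_coef_gt.
Qed.

Lemma gegen_deg1 : gegen 1 = (d - 1) *: 'X.
Proof.
rewrite /gegen (_ : gegen_shifted 1 = (d - 1)%:P - (d - 1) *: 'X).
  rewrite comp_polyB comp_polyC comp_polyZ comp_polyX.
  by rewrite -!mul_polyC; ring.
apply/polyP => -[|[|j]]; rewrite coef_gegen_shifted !coefE /=.
- rewrite /gegen_coef expr0 mul1r mulr1 addn0 muln0 add0n add1n binSn -natr1.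
  by ring.
- by rewrite /gegen_coef /= expr1 addn1 muln1 binn; field.
- by rewrite gegen_coef_gt// mulr0 subr0.
Qed.

(** Compared coefficient by coefficient: the constant terms reduce to the ratios of consecutive
    ['C(k + m, m)], the others to multiples of a single binomial. *)
Lemma gegen_shifted_rec k :
  (k%:R + 2) *: gegen_shifted k.+2 =
  (2 * k%:R + m%:R + 3) *: ((1 - 'X) * gegen_shifted k.+1)
  - (k%:R + m%:R + 1) *: gegen_shifted k.
Proof.
apply/polyP => j; rewrite mulrBl mul1r.
rewrite !(coefD, coefB, coefN, coefZ, coefXM) !coef_gegen_shifted.
case: j => [|j] /=.
  rewrite /gegen_coef expr0 !mul1r !mulr1 !addn0 muln0 !add0n.
  have H i : (i%:R + 1) * 'C(i.+1 + m, m)%:R = (i%:R + m%:R + 1) * 'C(i + m, m)%:R :> R.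
    by rewrite -natrD !natr1 -!natrM bin_rising.
  have H1 := H k; have H2 := H k.+1; rewrite -natr1 in H2.
  lra.
rewrite /gegen_coef /= exprS.
have -> : (k.+2 + j.+1 + m = (k + j + m).+1.+2)%N by lia.
have -> : (k.+1 + j.+1 + m = (k + j + m).+2)%N by lia.
have -> : (k.+1 + j + m = (k + j + m).+1)%N by lia.
have -> : (k + j.+1 + m = (k + j + m).+1)%N by lia.
have -> : (2 * j.+1 + m = (2 * j + m).+2)%N by lia.
move nE : (k + j + m).+1 => n; set r := (2 * j + m)%N.
rewrite !binS !natrD.
have B1 := binSr n r; have B2 := binSr n r.+1; rewrite -natr1 in B2.
have r1 : (r%:R + 1 : R) != 0 by rewrite natr1 pnatr_eq0.
have r2 : (r%:R + 2 : R) != 0 by rewrite -natrD addn2 pnatr_eq0.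
have j1 : (j%:R + 1 : R) != 0 by rewrite natr1 pnatr_eq0.
have C1 : 'C(n, r.+1)%:R = (n%:R - r%:R) / (r%:R + 1) * 'C(n, r)%:R :> R.
  by rewrite mulrAC -B1 mulrAC divff ?mul1r.
have C2 : 'C(n, r.+2)%:R = (n%:R - r%:R - 1) / (r%:R + 2) * 'C(n, r.+1)%:R :> R.
  apply: (mulfI r2); move: B2; rewrite -addrA -[1 + 1]/2 => ->.
  by field.
rewrite C2 C1.
have -> : n%:R = k%:R + j%:R + m%:R + 1 :> R by rewrite -nE -natr1 !natrD.
have rr : r%:R = 2 * j%:R + m%:R :> R by rewrite natrD natrM.
rewrite rr in r1 r2 *.
by field; rewrite j1 r1 r2.
Qed.

Lemma gegen_rec k : (k%:R + 2) *: gegen k.+2 =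
  (2 * k%:R + m%:R + 3) *: ('X * gegen k.+1) - (k%:R + m%:R + 1) *: gegen k.
Proof.
have := congr1 (comp_poly (1 - 'X)) (gegen_shifted_rec k).
rewrite comp_polyB !comp_polyZ comp_polyM comp_polyB comp_polyX comp_polyC.
by have -> : (1%:P - (1 - 'X) : {poly R}) = 'X by rewrite polyC1; ring.
Qed.

Lemma gegen_normE k : (k%:R + 1) * (gegen k.+1).[1] = (k%:R + m%:R + 1) * (gegen k).[1].
Proof.
by rewrite !horner_gegen1 -natrD !natr1 -!natrM bin_rising.
Qed.

Lemma gegen_neq0 k : gegen k != 0.
Proof. by rewrite -size_poly_eq0 size_gegen. Qed.

(** * Functionals obeying the integration by parts rule *)

Section functional.
Variable E : {scalar {poly R}}.
Hypothesis E_by_parts : forall p : {poly R}, E ((1 - 'X^2) * p^`()) = d * E ('X * p).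

(** By the rule on [E], the operator [D] of the differential equation is symmetric for [E (p * q)].
    Its eigenvalues [- k (k + d - 1)] are pairwise distinct. *)
Lemma gegen_orthogonal k l : k != l -> E (gegen k * gegen l) = 0.
Proof.
move=> kl.
pose D (p : {poly R}) := (1 - 'X^2) * p^`()^`() - d *: ('X * p^`()).
have symD p q : E (D p * q) = - E ((1 - 'X^2) * (p^`() * q^`())).
  have := E_by_parts (p^`() * q); rewrite derivM mulrDr linearD /= => eqE.
  have -> : D p * q = (1 - 'X^2) * (p^`()^`() * q) - d *: ('X * (p^`() * q)).
    by rewrite /D -!mul_polyC; ring.
  by rewrite linearB linearZ /= -eqE; ring.
have : E (D (gegen k) * gegen l) = E (D (gegen l) * gegen k).
  by rewrite !symD (mulrC (gegen k)^`()).
rewrite /D !gegen_ode !scaleNr !mulNr !linearN -!scalerAl !linearZ /=.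
rewrite (mulrC (gegen l)) => /eqP.
rewrite eqr_opp -subr_eq0 -mulrBl mulf_eq0 => /orP[|/eqP //].
have -> : k%:R * (k%:R + d - 1) - l%:R * (l%:R + d - 1) =
   (k%:R - l%:R) * (k%:R + l%:R + m%:R + 1) :> R by ring.
rewrite mulf_eq0 subr_eq0 eqr_nat (negbTE kl) -!natrD natr1 pnatr_eq0//.
Qed.

Lemma gegen_span k (p : {poly R}) : (size p <= k)%N ->
  exists c : nat -> R, p = \sum_(i < k) c i *: gegen i.
Proof.
elim: k p => [|k IH] p.
  by rewrite leqn0 size_poly_eq0 => /eqP ->; exists (fun=> 0); rewrite big_ord0.
move=> sp; pose a := p`_k / lead_coef (gegen k).
have [|c cE] := IH (p - a *: gegen k).
  apply/leq_sizeP => j; rewrite leq_eqVlt => /orP[/eqP <-|kj].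
    rewrite coefB coefZ /a lead_coefE size_gegen /=.
    rewrite divfK ?subrr// -[X in _`_X]/(k.+1.-1) -(size_gegen k) -lead_coefE.
    by rewrite lead_coef_eq0 gegen_neq0.
  rewrite coefB coefZ !nth_default ?mulr0 ?subr0 ?size_gegen//.
  exact: leq_trans sp kj.
exists (fun i => if i == k then a else c i); rewrite big_ord_recr /= eqxx.
rewrite -[LHS](subrK (a *: gegen k)) cE; congr (_ + _).
by apply: eq_bigr => i _; rewrite ltn_eqF.
Qed.

Lemma gegen_orthogonal_size k (p : {poly R}) : (size p <= k)%N -> E (p * gegen k) = 0.
Proof.
move=> /gegen_span[c ->]; rewrite mulr_suml linear_sum big1// => i _.
by rewrite -scalerAl linearZ /= gegen_orthogonal ?mulr0// ltn_eqF.
Qed.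

(** Pairing one instance of the recurrence with [gegen k] and the preceding instance with
    [gegen k.+1] produces the same number [E (gegen k * ('X * gegen k.+1))]. Eliminating it gives
    the ratio of two consecutive norms. *)
Lemma gegen_norm k :
  (2 * k%:R + m%:R + 1) * E (gegen k * gegen k) = (m%:R + 1) * (gegen k).[1] * E 1.
Proof.
elim: k => [|k IH].
  by rewrite horner_gegen1 gegen0 mulr1 add0n binn mulr0 add0r mulr1.
have rec1 := congr1 (fun p => E (gegen k * p)) (gegen_rec k).
rewrite /= mulrBr linearB /= -!scalerAr !linearZ /= gegen_orthogonal ?mulr0 in rec1; last first.
  by rewrite ltn_eqF.
have rec2 : (k%:R + 1) * E (gegen k.+1 * gegen k.+1) =
    (2 * k%:R + m%:R + 1) * E (gegen k * ('X * gegen k.+1)).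
  case: k {IH rec1} => [|k].
    rewrite gegen_deg1 gegen0 -!scalerAl !linearZ /= -!scalerAr !linearZ /=.
    by rewrite mul1r; ring.
  have := congr1 (fun p => E (p * gegen k.+2)) (gegen_rec k).
  rewrite /= mulrBl linearB /= -!scalerAl !linearZ /= (@gegen_orthogonal k); last first.
    by rewrite ltn_eqF// .
  by rewrite mulrCA !mulrA -!natr1 => H; lra.
have g1 := gegen_normE k.
have k1 : (k%:R + 1 : R) != 0 by rewrite natr1 pnatr_eq0.
have k2 : (k%:R + m%:R + 1 : R) != 0 by rewrite -natrD natr1 pnatr_eq0.
apply: (mulfI k1); rewrite mulrCA rec2 -natr1.
move: IH rec1.
set x := E (gegen k * gegen k); set y := E (gegen k * ('X * gegen k.+1)) => IH rec1.
have F : (2 * k%:R + m%:R + 3) * y = (k%:R + m%:R + 1) * x by lra.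
transitivity ((k%:R + m%:R + 1) * ((2 * k%:R + m%:R + 1) * x)).
  by rewrite [RHS]mulrCA -F; ring.
rewrite IH; transitivity ((m%:R + 1) * ((k%:R + m%:R + 1) * (gegen k).[1]) * E 1); first ring.
by rewrite -g1; ring.
Qed.

(** Strong induction shows [P k] proportional to [gegen k]: orthogonality to [P i], a nonzero
    multiple of [gegen i] by its size, kills the lower coefficients. The value at 1 fixes the
    scalar. *)
Lemma gegen_unique (P : nat -> {poly R}) : E 1 != 0 ->
  (forall k, size (P k) = k.+1) -> (forall k l, k != l -> E (P k * P l) = 0) ->
  (forall k, (P k).[1] = 'C(k + m, m)%:R) -> P =1 gegen.
Proof.
move=> E1 sP oP P1 k.
have norm_neq0 l : E (gegen l * gegen l) != 0.
  apply/eqP => z; have := gegen_norm l; rewrite z mulr0 => /esym/eqP.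
  rewrite !mulf_eq0 (negbTE E1) horner_gegen1 natr1 !pnatr_eq0 orbF /=.
  by rewrite eqn0Ngt bin_gt0 leq_addl.
suff [c cE] : exists c, P k = c *: gegen k.
  suff c1 : c = 1 by rewrite cE c1 scale1r.
  have := congr1 (horner^~ 1) cE; rewrite P1 hornerZ horner_gegen1 => /esym/eqP.
  rewrite -subr_eq0 -[X in _ - X]mul1r -mulrBl mulf_eq0 subr_eq0.
  by rewrite pnatr_eq0 eqn0Ngt bin_gt0 leq_addl orbF => /eqP.
elim/ltn_ind: k => k IH.
have [c cE] := gegen_span (eq_leq (sP k)).
exists (c k); rewrite cE big_ord_recr /= big1 ?add0r// => i _.
have [e eE] := IH i (ltn_ord i).
have /eqP := oP k i (negbT (gtn_eqF (ltn_ord i))).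
rewrite eE -scalerAr linearZ /= mulf_eq0 => /orP[/eqP e0|].
  by have := sP i; rewrite eE e0 scale0r size_poly0.
rewrite cE mulr_suml linear_sum (bigD1 (widen_ord (leqnSn k) i)) //= big1 ?addr0.
  by rewrite -scalerAl linearZ /= mulf_eq0 (negbTE (norm_neq0 _)) orbF => /eqP ->; rewrite scale0r.
move=> j ji; rewrite -scalerAl linearZ /= gegen_orthogonal ?mulr0//.
Qed.

Section weighted.
(* Abstracts the mean of [p / (1 - t)], [E p] being the mean of [p]. *)
Variable J : {scalar {poly R}}.
Hypothesis J_weight : forall p : {poly R}, J ((1 - 'X) * p) = E p.
Hypothesis J1 : m%:R * J 1 = (m%:R + 1) * E 1.

(** Multiplication by [X] does not change [J] of a [gegen k.+1], whose mean is zero. As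
    [k + 2 = (2 k + m + 3) - (k + m + 1)], the recurrence then propagates a constant value; [J1]
    says exactly that degrees 0 and 1 agree. *)
Lemma J_gegen k : J (gegen k) = J 1.
Proof.
have JX (p : {poly R}) : J ('X * p) = J p - E p.
  by rewrite -J_weight mulrBl mul1r linearB /= opprB addrCA subrr addr0.
have E0 l : E (gegen l.+1) = 0.
  by have := @gegen_orthogonal l.+1 0 isT; rewrite gegen0 mulr1.
have g1 : J (gegen 1) = J 1.
  by rewrite gegen_deg1 linearZ /= -['X]mulr1 JX; apply: (eq_of_subr J1); ring.
elim/ltn_ind: k => -[_|[_|k IH]]; rewrite ?gegen0//.
have := congr1 J (gegen_rec k); rewrite linearB !linearZ /= JX E0 subr0.
rewrite (IH k.+1)// (IH k)// => H.
have k2 : (k%:R + 2 : R) != 0 by rewrite -natrD addn2 pnatr_eq0.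
by apply: (mulfI k2); rewrite H; ring.
Qed.

(** For [i <= j], replace [gegen i] by its value at 1: the difference is divisible by [1 - X], which
    cancels the weight, and the quotient has degree below [j], hence is orthogonal to [gegen j]. *)
Lemma J_gegenM i j : J (gegen i * gegen j) = (gegen (minn i j)).[1] * J 1.
Proof.
wlog ij : i j / (i <= j)%N => [H|].
  by have /orP[/H //|/H ji] := leq_total i j; rewrite (mulrC (gegen i)) minnC.
rewrite (minn_idPl ij).
have /factor_theorem[q qE] : root (gegen i - (gegen i).[1]%:P) 1.
  by rewrite /root !hornerE subrr.
have -> : gegen i * gegen j =
    (gegen i).[1] *: gegen j - (1 - 'X) * (q * gegen j).
  rewrite -[X in X * _ = _](subrK (gegen i).[1]%:P) qE -mul_polyC.
  by rewrite -['X - 1%:P]/('X - 1); ring.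
rewrite linearB linearZ /= J_gegen J_weight.
have [->|q0] := eqVneq q 0; first by rewrite mul0r linear0 subr0.
rewrite gegen_orthogonal_size ?subr0//.
have : (size (q * ('X - 1%:P))%R <= i.+1)%N.
  rewrite -qE (leq_trans (size_polyD _ _))// geq_max size_gegen leqnn.
  by rewrite size_polyN (leq_trans (size_polyC_leq1 _)).
rewrite size_Mmonic ?monicXsubC// size_XsubC addn2 /= ltnS => sq.
exact: leq_trans sq ij.
Qed.

End weighted.
End functional.
End gegenbauer_polynomials.

(** * Determinants of kernel matrices *)

(** Schur complement with the adjugate in place of the inverse: right multiplication by [N] clears
    the column [v], at the price of the factor [\det A] on both sides. *)
Lemma det_border_mul (R : idomainType) n (c : 'M[R]_1) (w : 'rV[R]_n) (v : 'cV[R]_n) (A : 'M[R]_n) :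
  \det (block_mx c w v A) * \det A =
  (\det A * c 0 0 - (w *m \adj A *m v) 0 0) * \det A.
Proof.
pose N := block_mx (\det A)%:M 0 (- (\adj A *m v)) 1%:M : 'M[R]_(1 + n).
have dN : \det N = \det A by rewrite det_lblock det_scalar expr1 det1 mulr1.
rewrite -[X in _ * X = _]dN -det_mulmx mulmx_block !mulmx0 !mulmx1 !add0r.
rewrite !mulmxN !mulmxA mul_mx_adj mul_mx_scalar mul_scalar_mx.
rewrite mul_mx_scalar subrr det_ublock det_mx11 !mxE.
by congr ((_ - _) * _); rewrite mxE.
Qed.

(* [\det (A + X)] is monic, hence cancellable; then set [X = 0]. *)
Lemma det_border (R : idomainType) n (c : 'M[R]_1) (w : 'rV[R]_n) (v : 'cV[R]_n) (A : 'M[R]_n) :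
  \det (block_mx c w v A) = \det A * c 0 0 - (w *m \adj A *m v) 0 0.
Proof.
pose C := map_mx (@polyC R).
pose A' := char_poly_mx (- A).
have dA' : \det A' != 0.
  exact: (monic_neq0 (char_poly_monic _)).
pose f : {rmorphism {poly R} -> R} := horner_eval (0 : R).
have fC p q (M : 'M[R]_(p, q)) : map_mx f (C _ _ M) = M.
  by apply/matrixP => i j; rewrite !mxE /f /= /horner_eval hornerC.
have fA : map_mx f A' = A.
  apply/matrixP => i j; rewrite !mxE /f /= /horner_eval.
  by rewrite hornerD hornerN hornerMn hornerX mul0rn hornerC add0r opprK.
have := congr1 f (mulIf dA' (det_border_mul (C _ _ c) (C _ _ w) (C _ _ v) A')).
rewrite rmorphB rmorphM -!det_map_mx map_block_mx !fC fA => ->.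
have f00 (M : 'M[{poly R}]_1) : f (M 0 0) = (map_mx f M) 0 0 by rewrite mxE.
by rewrite !f00 !map_mxM map_mx_adj !fC fA.
Qed.

Section gram.
Variables (R : comNzRingType) (T : eqType) (K : T -> T -> R).

Definition kernel_mx n (x : n.-tuple T) : 'M[R]_n :=
  \matrix_(i, j) K (tnth x i) (tnth x j).

(** Indexing by a sequence lets points be inserted, appended and permuted without transport along
    equalities of sizes. *)
Definition kernel_det (s : seq T) : R := \det (kernel_mx (in_tuple s)).

Lemma kernel_detE n (x : n.-tuple T) : kernel_det x = \det (kernel_mx x).
Proof.
case: x => s /= sn; have := eqP sn => sn'; subst n.
by rewrite /kernel_det; congr (\det (kernel_mx _)); apply: val_inj.
Qed.

(** Rows and columns undergo the same permutation, so the two signs cancel. *)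
Lemma perm_kernel_det s t : perm_eq s t -> kernel_det s = kernel_det t.
Proof.
rewrite -[X in perm_eq _ X]/(tval (in_tuple t)) => /tuple_permP[p ->].
rewrite kernel_detE /kernel_det.
have -> : kernel_mx [tuple tnth (in_tuple t) (p i) | i < size t] =
    row_perm p (col_perm p (kernel_mx (in_tuple t))).
  by apply/matrixP => i j; rewrite !mxE !tnth_mktuple.
rewrite row_permE col_permE !det_mulmx !det_perm mulrCA odd_permV.
by rewrite -signr_addb addbb expr0 mulr1.
Qed.

End gram.

(** The new point [t] occurs only in [K t t] and in products [K x t * K t y], which are what the
    trace and the reproducing property integrate. *)
Lemma kernel_det_cons (R : idomainType) (T : eqType) (K : T -> T -> R) t (s : seq T) :
  let A := kernel_mx K (in_tuple s) in
  kernel_det K (t :: s) = \det A * K t t -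
    \sum_(j < size s) \sum_(i < size s)
      \adj A i j * (K (tnth (in_tuple s) j) t * K t (tnth (in_tuple s) i)).
Proof.
move=> A; rewrite /kernel_det.
have -> : kernel_mx K (in_tuple (t :: s)) =
  block_mx (K t t)%:M (\row_i K t (tnth (in_tuple s) i))
    (\col_i K (tnth (in_tuple s) i) t) A :> 'M_(1 + size s).
  have E0 : tnth (in_tuple (t :: s)) ord0 = t by [].
  have ES i : tnth (in_tuple (t :: s)) (lift ord0 i) = tnth (in_tuple s) i.
    by rewrite !(tnth_nth t).
  apply/matrixP => i j; rewrite [RHS]mxE.
  case: (splitP i) => i' ii'; rewrite [RHS]mxE; case: (splitP j) => j' jj'.
  - rewrite !ord1 in ii' jj' *; have -> : i = ord0 by apply: val_inj.
    have -> : j = ord0 by apply: val_inj.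
    by rewrite !mxE !E0.
  - have -> : i = ord0 by apply: val_inj; rewrite /= ii' ord1.
    have -> : j = lift ord0 j' by apply: val_inj; rewrite /= jj'.
    by rewrite !mxE E0 ES.
  - have -> : j = ord0 by apply: val_inj; rewrite /= jj' ord1.
    have -> : i = lift ord0 i' by apply: val_inj; rewrite /= ii'.
    by rewrite !mxE E0 ES.
  - have -> : i = lift ord0 i' by apply: val_inj; rewrite /= ii'.
    have -> : j = lift ord0 j' by apply: val_inj; rewrite /= jj'.
    by rewrite !mxE !ES.
rewrite det_border !mxE eqxx mulr1n; congr (_ - _).
apply: eq_bigr => j _; rewrite !mxE mulr_suml; apply: eq_bigr => i _.
by rewrite !mxE; ring.
Qed.

From mathcomp Require Import all_classical all_reals all_analysis.
From mathcomp Require Import measurable_realfun.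
Import Order.TTheory GRing.Theory Num.Theory.
Import numFieldNormedType.Exports.
Local Open Scope classical_set_scope.
Local Open Scope ring_scope.

(** * The orthogonality relation of the Gegenbauer weight *)

Section gegenbauer_weight.
Context {R : realType}.
Variable m : nat.
Local Notation mu := (@lebesgue_measure R).

(** For [d = m + 2] the exponent [alpha - 1/2] is [m / 2], so the weight is an integer power of a
    square root, continuous on the whole line. *)
Definition sqrt_weight (n : nat) (t : R) : R := Num.sqrt (1 - t ^+ 2) ^+ n.

Lemma gegenbauer_weightE (t : R) : -1 <= t <= 1 ->
  gegenbauer_weight (gegenbauer_index m.+2) t = sqrt_weight m t.
Proof.
move=> t1; have t0 : 0 <= 1 - t ^+ 2.
  by rewrite subr_ge0 -ler_sqrt// sqrtr_sqr sqrtr1 ler_norml.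
rewrite /gegenbauer_weight /gegenbauer_index /sqrt_weight.
have -> : (m.+2%:R - 1) / 2 - 2^-1 = 2^-1 * m%:R :> R.
  by rewrite -addn2 natrD; field.
by rewrite powRrM powR12_sqrt// powR_mulrn// sqrtr_ge0.
Qed.

Lemma sqrt_weightE n :
  sqrt_weight n = horner 'X^n \o (Num.sqrt \o horner (1 - 'X^2)) :> (R -> R).
Proof. by apply/funext => t; rewrite /sqrt_weight /= !hornerE. Qed.

Lemma continuous_sqrt_weight n : continuous (sqrt_weight n).
Proof.
rewrite sqrt_weightE => t; apply: continuous_comp; last exact: continuous_horner.
by apply: continuous_comp; [exact: continuous_horner|exact: sqrt_continuous].
Qed.

Lemma continuous_horner_weight n (p : {poly R}) :
  continuous (fun t => p.[t] * sqrt_weight n t).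
Proof.
move=> t; apply: continuousM; first exact: continuous_horner.
exact: continuous_sqrt_weight.
Qed.

Lemma integrable_horner_weight (p : {poly R}) :
  mu.-integrable `[(-1), 1] (EFin \o (fun t => p.[t] * sqrt_weight m t)).
Proof.
apply: continuous_compact_integrable; first exact: segment_compact.
by apply: continuous_subspaceT => t; exact: continuous_horner_weight.
Qed.

Definition weight_integral (p : {poly R}) : R :=
  \int[mu]_(t in `[(-1), 1]) (p.[t] * sqrt_weight m t).

Lemma weight_integral_is_linear : scalar weight_integral.
Proof.
move=> a p q; rewrite /weight_integral.
under eq_Rintegral do rewrite hornerD hornerZ mulrDl -mulrA.
rewrite RintegralD//=; last 2 first.
- have := integrable_horner_weight (a *: p).
  by apply: eq_integrable => // t _; rewrite /= hornerZ mulrA.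
- exact: integrable_horner_weight.
by rewrite RintegralZl//; exact: integrable_horner_weight.
Qed.

HB.instance Definition _ := GRing.isLinear.Build R {poly R} R *%R weight_integral
  weight_integral_is_linear.

Lemma is_derive_sqrt_weight n (t : R) : -1 < t < 1 ->
  is_derive t 1 (sqrt_weight n.+2) (- (n%:R + 2) * t * sqrt_weight n t).
Proof.
move=> /andP[t1 t2].
have s0 : 0 < 1 - t ^+ 2 by nra.
have s0' : 0 < (1 - 'X^2 : {poly R}).[t] by rewrite !hornerE.
rewrite sqrt_weightE.
have d1 := is_derive1_comp (is_derive1_sqrt s0') (is_derive_poly (1 - 'X^2) t).
have := is_derive1_comp (is_derive_poly 'X^(n.+2) _) d1.
move=> /is_derive_eq; apply.
rewrite derivXn derivB derivC derivXn hornerMn hornerXn sub0r hornerN hornerMn.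
rewrite -/('X^1) hornerXn expr1 /= !hornerE /sqrt_weight.
rewrite -[_ *+ n.+2]mulr_natl -[t *+ 2]mulr_natl exprS -natr1 -natr1.
have : Num.sqrt (1 - t ^+ 2) != 0 by rewrite sqrtr_eq0 -ltNge.
set r := Num.sqrt _ => r0.
change ((n%:R + 1 + 1) * (r * r ^+ n) / (2 * r) * - (2 * t) =
  - (n%:R + 1 + 1) * t * r ^+ n).
by field.
Qed.

(** The difference of the two sides is the integral of the derivative of [p] times
    [sqrt_weight m.+2], a function vanishing at both endpoints. *)
Lemma weight_integral_by_parts (p : {poly R}) :
  weight_integral ((1 - 'X^2) * p^`()) = (m%:R + 2) * weight_integral ('X * p).
Proof.
apply/eqP; rewrite -subr_eq0 -linearZ -linearB /=; apply/eqP.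
set q := (X in weight_integral X).
have cF : continuous (fun t => p.[t] * sqrt_weight m.+2 t).
  exact: continuous_horner_weight.
have dF (t : R) : -1 < t < 1 ->
  is_derive t 1 (fun t => p.[t] * sqrt_weight m.+2 t) (q.[t] * sqrt_weight m t).
  move=> t1; have := is_deriveM (is_derive_poly p t) (is_derive_sqrt_weight m t1).
  move=> /is_derive_eq; apply.
  have s0 : 0 <= 1 - t ^+ 2 by case/andP: t1 => ? ?; nra.
  have r2 := sqr_sqrtr s0; rewrite /q !hornerE /sqrt_weight.
  move: r2; set r := Num.sqrt _ => <-; rewrite /GRing.scale /=.
  by rewrite !exprS; ring.
have w1 (t : R) : t ^+ 2 = 1 -> sqrt_weight m.+2 t = 0.
  by move=> t1; rewrite /sqrt_weight t1 subrr sqrtr0 exprS mul0r.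
rewrite /weight_integral /Rintegral.
rewrite (@continuous_FTC2 R _ (fun t => p.[t] * sqrt_weight m.+2 t) (-1) 1) ?gtrN//.
- by rewrite /= !w1 ?mulr0 ?subrr// ?sqrrN expr1n.
- by apply: continuous_subspaceT => t; exact: continuous_horner_weight.
- split.
  + by move=> t; rewrite in_itv /= => /dF [].
  + exact/cvg_at_right_filter/cF.
  + exact/cvg_at_left_filter/cF.
- by move=> t; rewrite in_itv /= => /dF dFt; rewrite derive1E derive_val.
Qed.

Lemma weight_integral1_neq0 : weight_integral 1 != 0.
Proof.
rewrite gt_eqF//.
have w0 (t : R) : 0 <= sqrt_weight m t by rewrite exprn_ge0// sqrtr_ge0.
(* On the interval from [-1/2] to [1/2] one has [1 - t^2 >= 3/4], so [c] bounds the weight from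
   below there. *)
pose c : R := Num.sqrt (3 / 4) ^+ m.
have c0 : 0 < c by rewrite exprn_gt0// sqrtr_gt0; lra.
rewrite /weight_integral /Rintegral -lte_fin fineK; last first.
  by apply: integrable_fin_num => //; exact: integrable_horner_weight.
have half : (2^-1 : R) > - 2^-1 by lra.
apply: (@lt_le_trans _ _ (\int[mu]_(t in `[(- 2^-1)%R, (2^-1)%R]) c%:E)%E).
  rewrite integral_cst//= lebesgue_measure_itv /= lte_fin half.
  by rewrite -EFinB -EFinM lte_fin; nra.
apply: (@le_trans _ _ (\int[mu]_(t in `[(- 2^-1)%R, (2^-1)%R]) (sqrt_weight m t)%:E)%E).
  apply: ge0_le_integral => //.
  - by move=> t _; rewrite lee_fin ltW.
  - apply/measurable_EFinP; apply: measurable_funTS.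
    by apply: continuous_measurable_fun; exact: continuous_sqrt_weight.
  - move=> t; rewrite /= in_itv /= => /andP[t1 t2]; rewrite lee_fin.
    rewrite /c /sqrt_weight lerXn2r ?nnegrE ?sqrtr_ge0//.
    by rewrite ler_wsqrtr//; nra.
under [leRHS]eq_integral do rewrite hornerC mul1r.
apply: ge0_subset_integral => //.
- apply/measurable_EFinP; apply: measurable_funTS.
  by apply: continuous_measurable_fun; exact: continuous_sqrt_weight.
- by move=> t _; rewrite lee_fin.
- move=> t /=; rewrite !in_itv /= => /andP[t1 t2]; lra.
Qed.

(** [gegenbauer] is a choice among the families with the three properties; [gegen] shows that there
    is one and [gegen_unique] that there is no other. *)
Lemma gegenbauerE k : gegenbauer m.+2 k = gegen R m k.
Proof.
have family C : is_gegenbauer_family m.+2 C <->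
  [/\ forall k, size (C k) = k.+1,
    forall k l, k != l -> weight_integral (C k * C l) = 0
  & forall k, (C k).[1] = 'C(k + m, m)%:R].
  have intE i j : (\int[mu]_(t in `[(-1)%R, 1%R])
      ((C i).[t] * (C j).[t] * gegenbauer_weight (gegenbauer_index m.+2) t)%:E)%E
      = (weight_integral (C i * C j))%:E.
    rewrite /weight_integral /Rintegral fineK; last first.
      by apply: integrable_fin_num => //; exact: integrable_horner_weight.
    apply: eq_integral => t; rewrite inE /= in_itv /= => t1.
    by rewrite gegenbauer_weightE// hornerM.
  have binE l : 'C(m.+2 + l - 2, l) = 'C(l + m, m).
    by rewrite -[RHS]bin_sub ?leq_addl// addnK; congr 'C(_, _); lia.
  split=> -[sC oC C1]; split => //.
  - by move=> i j ij; have := oC i j ij; rewrite intE => -[].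
  - by move=> i; rewrite C1 binE.
  - by move=> i j ij; rewrite intE oC.
  - by move=> i; rewrite C1 binE.
have ex : is_gegenbauer_family m.+2 (gegen R m).
  apply/family; split.
  - exact: size_gegen.
  - exact: gegen_orthogonal weight_integral_by_parts.
  - exact: horner_gegen1.
have /family[sC oC C1] := xgetPex (fun=> 0 : {poly R}) (ex_intro _ _ ex).
apply: (@gegen_unique R m (weight_integral : {scalar {poly R}}) weight_integral_by_parts); [exact: weight_integral1_neq0|exact: sC|exact: oC|exact: C1].
Qed.

End gegenbauer_weight.

(** * Determinantal pair expectations *)

Section Rintegral_facts.
Context d (T : measurableType d) (R : realType) (mu : {measure set T -> \bar R}).

Lemma integrableT_sum (I : Type) (s : seq I) (f : I -> T -> R) :
  (forall i, mu.-integrable setT (EFin \o f i)) ->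
  mu.-integrable setT (EFin \o (fun x => \sum_(i <- s) f i x)).
Proof.
move=> fi; have := @integrable_sum _ _ _ mu setT measurableT I s xpredT (fun i => EFin \o f i) (fun i _ => fi i).
by apply: eq_integrable => // x _; rewrite /= sumEFin.
Qed.

Lemma Rintegral_sum (I : Type) (s : seq I) (f : I -> T -> R) :
  (forall i, mu.-integrable setT (EFin \o f i)) ->
  \int[mu]_x (\sum_(i <- s) f i x) = \sum_(i <- s) \int[mu]_x f i x.
Proof.
move=> fi; elim: s => [|i s IH].
  by under eq_Rintegral do rewrite big_nil; rewrite big_nil Rintegral_cst ?mul0r.
under eq_Rintegral do rewrite big_cons.
by rewrite big_cons RintegralD ?IH//; exact: integrableT_sum.
Qed.

Lemma integrableT_Zl (c : R) (f : T -> R) : mu.-integrable setT (EFin \o f) ->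
  mu.-integrable setT (EFin \o (fun x => c * f x)).
Proof. by move=> /(integrableZl measurableT c). Qed.

Lemma integrableT_D (f g : T -> R) : mu.-integrable setT (EFin \o f) ->
  mu.-integrable setT (EFin \o g) ->
  mu.-integrable setT (EFin \o (fun x => f x + g x)).
Proof. by move=> fi gi; have := integrableD measurableT fi gi. Qed.

Lemma bounded_setT (f : T -> R) (B : R) : (forall x, `|f x| <= B) ->
  [bounded f x | x in [set: T]].
Proof.
move=> fB; exists B; split; first by rewrite num_real.
by move=> M BM x _ /=; rewrite (le_trans (fB x))// ltW.
Qed.

Lemma integrableT_M (f g : T -> R) (B : R) : mu.-integrable setT (EFin \o f) ->
  measurable_fun setT g -> (forall x, `|g x| <= B) ->
  mu.-integrable setT (EFin \o (fun x => f x * g x)).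
Proof.
move=> fi mg /bounded_setT gB.
by have := integrableMl measurableT fi mg gB.
Qed.

Lemma integrableT_bounded (f : T -> R) (B : R) : (mu setT < +oo)%E ->
  measurable_fun setT f -> (forall x, `|f x| <= B) ->
  mu.-integrable setT (EFin \o f).
Proof. by move=> muT mf /bounded_setT fB; exact: measurable_bounded_integrable. Qed.

End Rintegral_facts.

Section product_integrable.
Context d1 d2 (T1 : measurableType d1) (T2 : measurableType d2) (R : realType).
Variables (m1 : {sigma_finite_measure set T1 -> \bar R}).
Variables (m2 : {sigma_finite_measure set T2 -> \bar R}).

Lemma integrable_fst (f : T1 -> R) : m2 setT = 1%E ->
  m1.-integrable setT (EFin \o f) ->
  (m1 \x m2)%E.-integrable setT (EFin \o (fun p => f p.1)).
Proof.
move=> m21 fi; have /measurable_EFinP mf := measurable_int _ fi.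
apply/integrable12ltyP.
  by apply/measurable_EFinP; exact: (measurableT_comp mf).
move/integrableP : fi => [_]; apply: le_lt_trans.
rewrite le_eqVlt; apply/orP; left; apply/eqP; apply: eq_integral => x _.
by rewrite /= integral_cst// [X in (_ * X)%E]m21 mule1.
Qed.

Lemma integrable_snd (f : T2 -> R) : m1 setT = 1%E ->
  m2.-integrable setT (EFin \o f) ->
  (m1 \x m2)%E.-integrable setT (EFin \o (fun p => f p.2)).
Proof.
move=> m11 fi; have /measurable_EFinP mf := measurable_int _ fi.
apply/integrable21ltyP.
  by apply/measurable_EFinP; exact: (measurableT_comp mf).
move/integrableP : fi => [_]; apply: le_lt_trans.
rewrite le_eqVlt; apply/orP; left; apply/eqP; apply: eq_integral => x _.
by rewrite /= integral_cst// [X in (_ * X)%E]m11 mule1.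
Qed.

Section fubini.
Variable F : T1 * T2 -> R.
Hypothesis iF : (m1 \x m2)%E.-integrable setT (EFin \o F).

(** Integrability on the product makes the slices integrable only almost everywhere, and [fine]
    sends an infinite inner integral to 0. Asking it of every slice identifies the inner integrals
    pointwise. *)
Lemma Rintegral_prod1 :
  (forall t, m2.-integrable setT (EFin \o (fun x => F (t, x)))) ->
  \int[(m1 \x m2)%E]_p F p = \int[m1]_t \int[m2]_x F (t, x).
Proof.
move=> iFt; rewrite /Rintegral; congr fine.
rewrite -(integral12_prod_meas1 iF) /fubini_F; apply: eq_integral => t _.
by rewrite fineK; last exact: integrable_fin_num (iFt t).
Qed.

Lemma Rintegral_prod2 :
  (forall x, m1.-integrable setT (EFin \o (fun t => F (t, x)))) ->
  \int[(m1 \x m2)%E]_p F p = \int[m2]_x \int[m1]_t F (t, x).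
Proof.
move=> iFx; rewrite /Rintegral; congr fine.
rewrite -(integral21_prod_meas1 iF) /fubini_G; apply: eq_integral => x _.
by rewrite fineK; last exact: integrable_fin_num (iFx x).
Qed.

End fubini.

End product_integrable.

Lemma measurable_pair_sum d (T : measurableType d) (R : realType) (phi : T -> T -> R) q :
  measurable_fun setT (fun p : T * T => phi p.1 p.2) ->
  measurable_fun setT (fun x : q.-tuple T =>
    \sum_(i < q) \sum_(j < q | i != j) phi (tnth x i) (tnth x j)).
Proof.
move=> mphi.
apply: measurable_sum => i; under eq_fun do rewrite big_mkcond.
apply: measurable_sum => j; case: (i != j); last exact: measurable_cst.
apply: (measurableT_comp mphi (g := fun x : q.-tuple T => (tnth x i, tnth x j))).
by apply: measurable_fun_pair; exact: measurable_tnth.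
Qed.

Section power_integral.
Context d (T : measurableType d) (R : realType) (mu : probability T R).
Local Notation pw := (power_measure mu).

Lemma power_measureT q : pw q setT = 1%E.
Proof.
have := @power_measure_box _ T R mu q setT measurableT.
rewrite [X in (X ^+ q)%E](probability_setT mu) -EFin_expe expr1n => <-.
congr (pw q _).
by apply/seteqP; split.
Qed.

Section cons.
Variables (q : nat) (f : q.+1.-tuple T -> R).
Hypothesis mf : measurable_fun setT f.
Hypothesis fi : (mu \x pw q)%E.-integrable setT (EFin \o f \o @cons_pair _ T q).

Lemma integrable_power_cons : (pw q.+1).-integrable setT (EFin \o f).
Proof.
apply: (integrable_pushforward (@measurable_cons_pair _ T q)) => //.
exact/measurable_EFinP.
Qed.

Lemma Rintegral_power_cons :
  \int[pw q.+1]_x f x = \int[(mu \x pw q)%E]_p f (cons_pair p).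
Proof.
rewrite /Rintegral; congr fine.
apply: (integral_pushforward (@measurable_cons_pair _ T q)) => //.
exact/measurable_EFinP.
Qed.

End cons.
End power_integral.

(** * Integrating points out of a projection determinant *)

Section determinantal_marginals.
Context d (T : measurableType d) (R : realType) (mu : probability T R).
Local Notation pw := (power_measure mu).
Variables (K : T -> T -> R) (B : R) (n : nat).
Hypothesis mK : measurable_fun setT (fun p : T * T => K p.1 p.2).
Hypothesis K_bounded : forall x y, `|K x y| <= B.
Hypothesis K_repro : forall x z, \int[mu]_y (K x y * K y z) = K x z.
Hypothesis K_trace : \int[mu]_x K x x = n%:R.

Lemma kernel_det_bound s : `|kernel_det K s| <= (size s)`!%:R * B ^+ size s.
Proof.
have -> : (size s)`!%:R * B ^+ size s = \sum_(p : 'S_(size s)) B ^+ size s.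
  by rewrite sumr_const -card_Sn mulr_natl.
rewrite (le_trans (ler_norm_sum _ _ _))// ler_sum// => p _.
rewrite normrM normrX normrN1 expr1n mul1r normr_prod.
rewrite -[X in B ^+ X]card_ord -prodr_const ler_prod// => i _.
by rewrite normr_ge0 mxE K_bounded.
Qed.

Lemma measurable_kernel_det y q :
  measurable_fun setT (fun x : q.-tuple T => kernel_det K (y ++ x)).
Proof.
under eq_fun => x do rewrite -[y ++ x]/(tval [tuple of in_tuple y ++ x]) kernel_detE.
apply: measurable_sum => p; apply: measurable_funM; first exact: measurable_cst.
apply: measurable_prod => i _.
under eq_fun => x do rewrite mxE.
have mt j : measurable_fun setT (fun x : q.-tuple T => tnth [tuple of in_tuple y ++ x] j).
  case: (split_ordP j) => k ->.
    by under eq_fun do rewrite tnth_lshift; exact: measurable_cst.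
  by under eq_fun do rewrite tnth_rshift; exact: measurable_tnth.
apply: (measurableT_comp mK (g := fun x => (tnth _ _, tnth _ _))).
exact: measurable_fun_pair.
Qed.

Let muT : (mu setT < +oo)%E. Proof. by rewrite probability_setT ltry. Qed.

Let pwT q : (pw q setT < +oo)%E. Proof. by rewrite power_measureT ltry. Qed.

Let mKl x : measurable_fun setT (K x).
Proof. exact: (measurableT_comp mK (measurable_pair1 _)). Qed.

Let mKr z : measurable_fun setT (K ^~ z).
Proof. exact: (measurableT_comp mK (measurable_pair2 _)). Qed.

Let iKl x : mu.-integrable setT (EFin \o K x).
Proof. exact: (integrableT_bounded muT (mKl x) (K_bounded x)). Qed.

Lemma integrable_kernel_mul x z :
  mu.-integrable setT (EFin \o (fun y => K x y * K y z)).
Proof. exact: (integrableT_M (iKl x) (mKr z) (K_bounded ^~ z)). Qed.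

Lemma integrable_kernel_diag : mu.-integrable setT (EFin \o (fun x => K x x)).
Proof.
have mKd : measurable_fun setT (fun x => K x x).
  by apply: (measurableT_comp mK (g := fun x => (x, x))); exact: measurable_fun_pair.
exact: (integrableT_bounded muT mKd (fun x => K_bounded x x)).
Qed.

(** The diagonal term integrates to [n] times the determinant of [s]. In the adjugate terms the
    reproducing property turns [K x t * K t y] into an entry of [A], and they sum to the trace of
    [\adj A *m A], that is [size s] times the determinant. *)
Lemma Rintegral_kernel_det_cons s :
  \int[mu]_t kernel_det K (t :: s) = (n%:R - (size s)%:R) * kernel_det K s.
Proof.
set A := kernel_mx K (in_tuple s).
have iA j i : mu.-integrable setT (EFin \o (fun t =>
    \adj A i j * (K (tnth (in_tuple s) j) t * K t (tnth (in_tuple s) i)))).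
  by apply: integrableT_Zl; exact: integrable_kernel_mul.
under eq_Rintegral do rewrite kernel_det_cons -/A.
rewrite RintegralB//; last 2 first.
- by apply: integrableT_Zl; exact: integrable_kernel_diag.
- by apply: integrableT_sum => j; exact: integrableT_sum.
rewrite RintegralZl//; last exact: integrable_kernel_diag.
rewrite K_trace mulrBl mulrC; congr (_ - _).
rewrite Rintegral_sum; last by move=> j; exact: integrableT_sum.
transitivity (\tr (\adj A *m A)); last first.
  by rewrite mul_adj_mx mxtrace_scalar mulr_natl.
transitivity (\sum_(j < size s) \sum_(i < size s) \adj A i j * A j i); last first.
  by rewrite exchange_big; apply: eq_bigr => i _; rewrite mxE.
apply: eq_bigr => j _; rewrite Rintegral_sum//; apply: eq_bigr => i _.
rewrite RintegralZl//; last exact: integrable_kernel_mul.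
by rewrite K_repro [A j i]mxE.
Qed.

Lemma kernel_det_middle y t x : kernel_det K (y ++ t :: x) = kernel_det K (t :: y ++ x).
Proof. by apply: perm_kernel_det; apply/permPl; exact: (perm_catCA y [:: t] x). Qed.

Lemma integrable_kernel_det_cons s :
  mu.-integrable setT (EFin \o (fun t => kernel_det K (t :: s))).
Proof.
rewrite (_ : (fun t => _) = (fun t => \det (kernel_mx K (in_tuple s)) * K t t +
    (-1) * \sum_(j < size s) \sum_(i < size s) \adj (kernel_mx K (in_tuple s)) i j *
      (K (tnth (in_tuple s) j) t * K t (tnth (in_tuple s) i)))); last first.
  by apply/funext => t; rewrite kernel_det_cons mulN1r.
apply: integrableT_D; first by apply: integrableT_Zl; exact: integrable_kernel_diag.
apply: integrableT_Zl; apply: integrableT_sum => j; apply: integrableT_sum => i.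
by apply: integrableT_Zl; exact: integrable_kernel_mul.
Qed.

Lemma kernel_det_cat_bound y q (x : q.-tuple T) :
  `|kernel_det K (y ++ x)| <= (size y + q)`!%:R * B ^+ (size y + q).
Proof. by rewrite (le_trans (kernel_det_bound _))// size_cat size_tuple. Qed.

Lemma integrable_kernel_det_cat y q :
  (pw q).-integrable setT (EFin \o (fun x : q.-tuple T => kernel_det K (y ++ x))).
Proof.
exact: (integrableT_bounded (pwT q) (measurable_kernel_det y (q := q)) (@kernel_det_cat_bound y q)).
Qed.

Lemma integrable_mul_kernel_det y q (g : T * q.-tuple T -> R) :
  (mu \x pw q)%E.-integrable setT (EFin \o g) ->
  (mu \x pw q)%E.-integrable setT
    (EFin \o (fun p => g p * kernel_det K (y ++ p.1 :: p.2))).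
Proof.
move=> gi; apply: (@integrableT_M _ _ _ _ g (fun p => kernel_det K (y ++ p.1 :: p.2))
  ((size y + q.+1)`!%:R * B ^+ (size y + q.+1)) gi) => [|p].
  have mD := measurableT_comp (measurable_kernel_det y (q := q.+1))
    (@measurable_cons_pair _ T q).
  exact: mD.
exact: (kernel_det_cat_bound y (cons_pair p)).
Qed.

Lemma integrable_kernel_det_prod y q :
  (mu \x pw q)%E.-integrable setT (EFin \o (fun p : T * q.-tuple T => kernel_det K (y ++ p.1 :: p.2))).
Proof.
have i1 : (mu \x pw q)%E.-integrable setT (EFin \o (fun p => 1 : R)).
  exact: (integrable_fst (power_measureT mu q) (finite_measure_integrable_cst mu 1 measurableT)).
have := @integrable_mul_kernel_det y q (fun=> 1) i1.
by apply: eq_integrable => // p _; rewrite /= mul1r.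
Qed.

Lemma Rintegral_kernel_det_insert y q (x : q.-tuple T) : (size y + q <= n)%N ->
  \int[mu]_t kernel_det K (y ++ t :: x) = (n - (size y + q))%:R * kernel_det K (y ++ x).
Proof.
move=> yq; under eq_Rintegral do rewrite kernel_det_middle.
by rewrite Rintegral_kernel_det_cons size_cat size_tuple natrB.
Qed.

Lemma integrable_kernel_det_insert y (x : seq T) :
  mu.-integrable setT (EFin \o (fun t => kernel_det K (y ++ t :: x))).
Proof.
have := integrable_kernel_det_cons (y ++ x).
by apply: eq_integrable => // t _; rewrite /= kernel_det_middle.
Qed.

(** Points are integrated out one by one; each contributes [n] minus the number of points left,
    whence the falling factorial. The size condition keeps the subtractions exact. *)
Lemma Rintegral_kernel_det y q : (size y + q <= n)%N ->
  \int[pw q]_x kernel_det K (y ++ x) = ((n - size y) ^_ q)%:R * kernel_det K y.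
Proof.
elim: q => [|q IH] yq.
  rewrite ffactn0 mul1r (_ : (fun x : 0.-tuple T => _) = fun=> kernel_det K y).
    by rewrite Rintegral_cst// [X in fine X]power_measureT mulr1.
  by apply/funext => x; rewrite (tuple0 x) /= cats0.
rewrite Rintegral_power_cons; last 2 first.
- exact: measurable_kernel_det.
- exact: integrable_kernel_det_prod.
rewrite (Rintegral_prod2 (integrable_kernel_det_prod y q))/=; last first.
  by move=> x; exact: integrable_kernel_det_insert.
have yq' : (size y + q <= n)%N by lia.
under eq_Rintegral => x _.
  rewrite Rintegral_kernel_det_insert//.
  over.
rewrite RintegralZl//; last exact: integrable_kernel_det_cat.
rewrite IH//.
by rewrite ffactnSr natrM subnDA; ring.
Qed.

Section linear_statistic.
Variable psi : T -> R.
Hypothesis ipsi : mu.-integrable setT (EFin \o psi).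

Let mpsi : measurable_fun setT psi.
Proof. by have /measurable_EFinP := measurable_int _ ipsi. Qed.

Definition statistic1 (s : seq T) : R := \sum_(u <- s) psi u.

Lemma measurable_statistic1 q : measurable_fun setT (fun x : q.-tuple T => statistic1 x).
Proof.
under eq_fun => x do rewrite /statistic1 big_tuple.
by apply: measurable_sum => i; apply: measurableT_comp => //; exact: measurable_tnth.
Qed.

Lemma integrable_statistic1_prod q :
  (pw q).-integrable setT (EFin \o (fun x : q.-tuple T => statistic1 x)) ->
  (mu \x pw q)%E.-integrable setT (EFin \o (fun p : T * q.-tuple T => psi p.1 + statistic1 p.2)).
Proof.
move=> i1; apply: integrableT_D.
  exact: (integrable_fst (power_measureT mu q) ipsi).
exact: (integrable_snd (probability_setT mu) i1).
Qed.

Lemma integrable_statistic1 q :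
  (pw q).-integrable setT (EFin \o (fun x : q.-tuple T => statistic1 x)).
Proof.
elim: q => [|q IH].
  apply: (integrableT_bounded (B := 0) (pwT 0) (measurable_statistic1 (q := 0))).
  by move=> x; rewrite (tuple0 x) /statistic1 big_nil normr0.
apply: integrable_power_cons; first exact: measurable_statistic1.
have := integrable_statistic1_prod IH.
by apply: eq_integrable => // p _; rewrite /= /statistic1 big_cons.
Qed.

Lemma integrable_mul_kernel_det_rcons y :
  mu.-integrable setT (EFin \o (fun s => psi s * kernel_det K (rcons y s))).
Proof.
apply: (@integrableT_M _ _ _ _ psi (fun s => kernel_det K (rcons y s))
  ((size y).+1`!%:R * B ^+ (size y).+1) ipsi).
  have /measurable_EFinP := measurable_int _ (integrable_kernel_det_insert y [::]).
  by under eq_fun do rewrite -cat_rcons cats0.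
by move=> s; have := kernel_det_bound (rcons y s); rewrite size_rcons.
Qed.

Lemma integrable_statistic1_det y q :
  (pw q).-integrable setT
    (EFin \o (fun x : q.-tuple T => statistic1 x * kernel_det K (y ++ x))).
Proof.
exact: (integrableT_M (integrable_statistic1 q) (measurable_kernel_det y (q := q))
  (@kernel_det_cat_bound y q)).
Qed.

(** Each of the [q] points contributes equally, and integrating out the [q - 1] others gives the
    falling factorial. The fixed prefix [y] will hold the first point of a pair. *)
Lemma Rintegral_statistic1 y q : (size y + q <= n)%N ->
  \int[pw q]_x (statistic1 x * kernel_det K (y ++ x)) =
  (q * (n - (size y).+1) ^_ q.-1)%:R *
  \int[mu]_s (psi s * kernel_det K (rcons y s)).
Proof.
set X := (X in _ * X); elim: q => [|q IH] yq.
  rewrite (_ : (fun x : 0.-tuple T => _) = fun=> 0).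
    by rewrite Rintegral_cst// mul0r mul0n mul0r.
  by apply/funext => x; rewrite (tuple0 x) /statistic1 big_nil mul0r.
have mS : measurable_fun setT
    (fun x : q.+1.-tuple T => statistic1 x * kernel_det K (y ++ x)).
  by apply: measurable_funM; [exact: measurable_statistic1|exact: measurable_kernel_det].
have ifst : (mu \x pw q)%E.-integrable setT (EFin \o (fun p => psi p.1)).
  exact: (integrable_fst (power_measureT mu q) ipsi).
have isnd : (mu \x pw q)%E.-integrable setT
    (EFin \o (fun p : T * q.-tuple T => statistic1 p.2)).
  exact: (integrable_snd (probability_setT mu) (integrable_statistic1 q)).
have i1 := @integrable_mul_kernel_det y q _ ifst.
have i2 := @integrable_mul_kernel_det y q _ isnd.
have yq' : (size y + q <= n)%N by lia.
have yq'' : ((size y).+1 + q <= n)%N by lia.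
rewrite Rintegral_power_cons//; last first.
  have := integrableT_D i1 i2.
  by apply: eq_integrable => // p _; rewrite /= /statistic1 big_cons mulrDl.
under eq_Rintegral do rewrite /= /statistic1 big_cons mulrDl.
rewrite RintegralD// (Rintegral_prod1 i1) /=; last first.
  move=> t; apply: integrableT_Zl.
  under eq_fun do rewrite -cat_rcons.
  exact: integrable_kernel_det_cat.
rewrite (Rintegral_prod2 i2) /=; last first.
  by move=> x; apply: integrableT_Zl; exact: integrable_kernel_det_insert.
under eq_Rintegral => t _.
  under eq_Rintegral do rewrite -cat_rcons.
  rewrite RintegralZl//; last exact: integrable_kernel_det_cat.
  rewrite Rintegral_kernel_det ?size_rcons//.
  rewrite mulrCA.
  over.
under [X in _ + X]eq_Rintegral => x _.
  rewrite RintegralZl//; last exact: integrable_kernel_det_insert.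
  rewrite Rintegral_kernel_det_insert//.
  rewrite mulrCA.
  over.
rewrite !RintegralZl//; last 2 first.
- exact: integrable_statistic1_det.
- exact: integrable_mul_kernel_det_rcons.
rewrite -/X IH// [X in _ + X]mulrA -natrM -mulrDl -natrD /=.
(* At [q = 0] the truncated predecessor in the exponent comes with a factor 0, so that case is
   separate. *)
congr (_%:R * _); case: q {IH i1 i2 mS ifst isnd} yq yq' yq'' => [|q] yq yq' yq'' /=.
  by rewrite ffactn0; lia.
rewrite ffactnSr (_ : (n - (size y).+1 - q = n - (size y + q.+1))%N); last lia.
by ring.
Qed.

End linear_statistic.

(** * Pair statistics with a singular interaction *)

Section pair_statistic.
Variables (phi : T -> T -> R) (C : R).
Hypothesis mphi : measurable_fun setT (fun p : T * T => phi p.1 p.2).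
Hypothesis phi_ge0 : forall t s, 0 <= phi t s.
Hypothesis phiC : forall t s, phi t s = phi s t.
Hypothesis phi_bounded : forall t, (\int[mu]_s (phi t s)%:E <= C%:E)%E.

Let mphil t : measurable_fun setT (phi t).
Proof. exact: (measurableT_comp mphi (measurable_pair1 t)). Qed.

Let iphi t : mu.-integrable setT (EFin \o phi t).
Proof.
apply/integrableP; split; first exact/measurable_EFinP.
rewrite (le_lt_trans _ (ltry C))// (le_trans _ (phi_bounded t))//.
by rewrite le_eqVlt; apply/orP; left; apply/eqP; apply: eq_integral => s _;
  rewrite /= ger0_norm.
Qed.

(** The sum over ordered pairs, cut recursively to match [power_measure], which adds one coordinate
    at a time. The factor 2 anticipates the symmetry of [phi]. *)
Fixpoint statistic2 (s : seq T) : R :=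
  if s is t :: s' then statistic2 s' + 2 * statistic1 (phi t) s' else 0.

Lemma statistic2E q (x : q.-tuple T) :
  statistic2 x = \sum_(i < q) \sum_(j < q | i != j) phi (tnth x i) (tnth x j).
Proof.
elim: q x => [|q IH] x; first by rewrite (tuple0 x) big_ord0.
rewrite [in LHS](tuple_eta x) /= (IH [tuple of behead x]) big_ord_recl.
have tl i : tnth x (lift ord0 i) = tnth [tuple of behead x] i.
  by rewrite [in LHS](tuple_eta x) tnthS.
have x0 : tnth x ord0 = thead x by [].
have -> : \sum_(j < q.+1 | ord0 != j) phi (tnth x ord0) (tnth x j) =
    statistic1 (phi (thead x)) (behead x).
  rewrite big_mkcond big_ord_recl /= add0r x0 /statistic1.
  rewrite -[behead x]/(tval [tuple of behead x]) big_tuple.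
  by apply: eq_bigr => i _; rewrite tl.
have -> : \sum_(i < q) \sum_(j < q.+1 | lift ord0 i != j) phi (tnth x (lift ord0 i)) (tnth x j) =
   statistic1 (phi (thead x)) (behead x) +
   \sum_(i < q) \sum_(j < q | i != j) phi (tnth [tuple of behead x] i) (tnth [tuple of behead x] j).
  rewrite /statistic1 -[behead x]/(tval [tuple of behead x]) big_tuple -big_split /=.
  apply: eq_bigr => i _; rewrite big_mkcond big_ord_recl /= x0 tl phiC; congr (_ + _).
  rewrite [RHS]big_mkcond; apply: eq_bigr => j _.
  by rewrite (inj_eq lift_inj) tl.
by ring.
Qed.

Lemma measurable_statistic2 q : measurable_fun setT (fun x : q.-tuple T => statistic2 x).
Proof. by under eq_fun do rewrite statistic2E; exact: measurable_pair_sum. Qed.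

(** As [phi] may be unbounded, Tonelli is used with [t] integrated first and the other points fixed;
    symmetry then makes [phi_bounded] apply to each term. *)
Lemma integrable_interaction q :
  (mu \x pw q)%E.-integrable setT
    (EFin \o (fun p : T * q.-tuple T => statistic1 (phi p.1) p.2)).
Proof.
have mi i : measurable_fun setT (fun p : T * q.-tuple T => phi p.1 (tnth p.2 i)).
  apply: (measurableT_comp mphi (g := fun p : T * q.-tuple T => (p.1, tnth p.2 i))).
  apply: measurable_fun_pair => //.
  exact: (measurableT_comp (measurable_tnth i)).
have ii i : (mu \x pw q)%E.-integrable setT
    (EFin \o (fun p : T * q.-tuple T => phi p.1 (tnth p.2 i))).
  apply/integrable21ltyP; first exact/measurable_EFinP.
  apply: (@le_lt_trans _ _ (\int[pw q]_x C%:E)%E); last first.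
    by rewrite integral_cst// [X in (_ * X)%E]power_measureT mule1 ltry.
  apply: ge0_le_integral => //.
  - by move=> x _; apply: integral_ge0.
  - apply: (@measurable_fun_fubini_tonelli_G _ _ _ _ R mu
      (fun p : T * q.-tuple T => `|(phi p.1 (tnth p.2 i))%:E|%E)) => //.
    by apply: measurableT_comp => //; exact/measurable_EFinP.
  - move=> x _ /=; rewrite (le_trans _ (phi_bounded (tnth x i)))//.
    rewrite le_eqVlt; apply/orP; left; apply/eqP; apply: eq_integral => t _.
    by rewrite phiC ger0_norm.
have := integrableT_sum (index_enum 'I_q) ii.
by apply: eq_integrable => // p _; rewrite /= /statistic1 big_tuple.
Qed.

Lemma kernel_det2 t s : kernel_det K [:: t; s] = K t t * K s s - K t s * K s t.
Proof.
rewrite kernel_det_cons !big_ord1 det_mx11 !mxE /cofactor !(expr0, mul1r, det_mx00).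
by rewrite !(tnth_nth s) /=; ring.
Qed.

Let integrable_pair :
  mu.-integrable setT (EFin \o (fun t => \int[mu]_s (phi t s * kernel_det K [:: t; s]))).
Proof.
have i1 : (mu \x mu)%E.-integrable setT (EFin \o (fun p : T * T => phi p.1 p.2)).
  apply/integrable12ltyP; first exact/measurable_EFinP.
  apply: (@le_lt_trans _ _ (\int[mu]_x C%:E)%E); last first.
    by rewrite integral_cst// [X in (_ * X)%E](probability_setT mu) mule1 ltry.
  apply: ge0_le_integral => //.
  - by move=> x _; apply: integral_ge0.
  - apply: (@measurable_fun_fubini_tonelli_F _ _ _ _ R mu
      (fun p : T * T => `|(phi p.1 p.2)%:E|%E)) => //.
    by apply: measurableT_comp => //; exact/measurable_EFinP.
  - move=> t _ /=; rewrite (le_trans _ (phi_bounded t))//.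
    rewrite le_eqVlt; apply/orP; left; apply/eqP; apply: eq_integral => s _.
    by rewrite ger0_norm.
have m2 : measurable_fun setT (fun p : T * T => kernel_det K [:: p.1; p.2]).
  have mKp (f g : T * T -> T) : measurable_fun setT f -> measurable_fun setT g ->
      measurable_fun setT (fun p => K (f p) (g p)).
    by move=> mf mg; apply: (measurableT_comp mK (g := fun p => (f p, g p)));
      exact: measurable_fun_pair.
  under eq_fun do rewrite kernel_det2.
  by apply: measurable_funB; apply: measurable_funM; exact: mKp.
have i2 : (mu \x mu)%E.-integrable setT
    (EFin \o (fun p : T * T => phi p.1 p.2 * kernel_det K [:: p.1; p.2])).
  exact: (integrableT_M (B := 2`!%:R * B ^+ 2) i1 m2 (fun p => kernel_det_bound [:: p.1; p.2])).
have := integrable_fubini_F i2; apply: eq_integrable => // t _.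
rewrite /fubini_F /= /Rintegral fineK//; apply: integrable_fin_num => //.
have := integrableT_M (B := 2`!%:R * B ^+ 2) (iphi t) (measurableT_comp m2 (measurable_pair1 t))
  (fun s => kernel_det_bound [:: t; s]).
by apply: eq_integrable.
Qed.

Let integrable_statistic2_prod q :
  (pw q).-integrable setT (EFin \o (fun x : q.-tuple T => statistic2 x)) ->
  (mu \x pw q)%E.-integrable setT (EFin \o (fun p : T * q.-tuple T => statistic2 p.2)) /\
  (mu \x pw q)%E.-integrable setT
    (EFin \o (fun p : T * q.-tuple T => 2 * statistic1 (phi p.1) p.2)).
Proof.
move=> i2; split; first exact: (integrable_snd (probability_setT mu) i2).
by apply: integrableT_Zl; exact: integrable_interaction.
Qed.

Lemma integrable_statistic2 q :
  (pw q).-integrable setT (EFin \o (fun x : q.-tuple T => statistic2 x)).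
Proof.
elim: q => [|q IH].
  apply: (integrableT_bounded (B := 0) (pwT 0) (measurable_statistic2 (q := 0))).
  by move=> x; rewrite (tuple0 x) normr0.
apply: integrable_power_cons; first exact: measurable_statistic2.
have [i1 i2] := integrable_statistic2_prod IH.
by have := integrableT_D i1 i2.
Qed.

Lemma integrable_statistic2_det y q :
  (pw q).-integrable setT
    (EFin \o (fun x : q.-tuple T => statistic2 x * kernel_det K (y ++ x))).
Proof.
exact: (integrableT_M (integrable_statistic2 q) (measurable_kernel_det y (q := q))
  (@kernel_det_cat_bound y q)).
Qed.

(** There are [q (q - 1)] ordered pairs, and integrating out the other [q - 2] points gives the
    falling factorial. The interactions of the head [t] form a linear statistic, treated with prefix
    [[:: t]]. *)
Lemma Rintegral_statistic2 q : (q <= n)%N ->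
  \int[pw q]_x (statistic2 x * kernel_det K x) =
  (q * q.-1 * (n - 2) ^_ q.-2)%:R *
  \int[mu]_t \int[mu]_s (phi t s * kernel_det K [:: t; s]).
Proof.
set X := (X in _ * X); elim: q => [|q IH] qn.
  rewrite (_ : (fun x : 0.-tuple T => _) = fun=> 0).
    by rewrite Rintegral_cst// mul0r mul0n mul0r.
  by apply/funext => x; rewrite (tuple0 x) mul0r.
have mS : measurable_fun setT
    (fun x : q.+1.-tuple T => statistic2 x * kernel_det K x).
  by apply: measurable_funM; [exact: measurable_statistic2|exact: (measurable_kernel_det [::])].
have [ifst isnd] := integrable_statistic2_prod (integrable_statistic2 q).
have i1 := @integrable_mul_kernel_det [::] q _ ifst.
have i2 := @integrable_mul_kernel_det [::] q _ isnd.
have qn' : (q <= n)%N by lia.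
rewrite Rintegral_power_cons//; last first.
  have := integrableT_D i1 i2.
  by apply: eq_integrable => // p _; rewrite /= (mulrDl (statistic2 p.2)).
under eq_Rintegral do rewrite /= (mulrDl (statistic2 _)).
rewrite RintegralD// (Rintegral_prod2 i1) /=; last first.
  move=> x; apply: integrableT_Zl; exact: (integrable_kernel_det_insert [::]).
rewrite (Rintegral_prod1 i2) /=; last first.
  move=> t; have := integrableT_Zl 2 (integrable_statistic1_det (iphi t) [:: t] q).
  by apply: eq_integrable => // x _; rewrite /= mulrA.
under [X in X + _]eq_Rintegral => x _.
  rewrite RintegralZl//; last exact: (integrable_kernel_det_insert [::]).
  rewrite (Rintegral_kernel_det_insert (y := [::]))// add0n mulrCA.
  over.
under [X in _ + X]eq_Rintegral => t _.
  under eq_Rintegral do rewrite -mulrA.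
  rewrite RintegralZl//; last exact: (integrable_statistic1_det (iphi t) [:: t]).
  rewrite (Rintegral_statistic1 (iphi t) (y := [:: t]))//= mulrA.
  over.
rewrite [X in X + _]RintegralZl//; last exact: (integrable_statistic2_det [::]).
rewrite [X in _ + X]RintegralZl//.
rewrite -/X IH// [X in X + _]mulrA -natrM -[2]/(2%:R) -natrM -mulrDl -natrD /=.
congr (_%:R * _); case: q {IH i1 i2 mS ifst isnd} qn qn' => [|[|q]] qn qn' //=.
- by rewrite !muln0.
- by rewrite !ffactn0; lia.
rewrite ffactnSr (_ : (n - 2 - q = n - q.+2)%N); last lia.
by ring.
Qed.

(** The [n (n - 1)] pairs and the [(n - 2)!] from the other points cancel the [n!] of the density,
    leaving the two-point determinant. *)
Lemma dpp_pair_expectation : (1 < n)%N ->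
  (\int[pw n]_x ((\sum_(i < n) \sum_(j < n | i != j) phi (tnth x i) (tnth x j)) *
    dpp_density K x)%:E =
  (\int[mu]_t \int[mu]_s (phi t s * (K t t * K s s - K t s * K s t)))%:E)%E.
Proof.
move=> n1.
have densE (x : n.-tuple T) :
    (\sum_(i < n) \sum_(j < n | i != j) phi (tnth x i) (tnth x j)) * dpp_density K x =
    n`!%:R^-1 * (statistic2 x * kernel_det K x).
  by rewrite statistic2E kernel_detE /dpp_density /kernel_mx; ring.
under eq_integral do rewrite densE.
have i2 := integrable_statistic2_det [::] n.
rewrite -[LHS]fineK; last first.
  by apply: integrable_fin_num => //; exact: (integrableT_Zl n`!%:R^-1 i2).
congr EFin; transitivity (\int[pw n]_x (n`!%:R^-1 * (statistic2 x * kernel_det K x))) => //.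
rewrite RintegralZl// Rintegral_statistic2// mulrA.
have -> : (n * n.-1 * (n - 2) ^_ n.-2)%N = n`!.
  by case: n n1 => [|[|k]]// _; rewrite /= subn2 /= ffactnn !factS mulnA.
rewrite mulVf ?mul1r ?pnatr_eq0 -?lt0n ?fact_gt0//.
by apply: eq_Rintegral => t _; apply: eq_Rintegral => s _; rewrite kernel_det2.
Qed.

End pair_statistic.

End determinantal_marginals.

(** * Rotation invariance *)

Section affine_substitution.
Context {R : realType}.
Local Notation mu := (@lebesgue_measure R).

Let affine (a b : R) (x : measurableTypeR R) : measurableTypeR R := a * x + b.

Let measurable_affine a b : measurable_fun setT (affine a b).
Proof. by apply: measurable_funD => //; exact: measurable_funM. Qed.

Let image_affine a b : {measure set (measurableTypeR R) -> \bar R} :=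
  measure_function_pushforward__canonical__measure_function_Measure mu
    (measurable_affine a b).

(** Both measures agree on half-open intervals, which characterizes Lebesgue measure. *)
Let lebesgue_measure_affine (a b : R) (a0 : 0 < a) (A : set R) : measurable A ->
  mu A = mscale (NngNum (ltW a0)) (image_affine a b) A.
Proof.
move=> mA; apply: lebesgue_measure_unique => // _ [[l r] _ <-].
change (mu `]l, r] = a%:E * mu (affine a b @^-1` `]l, r]))%E.
have -> : affine a b @^-1` `]l, r] = `](l - b) / a, (r - b) / a]%classic.
  apply/seteqP; split => x /=; rewrite !in_itv /= /affine.
    by rewrite ltr_pdivrMr// ler_pdivlMr// ltrBlDr lerBrDr mulrC.
  by rewrite ltr_pdivrMr// ler_pdivlMr// ltrBlDr lerBrDr mulrC.
rewrite !lebesgue_measure_itv /= !lte_fin ltr_pM2r ?invr_gt0// ltrD2r.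
case: ifPn => _; last by rewrite mule0.
by rewrite -!EFinB -EFinM; congr EFin; field; rewrite gt_eqF.
Qed.

Lemma ge0_integral_lebesgueN (f : R -> \bar R) : measurable_fun setT f ->
  (forall x, 0 <= f x)%E -> (\int[mu]_x f (- x)%R = \int[mu]_x f x)%E.
Proof.
move=> mf f0.
rewrite -(@ge0_integral_pushforward _ _ _ _ R (-%R : measurableTypeR R -> measurableTypeR R) _ mu setT f)//.
by apply: eq_measure_integral => A mA _; exact: lebesgue_measureN.
Qed.

Lemma ge0_integral_affine (a b : R) (f : R -> \bar R) : a != 0 ->
  measurable_fun setT f -> (forall x, 0 <= f x)%E ->
  (`|a|%:E * \int[mu]_x f (a * x + b)%R = \int[mu]_x f x)%E.
Proof.
have pos (c e : R) (g : R -> \bar R) : 0 < c -> measurable_fun setT g ->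
    (forall x, 0 <= g x)%E -> (c%:E * \int[mu]_x g (c * x + e)%R = \int[mu]_x g x)%E.
  move=> c0 mg g0.
  rewrite [RHS](eq_measure_integral (mscale (NngNum (ltW c0)) (image_affine c e))).
    rewrite ge0_integral_mscale//.
    by rewrite ge0_integral_pushforward.
  by move=> A mA _; exact: lebesgue_measure_affine.
move=> a0 mf f0; have [a_gt0|a_lt0|a00] := ltgtP a 0; last by rewrite a00 eqxx in a0.
  rewrite ltr0_norm//.
  rewrite -(ge0_integral_lebesgueN mf f0).
  rewrite -(pos (- a) (- b) (fun x => f (- x))) ?oppr_gt0//.
    by congr (_ * _)%E; apply: eq_integral => x _; congr f; ring.
  by apply: measurableT_comp.
by rewrite gtr0_norm// pos.
Qed.

(** The rotation is split into two affine substitutions in one variable: [t = c x + s y] in [x],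
    then one in [y] at fixed [t], with inverse Jacobians. One rotated coordinate and the squared
    radius are all that a zonal integrand involves. *)
Lemma ge0_integral_plane_rotation (c s : R) (g : R * R -> \bar R) :
  c ^+ 2 + s ^+ 2 = 1 -> measurable_fun setT g -> (forall p, 0 <= g p)%E ->
  (\int[mu]_x \int[mu]_y g (c * x + s * y, x ^+ 2 + y ^+ 2)%R =
   \int[mu]_x \int[mu]_y g (x, x ^+ 2 + y ^+ 2)%R)%E.
Proof.
move=> cs mg g0.
have mh (h k : R * R -> R) : measurable_fun setT h -> measurable_fun setT k ->
    measurable_fun setT (fun p => g (h p, k p)).
  by move=> mh mk; apply: (measurableT_comp mg (g := fun p => (h p, k p))); exact: measurable_fun_pair.
have msq : measurable_fun setT (fun p : R * R => p.1 ^+ 2 + p.2 ^+ 2).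
  by apply: measurable_funD; exact: measurable_funX.
transitivity (\int[mu]_y \int[mu]_x g (c * x + s * y, x ^+ 2 + y ^+ 2)%R)%E.
  apply: (fubini_tonelli (m1 := mu) (m2 := mu)
    (fun p : R * R => g (c * p.1 + s * p.2, p.1 ^+ 2 + p.2 ^+ 2))) => //.
  by apply: mh => //; apply: measurable_funD; exact: measurable_funM.
(* For [c = 0] the first substitution degenerates; then [s] is 1 or -1, and the exchange of the two
   integrals already does the rotation up to a sign. *)
have [c0|c0] := eqVneq c 0.
  have s1 : `|s| = 1.
    by apply/eqP; rewrite -(@eqrXn2 _ 2)// real_normK ?num_real// expr1n -cs c0; apply/eqP; ring.
  have s0 : s != 0 by rewrite -normr_eq0 s1 oner_eq0.
    have mG : measurable_fun setT (fun p : R * R => g (p.1, p.1 ^+ 2 + p.2 ^+ 2)) by exact: mh.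
  have := measurable_fun_fubini_tonelli_F (m2 := mu) _ mG (fun p => g0 _).
  move=> /(ge0_integral_affine 0 s0) <-; last by move=> x; exact: integral_ge0.
  rewrite s1 mul1e; apply: eq_integral => y _; apply: eq_integral => x _ /=.
  congr g; congr pair; first by rewrite c0; ring.
  have -> : (s * y + 0) ^+ 2 = `|s| ^+ 2 * y ^+ 2 by rewrite real_normK ?num_real//; ring.
  by rewrite s1; ring.
pose F y t : \bar R := g (t, ((t - s * y) / c) ^+ 2 + y ^+ 2).
have mF : measurable_fun setT (fun p : R * R => F p.2 p.1).
  apply: mh => //; apply: measurable_funD; last exact: measurable_funX.
  apply: measurable_funX; apply: measurable_funM => //.
  by apply: measurable_funB => //; exact: measurable_funM.
have cn0 : `|c| != 0 by rewrite normr_eq0.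
have inner y : (\int[mu]_x g (c * x + s * y, x ^+ 2 + y ^+ 2)%R =
    `|c|^-1%:E * \int[mu]_t F y t)%E.
  have mFy : measurable_fun setT (F y) by exact: (measurableT_comp mF (measurable_pair2 y)).
  rewrite -(ge0_integral_affine (s * y) c0 mFy (fun t => g0 _)).
  rewrite muleA -EFinM mulVf// mul1e; apply: eq_integral => x _.
  by rewrite /F; congr (g (_, _)); congr (_ + _); congr (_ ^+ 2); field.
under eq_integral do rewrite inner.
have mFG := measurable_fun_fubini_tonelli_G (m1 := mu) _ mF (fun p => g0 _).
rewrite ge0_integralZl//; last by move=> y _; apply: integral_ge0 => t _; exact: g0.
rewrite [X in (_ * X)%E](_ : _ = \int[mu]_t \int[mu]_y F y t)%E; last first.
  by symmetry; exact: (fubini_tonelli (m1 := mu) (m2 := mu) (fun p : R * R => F p.2 p.1) mF (fun p => g0 _)).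
have cV0 : c^-1 != 0 by rewrite invr_eq0.
have mH : measurable_fun setT (fun p : R * R => g (p.1, p.1 ^+ 2 + p.2 ^+ 2)) by exact: mh.
(* Completing the square with [c^2 + s^2 = 1]: [((t - s y) / c)^2 + y^2 = t^2 + ((y - s t) /
   c)^2]. *)
have outer t : (\int[mu]_y F y t =
    `|c|%:E * \int[mu]_y g (t, t ^+ 2 + y ^+ 2)%R)%E.
  have mgt : measurable_fun setT (fun y : R => g (t, t ^+ 2 + y ^+ 2)).
    exact: (measurableT_comp mH (measurable_pair1 t)).
  rewrite -(ge0_integral_affine (- (s * t / c)) cV0 mgt (fun y => g0 _)).
  rewrite muleA -EFinM -normrM divff// normr1 mul1e; apply: eq_integral => y _.
  rewrite /F; congr (g (_, _)); apply/eqP; rewrite -subr_eq0; apply/eqP.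
  transitivity ((t ^+ 2 - y ^+ 2) / c ^+ 2 * (1 - (c ^+ 2 + s ^+ 2))); first by field.
  by rewrite cs subrr mulr0.
under eq_integral do rewrite outer.
have mHF := measurable_fun_fubini_tonelli_F (m2 := mu) _ mH (fun p => g0 _).
rewrite ge0_integralZl//; last by move=> t _; apply: integral_ge0 => y _; exact: g0.
by rewrite muleA -EFinM mulVf// mul1e.
Qed.

End affine_substitution.

Section power_tonelli.
Context d (T : measurableType d) (R : realType).
Variable mu : {sigma_finite_measure set T -> \bar R}.
Local Notation pw := (power_measure mu).

Section cons.
Variables (q : nat) (f : q.+1.-tuple T -> \bar R).
Hypothesis mf : measurable_fun setT f.
Hypothesis f0 : forall x, (0 <= f x)%E.

Let mfc : measurable_fun setT (f \o @cons_pair _ T q).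
Proof. exact: (measurableT_comp mf (@measurable_cons_pair _ T q)). Qed.

Let ge0_integral_power_cons :
  (\int[pw q.+1]_x f x = \int[mu \x pw q]_p f (cons_pair p))%E.
Proof.
exact: (ge0_integral_pushforward (@measurable_cons_pair _ T q) (mu \x pw q)%E
  measurableT mf (fun x _ => f0 x)).
Qed.

Lemma ge0_integral_power_cons1 :
  (\int[pw q.+1]_x f x = \int[mu]_t \int[pw q]_x f (cons_pair (t, x)))%E.
Proof. by rewrite ge0_integral_power_cons (fubini_tonelli1 _ mfc (fun p => f0 _)). Qed.

Lemma ge0_integral_power_cons2 :
  (\int[pw q.+1]_x f x = \int[pw q]_x \int[mu]_t f (cons_pair (t, x)))%E.
Proof. by rewrite ge0_integral_power_cons (fubini_tonelli2 _ mfc (fun p => f0 _)). Qed.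

End cons.

Lemma ge0_integral_power_cons_cons q (f : q.+2.-tuple T -> \bar R) :
  measurable_fun setT f -> (forall x, (0 <= f x)%E) ->
  (\int[pw q.+2]_x f x =
   \int[pw q]_z \int[mu]_t \int[mu]_s f (cons_pair (t, cons_pair (s, z))))%E.
Proof.
move=> mf f0.
have mH : measurable_fun setT
    (fun p : T * q.-tuple T * T => f (cons_pair (p.1.1, cons_pair (p.2, p.1.2)))).
  apply: (measurableT_comp mf
    (g := fun p : T * q.-tuple T * T => cons_pair (p.1.1, cons_pair (p.2, p.1.2)))).
  apply: (measurableT_comp (@measurable_cons_pair _ T q.+1)
    (g := fun p : T * q.-tuple T * T => (p.1.1, cons_pair (p.2, p.1.2)))).
  apply: measurable_fun_pair.
    exact: (measurableT_comp measurable_fst measurable_fst).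
  apply: (measurableT_comp (@measurable_cons_pair _ T q)
    (g := fun p : T * q.-tuple T * T => (p.2, p.1.2))).
  apply: measurable_fun_pair => //.
  exact: (measurableT_comp measurable_snd measurable_fst).
rewrite ge0_integral_power_cons1//.
transitivity (\int[mu]_t \int[pw q]_z \int[mu]_s f (cons_pair (t, cons_pair (s, z))))%E.
  apply: eq_integral => t _; rewrite ge0_integral_power_cons2//.
  exact: (measurableT_comp mf (measurableT_comp (@measurable_cons_pair _ T q.+1) (measurable_pair1 t))).
have := measurable_fun_fubini_tonelli_F (m2 := mu) _ mH (fun p => f0 _).
by move=> /fubini_tonelli -> // p; exact: integral_ge0.
Qed.

End power_tonelli.

Section rotation.
Context {R : realType}.
Local Notation vec m := (m.-tuple (measurableTypeR R)).
Local Notation mu := (@lebesgue_measure R).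

Lemma dot_cons_pair m (u : vec m.+1) t (x : vec m) :
  dot u (cons_pair (t, x)) = thead u * t + dot [tuple of behead u] x.
Proof.
rewrite /dot big_ord_recl; congr (_ * _ + _).
apply: eq_bigr => i _; congr (_ * _); last by rewrite tnthS.
by rewrite [in LHS](tuple_eta u) tnthS.
Qed.

Lemma sqnorm_cons_pair m t (x : vec m) :
  dot (cons_pair (t, x)) (cons_pair (t, x)) = t ^+ 2 + dot x x.
Proof.
rewrite dot_cons_pair -expr2; congr (_ + dot _ _).
by apply: val_inj.
Qed.

Lemma sqnorm_ge0 m (x : vec m) : 0 <= dot x x.
Proof. by apply: sumr_ge0 => i _; rewrite -expr2 sqr_ge0. Qed.

Lemma measurable_dot m (f g : vec m -> vec m) :
  measurable_fun setT f -> measurable_fun setT g ->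
  measurable_fun setT (fun y => dot (f y) (g y)).
Proof.
move=> mf mg; apply: measurable_sum => i.
apply: measurable_funM.
  exact: (measurableT_comp (measurable_tnth i) mf).
exact: (measurableT_comp (measurable_tnth i) mg).
Qed.

Lemma measurable_dotl m (u : vec m) : measurable_fun setT (dot u).
Proof. exact: measurable_dot. Qed.

Lemma measurable_sqnorm m : measurable_fun setT (fun y : vec m => dot y y).
Proof. exact: measurable_dot. Qed.

Lemma measurable_thead m : measurable_fun setT (fun y : vec m.+1 => thead y : R).
Proof. exact: (measurable_tnth ord0). Qed.

Lemma enorm_ge0 m (x : vec m) : 0 <= enorm x.
Proof. exact: sqrtr_ge0. Qed.

Lemma enorm_sqr m (x : vec m) : enorm x ^+ 2 = dot x x.
Proof. by rewrite sqr_sqrtr// sqnorm_ge0. Qed.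

Let tonelli1 m (f : vec m.+1 -> \bar R) : measurable_fun setT f ->
  (forall y, (0 <= f y)%E) -> (\int[lebesgue_tuple m.+1]_y f y =
    \int[mu]_t \int[lebesgue_tuple m]_x f (cons_pair (t, x)))%E.
Proof. exact: ge0_integral_power_cons1. Qed.

Let tonelli2 m (f : vec m.+2 -> \bar R) : measurable_fun setT f ->
  (forall y, (0 <= f y)%E) -> (\int[lebesgue_tuple m.+2]_y f y =
    \int[lebesgue_tuple m]_z \int[mu]_t \int[mu]_s
      f (cons_pair (t, cons_pair (s, z))))%E.
Proof. exact: ge0_integral_power_cons_cons. Qed.

(** Induction on the dimension: the induction hypothesis turns the tail of [u] onto the second axis,
    then a plane rotation of the first two coordinates merges [thead u] and the norm of the tail
    into [enorm u]. In dimension one only a reflection is left. *)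
Lemma ge0_integral_rotation m (u : vec m.+1) (g : R * R -> \bar R) :
  measurable_fun setT g -> (forall p, 0 <= g p)%E ->
  (\int[lebesgue_tuple m.+1]_y g (dot u y, dot y y) =
   \int[lebesgue_tuple m.+1]_y g (enorm u * thead y, dot y y)%R)%E.
Proof.
have mg2 k (h : R * R -> \bar R) (f1 f2 : vec k -> R) : measurable_fun setT h ->
    measurable_fun setT f1 -> measurable_fun setT f2 ->
    measurable_fun setT (fun y => h (f1 y, f2 y)).
  move=> mh m1 m2; apply: (measurableT_comp mh (g := fun y => (f1 y, f2 y))).
  exact: measurable_fun_pair.
have mhead k (c : R) : measurable_fun setT (fun y : vec k.+1 => c * thead y).
  by apply: measurable_funM => //; exact: measurable_thead.
elim: m u g => [|m IH] u g mg g0.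
  rewrite (tonelli1 (mg2 _ _ _ _ mg (measurable_dotl u) (@measurable_sqnorm 1)) (fun y => g0 _)).
  rewrite (tonelli1 (mg2 _ _ _ _ mg (mhead 0 (enorm u)) (@measurable_sqnorm 1)) (fun y => g0 _)).
  have pw0 (c : \bar R) : (\int[lebesgue_tuple 0]_x cst c x = c)%E.
    by rewrite integral_cst//= diracT mule1.
  have dot0 (x y : vec 0) : dot x y = 0 by rewrite /dot big_ord0.
  transitivity (\int[mu]_t g (thead u * t, t ^+ 2)%R)%E.
    apply: eq_integral => t _; rewrite -[RHS]pw0; apply: eq_integral => x _.
    by rewrite sqnorm_cons_pair dot_cons_pair !dot0 !addr0.
  transitivity (\int[mu]_t g (enorm u * t, t ^+ 2)%R)%E; last first.
    apply: eq_integral => t _; rewrite -[LHS]pw0; apply: eq_integral => x _.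
    by rewrite sqnorm_cons_pair dot0 addr0.
  have -> : enorm u = `|thead u|.
    rewrite /enorm (_ : dot u u = thead u ^+ 2) ?sqrtr_sqr//.
    by rewrite /dot big_ord_recl big_ord0 addr0 -expr2.
  have mgt (c : R) : measurable_fun setT (fun t : R => g (c * t, t ^+ 2)).
    apply: (measurableT_comp mg (g := fun t : R => (c * t, t ^+ 2))).
    apply: measurable_fun_pair; first exact: measurable_funM.
    exact: measurable_funX.
  have [u0|u0] := lerP 0 (thead u); first by rewrite ger0_norm.
  rewrite ltr0_norm// -(ge0_integral_lebesgueN (mgt (- thead u)))//.
  by apply: eq_integral => t _; rewrite mulrNN sqrrN.
pose u0 : R := thead u; pose u' := [tuple of behead u].
(* Intermediate form: the tail has been rotated, the head not yet. *)
pose f1 (y : vec m.+2) : R := u0 * thead y + enorm u' * tnth y (lift ord0 ord0).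
have mf1 : measurable_fun setT f1.
  apply: measurable_funD; first exact: mhead.
  by apply: measurable_funM => //; exact: measurable_tnth.
have mG f : measurable_fun setT f -> measurable_fun setT (fun y : vec m.+2 => g (f y, dot y y)).
  by move=> mf; apply: mg2 => //; exact: measurable_sqnorm.
transitivity (\int[lebesgue_tuple m.+2]_y g (f1 y, dot y y))%E.
  rewrite (tonelli1 (mG _ (measurable_dotl u)) (fun y => g0 _)).
  rewrite (tonelli1 (mG _ mf1) (fun y => g0 _)).
  apply: eq_integral => t _.
  pose gt (p : R * R) := g (u0 * t + p.1, t ^+ 2 + p.2).
  have mgt : measurable_fun setT gt.
    apply: (measurableT_comp mg (g := fun p : R * R => (u0 * t + p.1, t ^+ 2 + p.2))).
    by apply: measurable_fun_pair; exact: measurable_funD.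
  have := IH u' gt mgt (fun p => g0 _); rewrite /gt /=.
  under eq_integral do rewrite -dot_cons_pair -sqnorm_cons_pair.
  move=> ->; apply: eq_integral => x _.
  by rewrite /f1 tnthS sqnorm_cons_pair.
rewrite (tonelli2 (mG _ mf1) (fun y => g0 _)).
rewrite (tonelli2 (mG _ (mhead m.+1 (enorm u))) (fun y => g0 _)).
apply: eq_integral => z _.
have uE : enorm u ^+ 2 = u0 ^+ 2 + enorm u' ^+ 2.
  rewrite !enorm_sqr {1 2}(tuple_eta u).
  have -> : [tuple of thead u :: [tuple of behead u]] = cons_pair (thead u, [tuple of behead u]) by [].
  by rewrite sqnorm_cons_pair.
(* A zero [u] defines no angle, but then the two integrands coincide. *)
have [r0|r0] := eqVneq (enorm u) 0.
  have [u00 u'0] : u0 = 0 /\ enorm u' = 0.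
    move: uE; rewrite r0 expr0n /= => /esym/eqP.
    by rewrite paddr_eq0 ?sqr_ge0// !sqrf_eq0 => /andP[/eqP ? /eqP ?].
  apply: eq_integral => t _; apply: eq_integral => s _.
  by rewrite /f1 r0 u00 u'0 !mul0r addr0.
pose gz (p : R * R) := g (enorm u * p.1, p.2 + dot z z).
have mgz : measurable_fun setT gz.
  apply: (measurableT_comp mg (g := fun p : R * R => (enorm u * p.1, p.2 + dot z z))).
  apply: measurable_fun_pair; first exact: measurable_funM.
  exact: measurable_funD.
have cs : (u0 / enorm u) ^+ 2 + (enorm u' / enorm u) ^+ 2 = 1.
  by rewrite !expr_div_n -mulrDl -uE divff// expf_neq0.
have := ge0_integral_plane_rotation cs mgz (fun p => g0 _).
rewrite /gz /= => eqr; transitivity (\int[mu]_t \int[mu]_s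
  g (enorm u * (u0 / enorm u * t + enorm u' / enorm u * s), t ^+ 2 + s ^+ 2 + dot z z)%R)%E.
  apply: eq_integral => t _; apply: eq_integral => s _.
  rewrite !sqnorm_cons_pair addrA; congr (g (_, _)).
  transitivity (u0 * t + enorm u' * s : R); first by rewrite /f1 tnthS.
  have scaleK (a w : R) : enorm u * (a / enorm u * w) = a * w by field.
  by rewrite mulrDr !scaleK.
rewrite eqr; apply: eq_integral => t _; apply: eq_integral => s _.
by rewrite !sqnorm_cons_pair addrA.
Qed.

End rotation.

Section dot_product.
Context {R : realType}.
Local Notation vec m := (m.-tuple (measurableTypeR R)).

Definition lincomb m (a : R) (x : vec m) (b : R) (z : vec m) : vec m :=
  [tuple a * (tnth x i : R) + b * (tnth z i : R) | i < m].

Lemma dotC m (x y : vec m) : dot x y = dot y x.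
Proof. by apply: eq_bigr => i _; rewrite mulrC. Qed.

Lemma dot_lincombl m a (x : vec m) b z y :
  dot (lincomb a x b z) y = a * dot x y + b * dot z y.
Proof.
rewrite /dot !mulr_sumr -big_split /=; apply: eq_bigr => i _.
by rewrite tnth_mktuple; ring.
Qed.

Lemma sqnorm_lincomb m a (x : vec m) b z : dot (lincomb a x b z) (lincomb a x b z) =
  a ^+ 2 * dot x x + 2 * a * b * dot x z + b ^+ 2 * dot z z.
Proof.
rewrite dot_lincombl !(dotC _ (lincomb _ _ _ _)) !dot_lincombl (dotC z x); ring.
Qed.

Lemma sqnorm_unit m (x : vec m) : enorm x = 1 -> dot x x = 1.
Proof. by move=> x1; rewrite -enorm_sqr x1 expr1n. Qed.

Lemma enorm_unit m (x : vec m) : dot x x = 1 -> enorm x = 1.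
Proof. by move=> x1; rewrite /enorm x1 sqrtr1. Qed.

Lemma dot_unit_bound m (x y : vec m) : enorm x = 1 -> enorm y = 1 -> `|dot x y| <= 1.
Proof.
move=> /sqnorm_unit x1 /sqnorm_unit y1.
have := sqnorm_ge0 (lincomb 1 x 1 y); have := sqnorm_ge0 (lincomb 1 x (-1) y).
rewrite !sqnorm_lincomb x1 y1 ler_norml; nra.
Qed.

Lemma euclid_dist_unit m (x y : vec m) : enorm x = 1 -> enorm y = 1 ->
  euclid_dist x y ^+ 2 = 2 - 2 * dot x y.
Proof.
move=> /sqnorm_unit x1 /sqnorm_unit y1.
rewrite /euclid_dist enorm_sqr.
rewrite (_ : [tuple _ | _ < m] = lincomb 1 x (-1) y).
  by rewrite sqnorm_lincomb x1 y1; ring.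
by apply: eq_from_tnth => i; rewrite !tnth_mktuple mul1r mulN1r.
Qed.

Lemma enorm_eq0 m (x : vec m) : enorm x = 0 -> forall y, dot x y = 0.
Proof.
move=> x0 y; have /eqP : dot x x = 0 by rewrite -enorm_sqr x0 expr0n.
rewrite psumr_eq0 => [/allP xi|i _]; last by rewrite -expr2 sqr_ge0.
apply: big1 => i _; have := xi i (mem_index_enum _).
by rewrite -expr2 sqrf_eq0 => /eqP ->; rewrite mul0r.
Qed.

Lemma dot_direction m (u y : vec m) : dot u (direction y) = (enorm y)^-1 * dot u y.
Proof.
rewrite /dot mulr_sumr; apply: eq_bigr => i _.
by rewrite tnth_mktuple mulrCA.
Qed.

Lemma enorm_direction m (y : vec m) : 0 < enorm y -> enorm (direction y) = 1.
Proof.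
move=> y0; apply: enorm_unit; rewrite dot_direction dotC dot_direction -enorm_sqr.
by field; rewrite gt_eqF.
Qed.

Lemma thead_direction m (y : vec m.+1) : thead (direction y) = (enorm y)^-1 * thead y :> R.
Proof. by rewrite /thead tnth_mktuple. Qed.

End dot_product.

(** * The surface measure and its invariance *)

Section sphere.
Context {R : realType}.
Variable d : nat.
Local Notation vec m := (m.-tuple (measurableTypeR R)).
Local Notation sigma := (@sphere_measure R d).

Definition unit_sphere : set (vec d.+1) := [set y | enorm y = 1].

Lemma measurable_unit_sphere : measurable unit_sphere.
Proof.
rewrite -[X in measurable X]setTI.
rewrite (_ : unit_sphere = @enorm R d.+1 @^-1` [set 1]) //.
by apply: measurable_enorm => //; exact: measurable_set1.
Qed.

Lemma sphere_measure_unit : sigma (~` unit_sphere) = 0%E.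
Proof.
rewrite sphere_measureE (_ : _ `&` _ = set0) ?measure0 ?mul0e//.
apply/seteqP; split => // y [/= ny /andP[y0 _]].
by apply: ny; exact: enorm_direction.
Qed.

Lemma sphere_measure_unit1 : sigma unit_sphere = 1%E.
Proof.
have := probability_setC sigma (measurableC measurable_unit_sphere).
by rewrite setCK sphere_measure_unit sube0.
Qed.

Lemma ae_sphere (P : vec d.+1 -> Prop) :
  (forall y, enorm y = 1 -> P y) -> {ae sigma, forall y, P y}.
Proof.
move=> HP; exists (~` unit_sphere); split.
- by apply: measurableC; exact: measurable_unit_sphere.
- exact: sphere_measure_unit.
- by move=> y /= nP y1; apply: nP; exact: HP.
Qed.

Lemma eq_sphere_integral (f g : vec d.+1 -> R) :
  measurable_fun setT f -> measurable_fun setT g ->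
  (forall y, enorm y = 1 -> f y = g y) ->
  (\int[sigma]_y (f y)%:E = \int[sigma]_y (g y)%:E)%E.
Proof.
move=> mf mg fg; apply: ae_eq_integral => //.
- exact/measurable_EFinP.
- exact/measurable_EFinP.
- by apply: ae_sphere => y y1 _; rewrite fg.
Qed.

Lemma integrable_sphere (f : vec d.+1 -> R) (B : R) :
  measurable_fun setT f -> (forall y, enorm y = 1 -> `|f y| <= B) ->
  sigma.-integrable setT (EFin \o f).
Proof.
move=> mf fB; pose g y := f y * \1_unit_sphere y.
have mg : measurable_fun setT g.
  by apply: measurable_funM => //; exact: measurable_indic measurable_unit_sphere.
(* The bound is assumed only at unit vectors, so its sign is read off at one of them. *)
have B0 : 0 <= B.
  pose y0 : vec d.+1 := [tuple (i == ord0)%:R | i < d.+1].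
  apply: le_trans (normr_ge0 (f y0)) (fB _ _); apply: enorm_unit.
  rewrite /dot big_ord_recl tnth_mktuple eqxx mulr1 big1 ?addr0// => i _.
  by rewrite tnth_mktuple mulr0.
have : sigma.-integrable setT (EFin \o g).
  apply: (integrableT_bounded (B := B) _ mg); first exact: fin_num_fun_lty.
  move=> y; rewrite /g indicE; have [/set_mem yS|yS] := boolP (y \in unit_sphere).
    by rewrite mulr1 fB.
  by rewrite mulr0 normr0.
move=> /integrableP[_ goo]; apply/integrableP; split; first exact/measurable_EFinP.
rewrite (le_lt_trans _ goo)// le_eqVlt; apply/orP; left; apply/eqP.
apply: ae_eq_integral => //.
- by apply: measurableT_comp => //; exact/measurable_EFinP.
- by apply: measurableT_comp => //; exact/measurable_EFinP.
- by apply: ae_sphere => y y1 _; rewrite /g /= indicE mem_set// mulr1.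
Qed.

(** Both linear forms [f] are homogeneous, so [y] lies in the truncated cone over the preimage of
    [A] exactly when [0 < |y| <= 1] and [f y / |y|] is in [A]. This depends only on [f y] and
    [dot y y], and [ge0_integral_rotation] applies. *)
Lemma sphere_measure_dot (u : vec d.+1) (A : set R) : enorm u = 1 -> measurable A ->
  pushforward sigma (dot u : _ -> measurableTypeR R) A =
  pushforward sigma (@thead d _ : _ -> measurableTypeR R) A.
Proof.
move=> u1 mA; rewrite /pushforward !sphere_measureE; congr (_ * _)%E.
pose G (p : R * R) : R := \1_(`]0, 1]%classic) (Num.sqrt p.2) * \1_A ((Num.sqrt p.2)^-1 * p.1).
have mG : measurable_fun setT (EFin \o G).
  apply/measurable_EFinP.
  have msq : measurable_fun setT (fun p : R * R => Num.sqrt p.2).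
    apply: measurableT_comp => //.
    by apply: continuous_measurable_fun; exact: sqrt_continuous.
  apply: measurable_funM.
    by apply: measurableT_comp => //; exact: measurable_indic.
  apply: measurableT_comp; first exact: measurable_indic.
  apply: measurable_funM => //.
  under eq_fun do rewrite -powR_inv1 ?sqrtr_ge0//.
  exact: (measurableT_comp (measurable_powR _)).
have G0 p : (0 <= (EFin \o G) p)%E by rewrite lee_fin mulr_ge0.
have repr (f : vec d.+1 -> R) : measurable_fun setT f ->
    (forall y, f (direction y) = (enorm y)^-1 * f y) ->
    lebesgue_tuple d.+1 (@direction R d.+1 @^-1` (f @^-1` A) `&` @punctured_ball R d.+1) =
    (\int[lebesgue_tuple d.+1]_y (EFin \o G) (f y, dot y y))%E.
  move=> mf fdir; have mE : measurable
      (@direction R d.+1 @^-1` (f @^-1` A) `&` @punctured_ball R d.+1).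
    apply: measurableI; last exact: measurable_punctured_ball.
    rewrite -[X in measurable X]setTI; apply: measurable_direction => //.
    by rewrite -[X in measurable X]setTI; exact: mf.
  rewrite -[X in lebesgue_tuple _ X]setIT -integral_indic//.
  apply: eq_integral => y _; congr EFin; rewrite /G indicI /= !indicE [RHS]mulrC.
  congr ((nat_of_bool _)%:R * (nat_of_bool _)%:R); apply/idP/idP => /set_mem H; apply/mem_set; move: H => /=.
  - by rewrite fdir.
  - by rewrite fdir.
rewrite repr; [|exact: measurable_dotl|exact: dot_direction].
rewrite [RHS]repr; [|exact: measurable_thead|exact: thead_direction].
rewrite (ge0_integral_rotation u mG G0) u1.
by apply: eq_integral => y _; rewrite mul1r.
Qed.

End sphere.

Lemma polyP_horner (R : realFieldType) (p q : {poly R}) :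
  (forall t, p.[t] = q.[t]) -> p = q.
Proof.
move=> pq; apply/eqP; rewrite -subr_eq0; apply/negP => /negP pq0.
pose rs : seq R := [seq i%:R | i <- iota 0 (size (p - q))].
have all_rs : all (root (p - q)) rs.
  by apply/allP => t _; rewrite /root !hornerE pq subrr.
have uniq_rs : uniq rs.
  by rewrite map_inj_uniq ?iota_uniq// => i j /eqP; rewrite eqr_nat => /eqP.
by have := max_poly_roots pq0 all_rs uniq_rs; rewrite size_map size_iota ltnn.
Qed.

Lemma horner_bound (R : realFieldType) (p : {poly R}) t : `|t| <= 1 ->
  `|p.[t]| <= \sum_(i < size p) `|p`_i|.
Proof.
move=> t1; rewrite horner_coef (le_trans (ler_norm_sum _ _ _))// ler_sum// => i _.
by rewrite normrM normrX ler_piMr// exprn_ile1.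
Qed.

(** * Moments and convolution of zonal functions *)

(* [trinomial <x,z>] at [a] is [|a x + z|^2] for unit vectors, so its powers are,
   up to moments, the integrals of [<a x + z, y>^(2 n)]; comparing coefficients of
   [a] gives the integrals of [<x,y>^p <y,z>^q]. *)
Section trinomial.
Variable R : realFieldType.

Definition trinomial (s : R) : {poly R} := 'X^2 + (2 * s) *: 'X + 1.

Lemma coef_trinomialS s n p : (trinomial s ^+ n.+1)`_p =
  (if (p < 2)%N then 0 else (trinomial s ^+ n)`_(p - 2)) +
  2 * s * (if p == 0%N then 0 else (trinomial s ^+ n)`_p.-1) + (trinomial s ^+ n)`_p.
Proof.
rewrite exprS {1}/trinomial; set c := 2 * s; rewrite !mulrDl mul1r.
by rewrite !coefD coefXnM -scalerAl coefZ coefXM.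
Qed.

(** In [trinomial s] the parameter [s] only multiplies [X], so a coefficient of [X^p] in a power
    contains at most [p] factors [s]. *)
Lemma trinomial_coef_poly n p : exists2 b : {poly R}, (size b <= p.+1)%N &
  forall s, (trinomial s ^+ n)`_p = b.[s].
Proof.
elim: n p => [|n IH] p.
  exists ((p == 0%N)%:R%:P) => [|s]; last by rewrite expr0 coef1 hornerC.
  by rewrite (leq_trans (size_polyC_leq1 _)).
have [b0 sb0 eb0] := IH p; have [b1 sb1 eb1] := IH p.-1; have [b2 sb2 eb2] := IH (p - 2)%N.
exists ((if (p < 2)%N then 0 else b2) + 2 *: ('X * (if p == 0%N then 0 else b1)) + b0).
  rewrite (leq_trans (size_polyD _ _))// geq_max sb0 andbT.
  rewrite (leq_trans (size_polyD _ _))// geq_max; apply/andP; split.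
    by case: ifP => p2; rewrite ?size_poly0// (leq_trans sb2)// ltnS leq_subr.
  rewrite (leq_trans (size_scale_leq _ _))//; case: ifP => p0; first by rewrite mulr0 size_poly0.
  rewrite mulrC; apply: (leq_trans (size_polyMleq _ _)); rewrite size_polyX addn2 /=.
  by rewrite ltnS (leq_trans sb1)// prednK// lt0n p0.
move=> s; rewrite coef_trinomialS eb0 eb1 eb2 !hornerD hornerZ hornerM hornerX.
by case: (p < 2)%N; case: (p == 0%N); rewrite ?horner0; ring.
Qed.

Lemma trinomial_coef0 s n : (trinomial s ^+ n)`_0 = 1.
Proof.
by elim: n => [|n IH]; rewrite ?coef1// coef_trinomialS /= IH mulr0 !add0r.
Qed.

Lemma trinomial_coef1 s n : (trinomial s ^+ n)`_1 = 2 * s * n%:R.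
Proof.
elim: n => [|n IH]; first by rewrite coef1 mulr0.
by rewrite coef_trinomialS /= IH trinomial_coef0 -natr1; ring.
Qed.

Lemma trinomial_coef2 s n :
  (trinomial s ^+ n)`_2 = n%:R + 2 * s ^+ 2 * (n%:R * (n%:R - 1)).
Proof.
elim: n => [|n IH]; first by rewrite coef1 /=; ring.
by rewrite coef_trinomialS /= IH trinomial_coef0 trinomial_coef1 -natr1; ring.
Qed.

End trinomial.

Section sphere_moments.
Context {R : realType}.
Variable d : nat.
Local Notation vec m := (m.-tuple (measurableTypeR R)).
Local Notation sigma := (@sphere_measure R d).

Lemma zonal_integral (u : vec d.+1) (F : R -> \bar R) : enorm u = 1 ->
  measurable_fun setT F ->
  (\int[sigma]_y F (dot u y) = \int[sigma]_y F (thead y))%E.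
Proof.
move=> u1.
have ge0 (G : R -> \bar R) : measurable_fun setT G -> (forall t, 0 <= G t)%E ->
    (\int[sigma]_y G (dot u y) = \int[sigma]_y G (thead y))%E.
  move=> mG G0.
  rewrite -(ge0_integral_pushforward (measurable_dotl u) sigma measurableT mG (fun t _ => G0 t)).
  rewrite -(ge0_integral_pushforward (@measurable_thead R d) sigma measurableT mG (fun t _ => G0 t)).
  apply: (@eq_measure_integral _ _ _ setT
    (measure_function_pushforward__canonical__measure_function_Measure sigma (@measurable_thead R d))
    (measure_function_pushforward__canonical__measure_function_Measure sigma (measurable_dotl u)))
    => A mA _.
  by apply: sphere_measure_dot.
move=> mF; rewrite [LHS]integralE [RHS]integralE.
rewrite (funepos_comp F (dot u)) (funeneg_comp F (dot u)).
rewrite (funepos_comp F (@thead d _)) (funeneg_comp F (@thead d _)).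
congr (_ - _)%E.
- exact: (ge0 _ (measurable_funepos mF) (fun t => funepos_ge0 F t)).
- exact: (ge0 _ (measurable_funeneg mF) (fun t => funeneg_ge0 F t)).
Qed.

Lemma measurable_horner_dot (p : {poly R}) (x : vec d.+1) :
  measurable_fun setT (fun y => p.[dot x y]).
Proof.
apply: (measurableT_comp (f := horner p) _ (measurable_dotl x)).
by apply: continuous_measurable_fun; exact: continuous_horner.
Qed.

Lemma integrable_horner_dot (p q : {poly R}) (x z : vec d.+1) :
  enorm x = 1 -> enorm z = 1 ->
  sigma.-integrable setT (EFin \o (fun y => p.[dot x y] * q.[dot z y])).
Proof.
move=> x1 z1.
apply: (@integrable_sphere _ _ _
  ((\sum_(i < size p) `|p`_i|) * (\sum_(i < size q) `|q`_i|))).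
  by apply: measurable_funM; exact: measurable_horner_dot.
move=> y y1; by rewrite normrM ler_pM// horner_bound// dot_unit_bound.
Qed.

Lemma integrable_horner_dot1 (p : {poly R}) (x : vec d.+1) : enorm x = 1 ->
  sigma.-integrable setT (EFin \o (fun y => p.[dot x y])).
Proof.
move=> x1; have := integrable_horner_dot p 1 x1 x1.
by apply: eq_integrable => // y _; rewrite /= hornerC mulr1.
Qed.

Definition basis_vec (i : 'I_d.+1) : vec d.+1 := [tuple (j == i)%:R | j < d.+1].

Lemma dot_basis_vec i y : dot (basis_vec i) y = tnth y i.
Proof.
rewrite /dot (bigD1 i)//= tnth_mktuple eqxx mul1r big1 ?addr0// => j ji.
by rewrite tnth_mktuple (negbTE ji) mul0r.
Qed.

Lemma enorm_basis_vec i : enorm (basis_vec i) = 1.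
Proof. by apply: enorm_unit; rewrite dot_basis_vec tnth_mktuple eqxx. Qed.

Definition sphere_mean (p : {poly R}) : R := \int[sigma]_y p.[dot (basis_vec ord0) y].

Lemma sphere_meanE (p : {poly R}) (x : vec d.+1) : enorm x = 1 ->
  \int[sigma]_y p.[dot x y] = sphere_mean p.
Proof.
move=> x1; rewrite /sphere_mean /Rintegral.
have mp : measurable_fun setT (EFin \o horner p).
  apply/measurable_EFinP.
  by apply: continuous_measurable_fun; exact: continuous_horner.
by rewrite !(zonal_integral (F := EFin \o horner p)) ?enorm_basis_vec.
Qed.

Lemma sphere_mean_is_scalar : scalar sphere_mean.
Proof.
move=> a p q; rewrite /sphere_mean.
have i1 r := integrable_horner_dot1 r (enorm_basis_vec ord0).
under eq_Rintegral do rewrite hornerD hornerZ.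
rewrite RintegralD//; first by rewrite RintegralZl.
exact: integrableT_Zl.
Qed.

HB.instance Definition _ := GRing.isLinear.Build R {poly R} R *%R sphere_mean
  sphere_mean_is_scalar.

Definition moment (n : nat) : R := sphere_mean 'X^n.

Lemma moment0 : moment 0 = 1.
Proof.
rewrite /moment /sphere_mean expr0; under eq_Rintegral do rewrite hornerC.
by rewrite Rintegral_cst// [X in fine X]probability_setT mulr1.
Qed.

(** The mean is the same along a unit vector and along its opposite, while odd powers change
    sign. *)
Lemma moment_odd n : odd n -> moment n = 0.
Proof.
move=> on; have e1 := enorm_basis_vec ord0.
have Ne1 : enorm (lincomb (-1) (basis_vec ord0) 0 (basis_vec ord0)) = 1.
  by apply: enorm_unit; rewrite sqnorm_lincomb sqnorm_unit//; ring.
suff : moment n = - moment n by lra.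
rewrite {1}/moment -(sphere_meanE _ Ne1).
transitivity (\int[sigma]_y (-1 * 'X^n.[dot (basis_vec ord0) y])).
  apply: eq_Rintegral => y _; rewrite !hornerXn dot_lincombl mul0r addr0.
  by rewrite !mulN1r exprNn -signr_odd on expr1 mulN1r.
by rewrite RintegralZl ?mulN1r//; exact: integrable_horner_dot1.
Qed.

Lemma sphere_power_integral n (u : vec d.+1) :
  \int[sigma]_y (dot u y) ^+ n = moment n * enorm u ^+ n.
Proof.
have [u0|u0] := eqVneq (enorm u) 0.
  rewrite u0 expr0n; case: n => [|n].
    under eq_Rintegral do rewrite expr0.
    by rewrite Rintegral_cst// [X in fine X]probability_setT moment0 mulr1.
  under eq_Rintegral do rewrite (enorm_eq0 u0) expr0n /=.
  by rewrite Rintegral_cst// mul0r mulr0.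
pose v := lincomb (enorm u)^-1 u 0 u.
have v1 : enorm v = 1.
  by apply: enorm_unit; rewrite sqnorm_lincomb -enorm_sqr; field.
have E y : dot u y ^+ n = enorm u ^+ n * 'X^n.[dot v y].
  by rewrite hornerXn -exprMn dot_lincombl mul0r addr0 mulrA divff// mul1r.
under eq_Rintegral do rewrite E.
rewrite RintegralZl//; last exact: integrable_horner_dot1.
by rewrite sphere_meanE// mulrC.
Qed.

Lemma mixed_moment p q (x z : vec d.+1) : enorm x = 1 -> enorm z = 1 ->
  'C(p + q, p)%:R * \int[sigma]_y ((dot x y) ^+ p * (dot z y) ^+ q) =
  moment (p + q) * (trinomial (dot x z) ^+ ((p + q)./2))`_p.
Proof.
move=> x1 z1; set N := (p + q)%N.
pose M i := \int[sigma]_y ((dot x y) ^+ i * (dot z y) ^+ (N - i)).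
pose P : {poly R} := \poly_(i < N.+1) ('C(N, i)%:R * M i).
suff PE : P = moment N *: trinomial (dot x z) ^+ N./2.
  have := congr1 (fun r : {poly R} => r`_p) PE.
  by rewrite coef_poly coefZ ltnS leq_addr /M addKn.
have iM i : sigma.-integrable setT (EFin \o (fun y => dot x y ^+ i * dot z y ^+ (N - i))).
  have := integrable_horner_dot 'X^i 'X^(N - i) x1 z1.
  by apply: eq_integrable => // y _; rewrite /= !hornerXn.
apply: polyP_horner => a.
have := sphere_power_integral N (lincomb a x 1 z).
have -> : \int[sigma]_y (dot (lincomb a x 1 z) y) ^+ N = P.[a].
  transitivity (\int[sigma]_y (\sum_(i < N.+1)
      ('C(N, i)%:R * a ^+ i) * (dot x y ^+ i * dot z y ^+ (N - i)))).
    apply: eq_Rintegral => y _; rewrite dot_lincombl mul1r addrC exprDn.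
    by apply: eq_bigr => i _; rewrite exprMn -mulr_natl; ring.
  rewrite Rintegral_sum => [|i]; last exact: integrableT_Zl.
  rewrite horner_poly; apply: eq_bigr => i _.
  by rewrite RintegralZl// mulrAC.
move=> ->; rewrite hornerZ horner_exp.
have nE : enorm (lincomb a x 1 z) ^+ 2 = (trinomial (dot x z)).[a].
  rewrite enorm_sqr sqnorm_lincomb !sqnorm_unit// /trinomial !hornerE; ring.
(* For odd [N] both sides vanish with the moment, so the rounding in [N./2] does no harm. *)
have [oN|eN] := boolP (odd N); first by rewrite moment_odd// !mul0r.
by rewrite -nE -exprM mul2n even_halfK.
Qed.

(** Insert [1 = y_0^2 + ... + y_d^2], valid on the sphere, and evaluate each resulting integral by
    [mixed_moment] with exponent 2; the squared coordinates of [e] sum to 1. *)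
Lemma moment_rec n : (n.*2.+1%:R) * moment n.*2 = (n.*2%:R + d%:R + 1) * moment n.*2.+2.
Proof.
set e := basis_vec ord0; have e1 := enorm_basis_vec ord0.
have i2 i : sigma.-integrable setT
    (EFin \o (fun y => dot (basis_vec i) y ^+ 2 * dot e y ^+ n.*2)).
  have := integrable_horner_dot 'X^2 'X^(n.*2) (enorm_basis_vec i) e1.
  by apply: eq_integrable => // y _; rewrite /= !hornerXn.
have sumE : moment n.*2 = \sum_i \int[sigma]_y (dot (basis_vec i) y ^+ 2 * dot e y ^+ n.*2).
  rewrite -Rintegral_sum// /moment /sphere_mean /Rintegral; congr fine.
  apply: eq_sphere_integral.
  - exact: measurable_horner_dot.
  - apply: measurable_sum => i.
    by have /measurable_EFinP := measurable_int _ (i2 i).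
  - move=> y y1; rewrite hornerXn -mulr_suml.
    rewrite (_ : \sum_i _ = 1) ?mul1r// -(sqnorm_unit y1) /dot.
    by apply: eq_bigr => i _; rewrite -/(dot _ _) dot_basis_vec expr2.
have bin2E : 'C(2 + n.*2, 2)%:R = (n.+1)%:R * n.*2.+1%:R :> R.
  by rewrite -natrM (_ : (2 + n.*2)%N = n.+1.*2)// bin2 -doubleMl doubleK.
have n1 : (n.+1%:R : R) != 0 by rewrite pnatr_eq0.
apply: (mulfI n1); rewrite mulrA -bin2E sumE mulr_sumr.
have term i : 'C(2 + n.*2, 2)%:R * \int[sigma]_y (dot (basis_vec i) y ^+ 2 * dot e y ^+ n.*2) =
    moment n.*2.+2 * (n.+1%:R + 2 * (tnth e i) ^+ 2 * (n.+1%:R * n%:R)).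
  rewrite mixed_moment ?enorm_basis_vec// add2n -doubleS doubleK trinomial_coef2.
  by rewrite dot_basis_vec -[in X in _ * (X - 1)]natr1 addrK.
under eq_bigr do rewrite term.
rewrite -mulr_sumr big_split /= sumr_const card_ord -mulr_suml -mulr_sumr.
have -> : \sum_(i < d.+1) tnth e i ^+ 2 = 1.
  by rewrite -(sqnorm_unit e1); apply: eq_bigr => i _; rewrite expr2.
by rewrite -mulr_natl -muln2 natrM -!natr1; ring.
Qed.

(** On even powers times [X] this is [moment_rec], on the other monomials both sides vanish. It
    makes the mean over the sphere an instance of the abstract functional [E]. *)
Lemma sphere_mean_by_parts (p : {poly R}) :
  sphere_mean ((1 - 'X^2) * p^`()) = d%:R * sphere_mean ('X * p).
Proof.
have mono n : sphere_mean ((1 - 'X^2) * ('X^n)^`()) = d%:R * sphere_mean ('X * 'X^n).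
  rewrite derivXn -exprS -/(moment n.+1) mulrnAr linearMn /=.
  case: n => [|n]; first by rewrite mulr0n moment_odd// mulr0.
  rewrite mulrBl mul1r -exprD linearB /= -/(moment n) -/(moment (2 + n)).
  have [on|en] := boolP (odd n).
    by rewrite !moment_odd ?mulr0 ?subr0 ?mul0rn//= ?on// negbK.
  rewrite -(even_halfK en) -[(2 + _)%N]/(_.+2); have := moment_rec n./2.
  by move=> H; rewrite -[LHS]mulr_natl mulrBr H -natr1; ring.
rewrite [in LHS](_ : p^`() = \sum_(i < size p) p`_i *: ('X^i)^`()); last first.
  rewrite -[in LHS](coefK p) poly_def raddf_sum /=.
  by apply: eq_bigr => i _; rewrite derivZ.
rewrite mulr_sumr linear_sum -[in RHS](coefK p) poly_def mulr_sumr linear_sum mulr_sumr.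
apply: eq_bigr => i _; rewrite -!scalerAr !linearZ /= mono; ring.
Qed.

End sphere_moments.

Section sphere_fubini.
Context {R : realType}.
Variable d : nat.
Local Notation vec m := (m.-tuple (measurableTypeR R)).
Local Notation sigma := (@sphere_measure R d).
Local Notation S := (@unit_sphere R d).

Lemma measurable_sphere_indic : measurable_fun setT (\1_S : vec d.+1 -> R).
Proof. exact: measurable_indic (@measurable_unit_sphere R d). Qed.

Lemma sphere_indic1 (y : vec d.+1) : enorm y = 1 -> \1_S y = 1 :> R.
Proof. by move=> y1; rewrite indicE mem_set. Qed.

Lemma sphere_indic0 (y : vec d.+1) : enorm y <> 1 -> \1_S y = 0 :> R.
Proof. by move=> y1; rewrite indicE memNset. Qed.

(* Points of the process are arbitrary vectors of [R^(d+1)]; off the sphere the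
   isotropic kernel is neither bounded nor reproducing, so it is cut off there. *)
Definition sphere_restrict (F : vec d.+1 -> vec d.+1 -> R) x y : R :=
  F x y * (\1_S x * \1_S y).

Lemma sphere_restrict_bound F (B : R) :
  (forall x y, enorm x = 1 -> enorm y = 1 -> `|F x y| <= B) ->
  forall x y, `|sphere_restrict F x y| <= B.
Proof.
move=> FB; have e1 := enorm_basis_vec (R := R) (@ord0 d).
have B0 : 0 <= B by rewrite (le_trans _ (FB _ _ e1 e1)).
move=> x y; rewrite /sphere_restrict.
have [x1|x1] := eqVneq (enorm x) 1; last first.
  by rewrite (sphere_indic0 (elimN eqP x1)) mul0r mulr0 normr0.
have [y1|y1] := eqVneq (enorm y) 1; last first.
  by rewrite (sphere_indic0 (elimN eqP y1)) !mulr0 normr0.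
by rewrite !sphere_indic1// !mulr1 FB.
Qed.

Lemma sphere_restrict_unit F x y : enorm x = 1 -> enorm y = 1 ->
  sphere_restrict F x y = F x y.
Proof. by move=> x1 y1; rewrite /sphere_restrict !sphere_indic1// !mulr1. Qed.

Section measurable.
Variable F : vec d.+1 -> vec d.+1 -> R.
Hypothesis mF : measurable_fun setT (fun p : vec d.+1 * vec d.+1 => F p.1 p.2).

Lemma measurable_sphere_restrict :
  measurable_fun setT (fun p : vec d.+1 * vec d.+1 => sphere_restrict F p.1 p.2).
Proof.
apply: measurable_funM => //.
apply: measurable_funM.
  exact: (measurableT_comp measurable_sphere_indic measurable_fst).
exact: (measurableT_comp measurable_sphere_indic measurable_snd).
Qed.

(** The partial integrals are prescribed at unit vectors only; there they coincide with those of the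
    cut-off [G], which is bounded everywhere, and the sphere has full measure. *)
Lemma sphere_fubini (B : R) (h1 h2 : vec d.+1 -> R) :
  (forall x y, enorm x = 1 -> enorm y = 1 -> `|F x y| <= B) ->
  measurable_fun setT h1 -> measurable_fun setT h2 ->
  (forall x, enorm x = 1 -> \int[sigma]_y F x y = h1 x) ->
  (forall y, enorm y = 1 -> \int[sigma]_x F x y = h2 y) ->
  \int[sigma]_x h1 x = \int[sigma]_y h2 y.
Proof.
move=> FB mh1 mh2 h1E h2E.
pose G := sphere_restrict F; have GB := sphere_restrict_bound FB.
have mG := measurable_sphere_restrict.
have iG : (sigma \x sigma)%E.-integrable setT (EFin \o (fun p => G p.1 p.2)).
  apply: (integrableT_bounded (B := B) _ mG) => [|p]; last exact: GB.
  rewrite -setXTT [X in (X < _)%E](@product_measure1E _ _ _ _ R sigma sigma)//.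
  by rewrite [X in (X * _)%E](probability_setT sigma) [X in (_ * X)%E](probability_setT sigma) mule1 ltry.
have mF1 x : measurable_fun setT (F x) := measurableT_comp mF (measurable_pair1 x).
have mF2 y : measurable_fun setT (F ^~ y) := measurableT_comp mF (measurable_pair2 y).
have mG1 x : measurable_fun setT (G x) := measurableT_comp mG (measurable_pair1 x).
have mG2 y : measurable_fun setT (G ^~ y) := measurableT_comp mG (measurable_pair2 y).
rewrite /Rintegral; congr fine.
transitivity (\int[sigma]_x fubini_F sigma (fun p => (G p.1 p.2)%:E) x)%E.
  apply: ae_eq_integral => //.
  - exact/measurable_EFinP.
  - exact: measurable_fubini_F iG.
  - apply: ae_sphere => x x1 _; rewrite /fubini_F /= -h1E// /Rintegral fineK.
      apply: eq_sphere_integral => //.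
      by move=> y y1; rewrite /G sphere_restrict_unit.
    apply: integrable_fin_num => //.
    by apply: integrable_sphere => // y y1; exact: FB.
transitivity (\int[sigma]_y fubini_G sigma (fun p => (G p.1 p.2)%:E) y)%E.
  by rewrite (integral12_prod_meas1 iG) (integral21_prod_meas1 iG).
apply: ae_eq_integral => //.
- exact: measurable_fubini_G iG.
- exact/measurable_EFinP.
- apply: ae_sphere => y y1 _; rewrite /fubini_G /= -h2E// /Rintegral fineK.
    apply: eq_sphere_integral => //.
    by move=> x x1; rewrite /G sphere_restrict_unit.
  apply: integrable_fin_num => //.
  by apply: integrable_sphere => // x x1; exact: FB.
Qed.

End measurable.
End sphere_fubini.

(** * Convolution of zonal polynomials *)

Section reproducing.
Context {R : realType}.
Variable d : nat.
Local Notation vec m := (m.-tuple (measurableTypeR R)).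
Local Notation sigma := (@sphere_measure R d).

Lemma mixed_moment_poly p q : exists2 b : {poly R}, (size b <= p.+1)%N &
  forall x z : vec d.+1, enorm x = 1 -> enorm z = 1 ->
    \int[sigma]_y ((dot x y) ^+ p * (dot z y) ^+ q) = b.[dot x z].
Proof.
have [b sb bE] := trinomial_coef_poly R ((p + q)./2) p.
exists ((('C(p + q, p)%:R)^-1 * moment d (p + q)) *: b).
  exact: leq_trans (size_scale_leq _ _) sb.
move=> x z x1 z1; rewrite hornerZ -bE -mulrA -mixed_moment// mulKf//.
by rewrite pnatr_eq0 -lt0n bin_gt0 leq_addr.
Qed.

(** A weak form of the Funk-Hecke formula. The degree bound involves [f] alone, which later confines
    the convolution with [C k] to degree [k]. *)
Lemma convolution_poly (f g : {poly R}) : exists2 b : {poly R}, (size b <= size f)%N &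
  forall x z : vec d.+1, enorm x = 1 -> enorm z = 1 ->
    \int[sigma]_y (f.[dot x y] * g.[dot z y]) = b.[dot x z].
Proof.
pose b p q := s2val (cid2 (mixed_moment_poly p q)).
have sb p q : (size (b p q) <= p.+1)%N by rewrite /b; case: cid2.
have bE p q (x z : vec d.+1) : enorm x = 1 -> enorm z = 1 ->
    \int[sigma]_y ((dot x y) ^+ p * (dot z y) ^+ q) = (b p q).[dot x z].
  by rewrite /b; case: cid2 => /= c _ cE; exact: cE.
exists (\sum_(p < size f) \sum_(q < size g) (f`_p * g`_q) *: b p q).
  apply: (leq_trans (size_sum _ _ _)); apply/bigmax_leqP => p _.
  apply: (leq_trans (size_sum _ _ _)); apply/bigmax_leqP => q _.
  by rewrite (leq_trans (size_scale_leq _ _))// (leq_trans (sb p q)).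
move=> x z x1 z1.
have im p q : sigma.-integrable setT (EFin \o (fun y => (dot x y) ^+ p * (dot z y) ^+ q)).
  have := integrable_horner_dot 'X^p 'X^q x1 z1.
  by apply: eq_integrable => // y _; rewrite /= !hornerXn.
transitivity (\int[sigma]_y (\sum_(p < size f) \sum_(q < size g)
    (f`_p * g`_q) * ((dot x y) ^+ p * (dot z y) ^+ q))).
  apply: eq_Rintegral => y _; rewrite !horner_coef mulr_suml; apply: eq_bigr => p _.
  by rewrite mulr_sumr; apply: eq_bigr => q _; rewrite mulrACA.
rewrite Rintegral_sum => [|p]; last first.
  by apply: integrableT_sum => q; exact: integrableT_Zl.
rewrite horner_sum; apply: eq_bigr => p _.
rewrite Rintegral_sum => [|q]; last exact: integrableT_Zl.
rewrite horner_sum; apply: eq_bigr => q _.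
by rewrite RintegralZl// bE// hornerZ.
Qed.

End reproducing.

Section gegenbauer_reproducing.
Context {R : realType}.
Variable m : nat.
Local Notation d := m.+2.
Local Notation vec m := (m.-tuple (measurableTypeR R)).
Local Notation sigma := (@sphere_measure R d).
Local Notation C := (gegen R m).

Lemma sphere_mean_by_parts2 (p : {poly R}) :
  sphere_mean d ((1 - 'X^2) * p^`()) = (m%:R + 2) * sphere_mean d ('X * p).
Proof. by rewrite sphere_mean_by_parts -addn2 natrD. Qed.

Let orth_size k (p : {poly R}) : (size p <= k)%N -> sphere_mean d (p * C k) = 0.
Proof. exact: (gegen_orthogonal_size sphere_mean_by_parts2). Qed.

Let C1_neq0 k : (C k).[1] != 0.
Proof. by rewrite horner_gegen1 pnatr_eq0 -lt0n bin_gt0 leq_addl. Qed.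

Let mean1 : sphere_mean d 1 = 1 :> R.
Proof. by have := moment0 (R := R) d; rewrite /moment expr0. Qed.

Let norm_neq0 k : sphere_mean d (C k * C k) != 0.
Proof.
apply/eqP => z; have := gegen_norm sphere_mean_by_parts2 k.
rewrite /= z mulr0 mean1 mulr1 => /esym/eqP.
by rewrite mulf_eq0 (negbTE (C1_neq0 k)) orbF natr1 pnatr_eq0.
Qed.

Lemma measurable_dot2 : measurable_fun setT (fun p : vec d.+1 * vec d.+1 => dot p.1 p.2).
Proof.
apply: measurable_sum => i; apply: measurable_funM.
  exact: (measurableT_comp (measurable_tnth i) measurable_fst).
exact: (measurableT_comp (measurable_tnth i) measurable_snd).
Qed.

Lemma measurable_horner_dot2 (p : {poly R}) :
  measurable_fun setT (fun q : vec d.+1 * vec d.+1 => p.[dot q.1 q.2]).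
Proof.
apply: (measurableT_comp (f := horner p) _ measurable_dot2).
by apply: continuous_measurable_fun; exact: continuous_horner.
Qed.

(** Stands in for the addition theorem: the convolution is a polynomial [b] of degree at most [k],
    orthogonal to all lower [C j], hence a multiple of [C k]. Setting [z = x] determines the factor
    through [gegen_norm]. *)
Let gegen_convolution_le k l (x z : vec d.+1) : (k <= l)%N ->
  enorm x = 1 -> enorm z = 1 ->
  \int[sigma]_y ((C k).[dot x y] * (C l).[dot z y]) =
  if k == l then (m%:R + 1) / (2 * k%:R + m%:R + 1) * (C k).[dot x z] else 0.
Proof.
move=> kl x1 z1.
have [b sb bE] := @convolution_poly R d (C k) (C l); rewrite size_gegen in sb.
(* By Fubini the mean of [b * C j] is that of [b' * C k], where [b'] is the convolution of [C j] and
   [C l], of degree at most [j < k]. *)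
have b_orth j : (j < k)%N -> sphere_mean d (b * C j) = 0.
  move=> jk; have [b' sb' b'E] := @convolution_poly R d (C j) (C l).
  rewrite size_gegen in sb'.
  rewrite -(orth_size (leq_trans sb' jk)) -!(sphere_meanE _ x1).
  pose F z y := (C j).[dot x z] * ((C k).[dot x y] * (C l).[dot z y]).
  pose bd (p : {poly R}) := \sum_(i < size p) `|p`_i|.
  apply: (@sphere_fubini _ _ F _ (bd (C j) * (bd (C k) * bd (C l)))).
  - apply: measurable_funM; last apply: measurable_funM.
    + exact: (measurableT_comp (measurable_horner_dot _ x) measurable_fst).
    + exact: (measurableT_comp (measurable_horner_dot _ x) measurable_snd).
    + exact: measurable_horner_dot2.
  - move=> u v u1 v1; rewrite !normrM !ler_pM ?mulr_ge0// horner_bound// dot_unit_bound//.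
  - exact: measurable_horner_dot.
  - exact: measurable_horner_dot.
  - move=> u u1; rewrite RintegralZl//; last exact: integrable_horner_dot.
    by rewrite bE// hornerM mulrC.
  - move=> v v1; rewrite hornerM -b'E// mulrC -RintegralZl//; last exact: integrable_horner_dot.
    by apply: eq_Rintegral => u _; rewrite /F (dotC v) mulrCA.
have [c cE] : exists c, b = c *: C k.
  have [c cE] := gegen_span m sb.
  exists (c k); rewrite cE big_ord_recr /= big1 ?add0r// => i _.
  have := b_orth i (ltn_ord i); rewrite cE mulr_suml linear_sum.
  rewrite (bigD1 (widen_ord (leqnSn k) i)) //= big1 ?addr0; last first.
    by move=> j ji; rewrite -scalerAl linearZ /= (gegen_orthogonal sphere_mean_by_parts2)// mulr0.
  rewrite -scalerAl linearZ /= => /eqP; rewrite mulf_eq0 (negbTE (norm_neq0 _)) orbF.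
  by move=> /eqP ->; rewrite scale0r.
have b1 : b.[1] = sphere_mean d (C k * C l).
  rewrite -(sphere_meanE _ x1) -(sqnorm_unit x1) -bE//.
  by apply: eq_Rintegral => y _; rewrite hornerM.
rewrite bE// cE hornerZ; move: b1; rewrite cE hornerZ.
case: eqP => [<- b1|/eqP kl0].
  congr (_ * _); apply: (mulIf (C1_neq0 k)); rewrite b1 mulrAC.
  have := gegen_norm sphere_mean_by_parts2 k; rewrite /= mean1 mulr1 => <-.
  by field; rewrite gt_eqF//; have := ler0n R k; have := ler0n R m; lra.
rewrite (gegen_orthogonal sphere_mean_by_parts2)// => /eqP.
by rewrite mulf_eq0 (negbTE (C1_neq0 k)) orbF => /eqP ->; rewrite mul0r.
Qed.

Lemma gegen_convolution k l (x z : vec d.+1) : enorm x = 1 -> enorm z = 1 ->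
  \int[sigma]_y ((C k).[dot x y] * (C l).[dot z y]) =
  if k == l then (m%:R + 1) / (2 * k%:R + m%:R + 1) * (C k).[dot x z] else 0.
Proof.
move=> x1 z1; have /orP[kl|lk] := leq_total k l; first exact: gegen_convolution_le.
under eq_Rintegral do rewrite mulrC.
by rewrite gegen_convolution_le// eq_sym dotC; case: eqP => // ->.
Qed.

End gegenbauer_reproducing.

(** Writing [1 / x] as [x / x^2] brings it to a real power of a nonnegative base; at 0 both are 0 by
    convention. *)
Lemma measurable_funV d (T : measurableType d) (R : realType) (f : T -> R) :
  measurable_fun setT f -> measurable_fun setT (fun x => (f x)^-1).
Proof.
move=> mf.
rewrite (_ : (fun x => _) = fun x => f x * (f x ^+ 2) `^ (-1)).
  apply: measurable_funM => //.
  by apply: (measurableT_comp (measurable_powR _)); exact: measurable_funX.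
apply/funext => x; rewrite powR_inv1 ?sqr_ge0//.
have [->|fx0] := eqVneq (f x) 0; first by rewrite mul0r invr0.
by rewrite expr2 invfM mulrA divff ?mul1r.
Qed.

(** * The weight 1 / (1 - t) *)

Section inverse_weight.
Context {R : realType}.
Variable m : nat.
Hypothesis m_gt0 : (0 < m)%N.
Local Notation d := m.+2.
Local Notation vec m := (m.-tuple (measurableTypeR R)).
Local Notation sigma := (@sphere_measure R d).
Local Notation e0 := (@basis_vec R d ord0).
Local Notation c N := (moment (R := R) d (N.*2)).

(** Chosen to telescope: by the moment recurrence [g N - g N.+1 = m c_N], where [c_N] is the moment
    of order [2 N]. *)
Let g (N : nat) : R := (N.*2%:R + m%:R + 1) * c N.

Let g_rec N : g N.+1 = N.*2.+1%:R * c N.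
Proof.
by rewrite /g moment_rec doubleS -!natr1; ring.
Qed.

Let moment_even_ge0 N : 0 <= c N.
Proof.
apply: Rintegral_ge0 => y _.
by rewrite hornerXn -mul2n exprM exprn_ge0// sqr_ge0.
Qed.

Let g_ge0 N : 0 <= g N.
Proof. by rewrite /g mulr_ge0// !addr_ge0. Qed.

Let g0E : g 0 = m%:R + 1.
Proof. by rewrite /g /= moment0 add0r mulr1. Qed.

Let m_ge1 : 1 <= m%:R :> R.
Proof. by rewrite ler1n. Qed.

(** A Wallis-type bound: [g N.+1 / g N] is at most [(2 N + 1) / (2 N + 2)] as [m >= 1], and the
    square of this is at most [(N + 1) / (N + 2)]. *)
Let g_sqr_bound N : g N ^+ 2 * N.+1%:R <= (m%:R + 1) ^+ 2.
Proof.
elim: N => [|N IH]; first by rewrite g0E mulr1.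
apply: le_trans IH.
have cE : c N = g N / (N.*2%:R + m%:R + 1).
  by rewrite /g; field; rewrite gt_eqF// ltr_wpDl// addr_ge0.
rewrite g_rec cE -!natr1 -mul2n natrM.
set x : R := N%:R; set M : R := m%:R; set G := g N.
have x0 : 0 <= x by rewrite ler0n.
have M1 : 1 <= M := m_ge1.
have D0 : 0 < 2 * x + M + 1 by lra.
have -> : ((2 * x + 1) * (G / (2 * x + M + 1))) ^+ 2 * (x + 1 + 1) =
  G ^+ 2 * ((2 * x + 1) ^+ 2 * (x + 2) / (2 * x + M + 1) ^+ 2) by field; rewrite gt_eqF.
rewrite ler_wpM2l ?sqr_ge0// ler_pdivrMr ?exprn_gt0//.
apply: (@le_trans _ _ ((x + 1) * (2 * x + 2) ^+ 2)); first by nra.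
rewrite ler_wpM2l ?addr_ge0// lerXn2r ?nnegrE; lra.
Qed.

Let cvg_g : g @ \oo --> (0 : R).
Proof.
have g2 : (fun N => g N ^+ 2) @ \oo --> (0 : R).
  apply: (@squeeze_cvgr _ _ _ _ (fun=> 0) (fun N => (m%:R + 1) ^+ 2 * N.+1%:R^-1)).
  - near=> N; rewrite sqr_ge0 /= ler_pdivlMr// g_sqr_bound.
  - exact: cvg_cst.
  - rewrite -[X in _ --> X](mulr0 ((m%:R + 1) ^+ 2)).
    by apply: cvgMl_tmp; exact: cvg_harmonic.
have : (fun N => Num.sqrt (g N ^+ 2)) @ \oo --> Num.sqrt (0 : R).
  by apply: continuous_cvg g2; exact: sqrt_continuous.
by rewrite sqrtr0; under eq_fun do rewrite sqrtr_sqr ger0_norm//.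
Unshelve. all: by end_near. Qed.

Let sum_moment N : m%:R * \sum_(k < N) c k = m%:R + 1 - g N.
Proof.
elim: N => [|N IH]; first by rewrite big_ord0 mulr0 g0E subrr.
by rewrite big_ord_recr mulrDr /= IH g_rec /g -natr1; ring.
Qed.

Let moment_even_le N : c N <= g N.
Proof. by rewrite /g ler_peMl// -addrA ler_wpDl// lerDr. Qed.

Definition open_cap : set (vec d.+1) := [set y | `|dot e0 y| < 1].

Lemma measurable_open_cap : measurable open_cap.
Proof.
rewrite -[X in measurable X]setTI.
rewrite (_ : open_cap = dot e0 @^-1` `]-1, 1[%classic).
  exact: measurable_dotl.
by apply/seteqP; split => y; rewrite /open_cap /= in_itv /= ltr_norml.
Qed.

(** Where [|t| >= 1] every [t^(2 N)] is at least 1, so the measure is bounded by all even moments,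
    which tend to 0. *)
Lemma open_cap_null : sigma (~` open_cap) = 0%E.
Proof.
have mA : measurable (~` open_cap) by apply: measurableC; exact: measurable_open_cap.
have le_g N : (sigma (~` open_cap) <= (g N)%:E)%E.
  apply: (@le_trans _ _ (c N)%:E); last by rewrite lee_fin.
  rewrite -[X in sigma X]setIT -integral_indic//.
  rewrite /moment /sphere_mean /Rintegral fineK; last first.
    by apply: integrable_fin_num => //; exact: integrable_horner_dot1 (enorm_basis_vec _).
  apply: ge0_le_integral => //.
  - by apply/measurable_EFinP; exact: measurable_indic.
  - by apply/measurable_EFinP; exact: measurable_horner_dot.
  - move=> y _; rewrite lee_fin hornerXn -mul2n exprM indicE.
    case: (boolP (y \in _)) => [/set_mem /= /negP|_]; last first.
      by rewrite exprn_ge0// sqr_ge0.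
    rewrite -leNgt => y1; rewrite exprn_ege1// -real_normK ?num_real//.
    by rewrite exprn_ege1.
apply/eqP; rewrite eq_le measure_ge0 andbT.
have g0cvg : EFin \o g @ \oo --> 0%:E.
  by apply: cvg_EFin; [exact: nearW|exact: cvg_g].
by apply: (cvge_to_ge g0cvg); exact: nearW.
Qed.

(** The first [2 N] terms of the series of [1 / (1 - t)], taken in pairs: each increment
    [(1 + t) t^(2 k)] is nonnegative for [|t| <= 1], as monotone convergence requires. *)
Definition geometric_poly N : {poly R} := (1 + 'X) * \sum_(k < N) 'X^(k.*2).

Lemma sphere_mean_geometric N : sphere_mean d (geometric_poly N) = \sum_(k < N) c k.
Proof.
rewrite /geometric_poly mulrDl mul1r linearD /= mulr_sumr !linear_sum /=.
rewrite [X in _ + X]big1 ?addr0// => k _.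
by rewrite -exprS -/(moment _ _) moment_odd//= odd_double.
Qed.

Lemma horner_geometric N t : (1 - t) * (geometric_poly N).[t] = 1 - t ^+ N.*2.
Proof.
elim: N => [|N IH]; first by rewrite /geometric_poly big_ord0 mulr0 horner0 mulr0 subrr.
rewrite /geometric_poly big_ord_recr /= mulrDr hornerD mulrDr IH.
rewrite hornerM hornerD hornerC hornerX hornerXn.
by rewrite doubleS !exprS; ring.
Qed.

Lemma ae_open_cap (P : vec d.+1 -> Prop) :
  (forall y, enorm y = 1 -> `|dot e0 y| < 1 -> P y) -> {ae sigma, forall y, P y}.
Proof.
move=> HP; exists (~` (@unit_sphere R d) `|` ~` open_cap); split.
- by apply: measurableU; apply: measurableC; [exact: measurable_unit_sphere|exact: measurable_open_cap].
- apply/eqP; rewrite eq_le measure_ge0 andbT (le_trans (measureU2 _ _ _))//.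
  + by apply: measurableC; exact: measurable_unit_sphere.
  + by apply: measurableC; exact: measurable_open_cap.
  + by rewrite [X in (X + _)%E]sphere_measure_unit [X in (_ + X)%E]open_cap_null adde0.
- move=> y /= nP; have [y1|/eqP y1] := eqVneq (enorm y) 1; last by left.
  by right => /= yA; apply: nP; exact: HP.
Qed.

Lemma measurable_inverse_weight :
  measurable_fun setT (fun y : vec d.+1 => (1 - dot e0 y)^-1).
Proof.
apply: measurable_funV.
by apply: measurable_funB => //; exact: measurable_dotl.
Qed.

(** Monotone convergence along [geometric_poly], whose means [(m + 1 - g N) / m] are given by
    telescoping, with [g] tending to 0. For [m = 0] the sequence [g] would be constant and the
    integral infinite. *)
Lemma inverse_weight_integral :
  (\int[sigma]_y ((1 - dot e0 y)^-1)%:E = ((m%:R + 1) / m%:R)%:E)%E.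
Proof.
pose A y : R := \1_(open_cap `&` @unit_sphere R d) y.
have mA : measurable_fun setT A.
  apply: measurable_indic; apply: measurableI; [exact: measurable_open_cap|exact: measurable_unit_sphere].
have A1 y : enorm y = 1 -> `|dot e0 y| < 1 -> A y = 1.
  by move=> y1 yA; rewrite /A indicE mem_set.
have P1 N t : `|t| < 1 -> (geometric_poly N).[t] = (1 - t ^+ N.*2) / (1 - t).
  rewrite ltr_norml => /andP[_ t1]; rewrite -horner_geometric mulrAC divff ?mul1r//.
  by rewrite subr_eq0 eq_sym lt_eqF.
pose Q N y : R := (geometric_poly N).[dot e0 y] * A y.
have mQ N : measurable_fun setT (Q N).
  by apply: measurable_funM => //; exact: measurable_horner_dot.
have intQ N : (\int[sigma]_y (Q N y)%:E = (((m%:R + 1) - g N) / m%:R)%:E)%E.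
  rewrite -sum_moment mulrAC divff ?mul1r ?pnatr_eq0 -?lt0n// -sphere_mean_geometric.
  rewrite /sphere_mean /Rintegral fineK; last first.
    by apply: integrable_fin_num => //; exact: integrable_horner_dot1 (enorm_basis_vec _).
  apply: ae_eq_integral => //.
  - exact/measurable_EFinP.
  - by apply/measurable_EFinP; exact: measurable_horner_dot.
  - by apply: ae_open_cap => y y1 yA _; rewrite /Q A1// mulr1.
have intA : (\int[sigma]_y ((1 - dot e0 y)^-1)%:E =
    \int[sigma]_y ((1 - dot e0 y)^-1 * A y)%:E)%E.
  apply: ae_eq_integral => //.
  - by apply/measurable_EFinP; exact: measurable_inverse_weight.
  - by apply/measurable_EFinP; apply: measurable_funM => //; exact: measurable_inverse_weight.
  - by apply: ae_open_cap => y y1 yA _; rewrite A1// mulr1.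
rewrite intA.
have A_cases y : A y = 0 \/ (A y = 1 /\ `|dot e0 y| < 1).
  rewrite /A indicE; case: (boolP (y \in _)) => [/set_mem[yA _]|_]; [right|left] => //.
have Q_ge0 N y : 0 <= Q N y.
  rewrite /Q; have [->|[-> yA]] := A_cases y; first by rewrite mulr0.
  rewrite mulr1 P1// divr_ge0// subr_ge0.
    by rewrite -mul2n exprM exprn_ile1 ?sqr_ge0// -real_normK ?num_real// exprn_ile1// ltW.
  by move: yA; rewrite ltr_norml => /andP[_ /ltW].
have Q_nd y : {homo (fun N => (Q N y)%:E) : a b / (a <= b)%N >-> (a <= b)%E}.
  move=> a b ab; rewrite lee_fin /Q; have [->|[-> yA]] := A_cases y; first by rewrite !mulr0.
  rewrite !mulr1 !P1// ler_pM2r; last first.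
    by move: yA; rewrite ltr_norml invr_gt0 subr_gt0 => /andP[].
  rewrite lerD2l lerN2 -!mul2n !exprM ler_wiXn2l ?sqr_ge0//.
  by rewrite -real_normK ?num_real// exprn_ile1// ltW.
have cvgQ y : (fun N => (Q N y)%:E) @ \oo --> ((1 - dot e0 y)^-1 * A y)%:E.
  apply: cvg_EFin; first exact: nearW.
  suff : Q ^~ y @ \oo --> (1 - dot e0 y)^-1 * A y by [].
  have [A0|[Ay yA]] := A_cases y.
    rewrite A0 mulr0 (_ : Q ^~ y = fun=> 0); first exact: cvg_cst.
    by apply/funext => N; rewrite /Q A0 mulr0.
  rewrite (_ : Q ^~ y = fun N => (1 - (dot e0 y ^+ 2) ^+ N) / (1 - dot e0 y)).
    have e1 : (fun N => (dot e0 y ^+ 2) ^+ N) @ \oo --> (0 : R).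
      by apply: cvg_expr; rewrite normrX exprn_ilt1.
    have e2 : (fun N => 1 - (dot e0 y ^+ 2) ^+ N) @ \oo --> (1 - 0 : R).
      by apply: cvgB e1; exact: cvg_cst.
    have := cvgM e2 (cvg_cst (1 - dot e0 y)^-1).
    by rewrite subr0 mul1r Ay mulr1; apply.
  by apply/funext => N; rewrite /Q Ay mulr1 P1// -mul2n exprM.
transitivity (\int[sigma]_y limn (fun N => (Q N y)%:E))%E.
  by apply: eq_integral => y _; apply/esym/cvg_lim => //; exact: cvgQ.
rewrite monotone_convergence//; last 2 first.
- by move=> N; exact/measurable_EFinP.
- by move=> N y _; rewrite lee_fin.
rewrite (funext intQ).
apply/cvg_lim => //; apply: cvg_EFin; first exact: nearW.
have e2 : (fun N => m%:R + 1 - g N) @ \oo --> (m%:R + 1 - 0 : R).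
  by apply: cvgB cvg_g; exact: cvg_cst.
by have := cvgM e2 (cvg_cst (m%:R^-1 : R)); rewrite subr0; apply.
Qed.

End inverse_weight.

Lemma integrable_sphere_eq (R : realType) d (f g : d.+1.-tuple (measurableTypeR R) -> R) :
  measurable_fun setT f -> (@sphere_measure R d).-integrable setT (EFin \o g) ->
  (forall y, enorm y = 1 -> f y = g y) ->
  (@sphere_measure R d).-integrable setT (EFin \o f).
Proof.
move=> mf /integrableP[mg goo] fg; apply/integrableP; split; first exact/measurable_EFinP.
rewrite (le_lt_trans _ goo)// le_eqVlt; apply/orP; left; apply/eqP.
apply: ae_eq_integral => //.
- by apply: measurableT_comp => //; exact/measurable_EFinP.
- exact: measurableT_comp.
- by apply: ae_sphere => y y1 _; rewrite /= fg.
Qed.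

Section inverse_weight_functional.
Context {R : realType}.
Variable m : nat.
Hypothesis m_gt0 : (0 < m)%N.
Local Notation d := m.+2.
Local Notation vec m := (m.-tuple (measurableTypeR R)).
Local Notation sigma := (@sphere_measure R d).
Local Notation e0 := (@basis_vec R d ord0).

Let w (y : vec d.+1) : R := (1 - dot e0 y)^-1.

Let mw : measurable_fun setT w. Proof. exact: measurable_inverse_weight. Qed.

Let w_ge0 y : enorm y = 1 -> 0 <= w y.
Proof.
move=> y1; rewrite invr_ge0 subr_ge0.
by have := dot_unit_bound (enorm_basis_vec ord0) y1; rewrite ler_norml => /andP[].
Qed.

Let integrable_w : sigma.-integrable setT (EFin \o w).
Proof.
apply/integrableP; split; first exact/measurable_EFinP.
apply: (@le_lt_trans _ _ (\int[sigma]_y (w y)%:E)%E); last first.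
  by rewrite (inverse_weight_integral m_gt0) ltry.
rewrite le_eqVlt; apply/orP; left; apply/eqP; apply: ae_eq_integral => //.
- by apply: measurableT_comp => //; exact/measurable_EFinP.
- exact/measurable_EFinP.
- by apply: ae_sphere => y y1 _; rewrite /= ger0_norm// w_ge0.
Qed.

Lemma integrable_inverse_weight (p : {poly R}) :
  sigma.-integrable setT (EFin \o (fun y => p.[dot e0 y] * (1 - dot e0 y)^-1)).
Proof.
pose g y : R := p.[dot e0 y] * \1_(@unit_sphere R d) y.
have mg : measurable_fun setT g.
  apply: measurable_funM; [exact: measurable_horner_dot|exact: measurable_sphere_indic].
have gB y : `|g y| <= \sum_(i < size p) `|p`_i|.
  rewrite /g; have [y1|/eqP y1] := eqVneq (enorm y) 1; last first.
    by rewrite sphere_indic0// mulr0 normr0 sumr_ge0.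
  by rewrite sphere_indic1// mulr1 horner_bound// dot_unit_bound// enorm_basis_vec.
apply: (integrable_sphere_eq _ (integrableT_M integrable_w mg gB)).
  apply: measurable_funM; [exact: measurable_horner_dot|exact: measurable_inverse_weight].
by move=> y y1; rewrite /g sphere_indic1// mulr1 mulrC.
Qed.

Definition weight_mean (p : {poly R}) : R :=
  \int[sigma]_y (p.[dot e0 y] * (1 - dot e0 y)^-1).

Lemma weight_mean_is_scalar : scalar weight_mean.
Proof.
move=> a p q; rewrite /weight_mean.
under eq_Rintegral do rewrite hornerD hornerZ mulrDl -mulrA.
rewrite RintegralD//; last 2 first.
- exact: integrableT_Zl (integrable_inverse_weight p).
- exact: integrable_inverse_weight.
by rewrite RintegralZl//; exact: integrable_inverse_weight.
Qed.

HB.instance Definition _ := GRing.isLinear.Build R {poly R} R *%R weight_mean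
  weight_mean_is_scalar.

Lemma weight_mean1 : weight_mean 1 = (m%:R + 1) / m%:R.
Proof.
rewrite /weight_mean /Rintegral; under eq_integral do rewrite hornerC mul1r.
by rewrite (inverse_weight_integral m_gt0).
Qed.

(** The factor [1 - t] cancels its inverse except where [t = 1], a null set by [open_cap_null]. *)
Lemma weight_meanM (p : {poly R}) : weight_mean ((1 - 'X) * p) = sphere_mean d p.
Proof.
rewrite /weight_mean /sphere_mean /Rintegral; congr fine; apply: ae_eq_integral => //.
- by have /measurable_int := integrable_inverse_weight ((1 - 'X) * p).
- by apply/measurable_EFinP; exact: measurable_horner_dot.
- apply: (ae_open_cap m_gt0) => y y1; rewrite ltr_norml => /andP[_ t1] _.
  congr EFin; rewrite hornerM hornerD hornerN hornerC hornerX mulrAC divff ?mul1r//.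
  by rewrite subr_eq0 eq_sym lt_eqF.
Qed.

Lemma weight_meanE (p : {poly R}) (x : vec d.+1) : enorm x = 1 ->
  (\int[sigma]_y (p.[dot x y] * (1 - dot x y)^-1)%:E = (weight_mean p)%:E)%E.
Proof.
move=> x1; rewrite /weight_mean /Rintegral fineK; last first.
  by apply: integrable_fin_num => //; exact: integrable_inverse_weight.
have mF : measurable_fun setT (fun t : R => (p.[t] * (1 - t)^-1)%:E).
  apply/measurable_EFinP; apply: measurable_funM.
    by apply: continuous_measurable_fun; exact: continuous_horner.
  by apply: measurable_funV; exact: measurable_funB.
by rewrite (zonal_integral x1 mF) (zonal_integral (enorm_basis_vec ord0) mF).
Qed.

Lemma integrable_inverse_weight_dot (p : {poly R}) (x : vec d.+1) : enorm x = 1 ->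
  sigma.-integrable setT (EFin \o (fun y => p.[dot x y] * (1 - dot x y)^-1)).
Proof.
move=> x1; have mf : measurable_fun setT (fun t : R => p.[t] * (1 - t)^-1).
  apply: measurable_funM.
    by apply: continuous_measurable_fun; exact: continuous_horner.
  by apply: measurable_funV; exact: measurable_funB.
have mF : measurable_fun setT (fun t : R => `|(p.[t] * (1 - t)^-1)%:E|%E).
  by apply: measurableT_comp => //; exact/measurable_EFinP.
apply/integrableP; split.
  apply/measurable_EFinP; exact: (measurableT_comp mf (measurable_dotl x)).
have := zonal_integral x1 mF; rewrite -(zonal_integral (enorm_basis_vec ord0) mF) => ->.
by have /integrableP[] := integrable_inverse_weight p.
Qed.

Lemma weight_mean_gegenM i j :
  weight_mean (gegen R m i * gegen R m j) = 'C(minn i j + m, m)%:R * ((m%:R + 1) / m%:R).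
Proof.
have -> : weight_mean (gegen R m i * gegen R m j) = (gegen R m (minn i j)).[1] * weight_mean 1.
  apply: (@J_gegenM _ _ (sphere_mean d : {scalar {poly R}}) (@sphere_mean_by_parts2 R m)
    (weight_mean : {scalar {poly R}})).
  - exact: weight_meanM.
  - change (m%:R * weight_mean 1 = (m%:R + 1) * sphere_mean d 1).
    rewrite weight_mean1 mulrCA divff ?mulr1 ?pnatr_eq0 -?lt0n//.
    by have := moment0 (R := R) d; rewrite /moment expr0 => ->; rewrite mulr1.
by rewrite weight_mean1 horner_gegen1.
Qed.

End inverse_weight_functional.

Lemma limn_series_finite (R : realType) (f : nat -> R) N :
  (forall k, (N <= k)%N -> f k = 0) -> limn (series f) = \sum_(k < N) f k.
Proof.
move=> f0; apply: lim_near_cst => //; near=> n.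
have Nn : (N <= n)%N by near: n; exact: nbhs_infty_ge.
rewrite /series /= (@big_cat_nat _ _ _ N 0 n)//= big_mkord.
by rewrite [X in _ + X]big_nat_cond [X in _ + X]big1 ?addr0// => k /andP[/andP[/f0]].
Unshelve. all: by end_near. Qed.

Lemma ae_power_measure d (T : measurableType d) (R : realType) (mu : probability T R)
    n (S : set T) (P : n.-tuple T -> Prop) : measurable S -> mu S = 1%E ->
  (forall x, (forall i, S (tnth x i)) -> P x) -> {ae power_measure mu n, forall x, P x}.
Proof.
move=> mS S1 HP; have mB := @measurable_tnth_box _ T n S mS.
have pB : power_measure mu n [set x | forall i, S (tnth x i)] = 1%E.
  by rewrite power_measure_box// [X in (X ^+ _)%E]S1 -EFin_expe expr1n.
exists (~` [set x | forall i, S (tnth x i)]); split.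
- exact: measurableC.
- rewrite -setTD measureD//; last by rewrite [X in (X < _)%E]power_measureT ltry.
  rewrite [X in (X - _)%E]power_measureT setTI [X in (_ - X)%E]pB.
  by rewrite -EFinB subrr.
- by move=> x /= nP xS; apply: nP; exact: HP.
Qed.

(** * The expected energy of a projection kernel *)

Section projection_kernel.
Context {R : realType}.
Variable m : nat.
Hypothesis m_gt0 : (0 < m)%N.
Local Notation d := m.+2.
Local Notation vec m := (m.-tuple (measurableTypeR R)).
Local Notation sigma := (@sphere_measure R d).
Local Notation C := (gegen R m).
Variables (n N : nat) (a : nat -> R).
Hypothesis a_proj : forall k, a k = projection_coef d k \/ a k = 0.
Hypothesis a_supp : forall k, (N <= k)%N -> a k = 0.
Hypothesis a_trace : \sum_(k < N) a k * 'C(k + m, m)%:R = n%:R.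

Definition kernel_poly : {poly R} := \sum_(k < N) a k *: C k.

Lemma isotropic_kernelE (x y : vec d.+1) : isotropic_kernel a x y = kernel_poly.[dot x y].
Proof.
rewrite /isotropic_kernel (@limn_series_finite _ _ N) => [|k Nk]; last first.
  by rewrite a_supp// mul0r.
by rewrite horner_sum; apply: eq_bigr => k _; rewrite gegenbauerE hornerZ.
Qed.

Lemma kernel_poly1 : kernel_poly.[1] = n%:R.
Proof. by rewrite horner_sum -a_trace; apply: eq_bigr => k _; rewrite hornerZ horner_gegen1. Qed.

Lemma projection_coefE k : projection_coef d k = (2 * k%:R + m%:R + 1) / (m%:R + 1) :> R.
Proof.
rewrite /projection_coef -!natr1; congr (_ / _); ring.
Qed.

(** Distinct degrees convolve to zero, and [a_k^2 (m + 1) / (2 k + m + 1) = a_k] for both allowed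
    values of [a_k]. *)
Lemma kernel_poly_repro (x z : vec d.+1) : enorm x = 1 -> enorm z = 1 ->
  \int[sigma]_y (kernel_poly.[dot x y] * kernel_poly.[dot z y]) = kernel_poly.[dot x z].
Proof.
move=> x1 z1.
have ii k l : sigma.-integrable setT
    (EFin \o (fun y => a k * a l * ((C k).[dot x y] * (C l).[dot z y]))).
  by apply: integrableT_Zl; exact: integrable_horner_dot.
transitivity (\int[sigma]_y (\sum_(k < N) \sum_(l < N)
    a k * a l * ((C k).[dot x y] * (C l).[dot z y]))).
  apply: eq_Rintegral => y _; rewrite !horner_sum mulr_suml; apply: eq_bigr => k _.
  by rewrite mulr_sumr; apply: eq_bigr => l _; rewrite !hornerZ mulrACA.
rewrite Rintegral_sum => [|k]; last exact: integrableT_sum.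
rewrite horner_sum; apply: eq_bigr => k _.
rewrite Rintegral_sum// (bigD1 k)//= [X in _ + X]big1 ?addr0 => [|l lk].
  rewrite RintegralZl//; last exact: integrable_horner_dot.
  rewrite gegen_convolution// eqxx hornerZ.
  have [->|->] := a_proj k; last by rewrite !mul0r.
  have m1 : (m%:R + 1 : R) != 0 by rewrite natr1 pnatr_eq0.
  have k1 : (2 * k%:R + m%:R + 1 : R) != 0.
    by rewrite gt_eqF//; have := ler0n R k; have := ler0n R m; lra.
  by rewrite projection_coefE; field; rewrite m1 k1.
rewrite RintegralZl//; last exact: integrable_horner_dot.
by rewrite gegen_convolution// ifF ?mulr0//; apply/negbTE; rewrite eq_sym.
Qed.

Let kernel (x y : vec d.+1) : R := kernel_poly.[dot x y].
Let K := sphere_restrict kernel.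
Let phi := sphere_restrict (fun x y : vec d.+1 => euclid_dist x y ^- 2).

Let mkernel : measurable_fun setT (fun p : vec d.+1 * vec d.+1 => kernel p.1 p.2).
Proof. exact: measurable_horner_dot2. Qed.

Let mK : measurable_fun setT (fun p : vec d.+1 * vec d.+1 => K p.1 p.2).
Proof. exact: measurable_sphere_restrict. Qed.

Let K_bounded x y : `|K x y| <= \sum_(i < size kernel_poly) `|kernel_poly`_i|.
Proof.
apply: sphere_restrict_bound => u v u1 v1.
by rewrite horner_bound// dot_unit_bound.
Qed.

Let K_repro x z : \int[sigma]_y (K x y * K y z) = K x z.
Proof.
rewrite /K /sphere_restrict.
have [x1|/eqP x1] := eqVneq (enorm x) 1; last first.
  rewrite (sphere_indic0 x1) mul0r mulr0.
  under eq_Rintegral do rewrite mul0r mulr0 mul0r.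
  by rewrite Rintegral_cst// mul0r.
have [z1|/eqP z1] := eqVneq (enorm z) 1; last first.
  rewrite (sphere_indic0 z1) !mulr0.
  under eq_Rintegral do rewrite !mulr0.
  by rewrite Rintegral_cst// mul0r.
rewrite !sphere_indic1// !mulr1 /kernel -kernel_poly_repro// /Rintegral; congr fine.
apply: eq_sphere_integral.
- apply: measurable_funM; apply: measurable_funM.
  + exact: measurable_horner_dot.
  + by apply: measurable_funM => //; exact: measurable_sphere_indic.
  + by under eq_fun do rewrite dotC; exact: measurable_horner_dot.
  + by apply: measurable_funM => //; exact: measurable_sphere_indic.
- by apply: measurable_funM; exact: measurable_horner_dot.
- by move=> y y1; rewrite sphere_indic1// !mulr1 (dotC y).
Qed.

Let K_diag x : K x x = n%:R * \1_(@unit_sphere R d) x.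
Proof.
rewrite /K /sphere_restrict; have [x1|/eqP x1] := eqVneq (enorm x) 1; last first.
  by rewrite (sphere_indic0 x1) !mulr0.
by rewrite !sphere_indic1// !mulr1 /kernel sqnorm_unit// kernel_poly1.
Qed.

Let K_trace : \int[sigma]_x K x x = n%:R.
Proof.
rewrite (_ : n%:R = \int[sigma]_x n%:R); last first.
  by rewrite Rintegral_cst// [X in fine X]probability_setT mulr1.
rewrite /Rintegral; congr fine; apply: eq_sphere_integral => //.
- by under eq_fun do rewrite K_diag; apply: measurable_funM => //; exact: measurable_sphere_indic.
- by move=> y y1; rewrite K_diag sphere_indic1// mulr1.
Qed.

Lemma measurable_inv_dist : measurable_fun setT
  (fun p : vec d.+1 * vec d.+1 => euclid_dist p.1 p.2 ^- 2).
Proof.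
apply: measurable_funV; under eq_fun do rewrite enorm_sqr.
apply: measurable_sum => i; rewrite /=; under eq_fun do rewrite tnth_mktuple.
have mt : measurable_fun setT (fun p : vec d.+1 * vec d.+1 => (tnth p.1 i : R) - tnth p.2 i).
  apply: measurable_funB.
    exact: (measurableT_comp (measurable_tnth i) measurable_fst).
  exact: (measurableT_comp (measurable_tnth i) measurable_snd).
exact: measurable_funM.
Qed.

Let mphi : measurable_fun setT (fun p : vec d.+1 * vec d.+1 => phi p.1 p.2).
Proof. exact: measurable_sphere_restrict measurable_inv_dist. Qed.

Let phi_ge0 x y : 0 <= phi x y.
Proof. by rewrite !mulr_ge0// invr_ge0 exprn_ge0// enorm_ge0. Qed.

Let phiE x y : enorm x = 1 -> enorm y = 1 -> phi x y = 2^-1 * (1 - dot x y)^-1.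
Proof.
move=> x1 y1; rewrite /phi sphere_restrict_unit// euclid_dist_unit//.
by rewrite -invfM mulrBr mulr1.
Qed.

Let phiC x y : phi x y = phi y x.
Proof.
rewrite {2}/phi /sphere_restrict.
have [x1|/eqP x1] := eqVneq (enorm x) 1; last first.
  by rewrite /phi /sphere_restrict (sphere_indic0 x1) !(mul0r, mulr0).
have [y1|/eqP y1] := eqVneq (enorm y) 1; last first.
  by rewrite /phi /sphere_restrict (sphere_indic0 y1) !(mul0r, mulr0).
by rewrite -[RHS]/(phi y x) !phiE// dotC.
Qed.

Let phi_poly (p : {poly R}) x : enorm x = 1 ->
  (\int[sigma]_y (phi x y * (p.[dot x y]))%:E = (2^-1 * weight_mean m p)%:E)%E.
Proof.
move=> x1; rewrite EFinM -(weight_meanE m_gt0 p x1).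
have iw : sigma.-integrable setT (EFin \o (fun y => p.[dot x y] * (1 - dot x y)^-1)).
  exact: integrable_inverse_weight_dot.
rewrite -integralZl//; apply: eq_sphere_integral.
- apply: measurable_funM; last exact: measurable_horner_dot.
  exact: (measurableT_comp mphi (measurable_pair1 x)).
- apply: measurable_funM => //.
  by have /measurable_EFinP := measurable_int _ iw.
- by move=> y y1; rewrite phiE//; ring.
Qed.

Let phi_bounded x : (\int[sigma]_y (phi x y)%:E <= (2^-1 * weight_mean m 1)%:E)%E.
Proof.
have [x1|/eqP x1] := eqVneq (enorm x) 1.
  rewrite -(phi_poly 1 x1) le_eqVlt; apply/orP; left; apply/eqP.
  by apply: eq_integral => y _; rewrite hornerC mulr1.
rewrite (_ : (fun y => _) = fun=> 0%E); last first.
  by apply/funext => y; rewrite /phi /sphere_restrict (sphere_indic0 x1) mul0r mulr0.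
rewrite integral0 lee_fin weight_mean1// mulr_ge0// divr_ge0// addr_ge0//.
Qed.

Let weight_mean_kernel : weight_mean m (kernel_poly * kernel_poly) =
  (\sum_(i < N) \sum_(j < N) a i * a j * 'C(minn i j + m, m)%:R) * ((m%:R + 1) / m%:R).
Proof.
rewrite /kernel_poly mulr_suml linear_sum mulr_suml; apply: eq_bigr => i _.
rewrite mulr_sumr linear_sum mulr_suml; apply: eq_bigr => j _.
by rewrite -scalerAl -scalerAr scalerA linearZ /= weight_mean_gegenM// !mulrA.
Qed.

(** For unit [t] the inner integral of the pair formula is zonal, hence independent of [t], and
    [weight_mean] evaluates it. The factor [1/2] comes from the squared distance and [(m + 1) / m]
    is the mean of [1 / (1 - t)]. *)
Lemma expected_riesz2E : (1 < n)%N -> expected_riesz2 d n a =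
  (2^-1 * ((m%:R + 1) / m%:R) * (n%:R ^+ 2 -
    \sum_(i < N) \sum_(j < N) a i * a j * 'C(minn i j + m, m)%:R))%:E.
Proof.
move=> n1.
have mdens (F : vec d.+1 -> vec d.+1 -> R) :
    measurable_fun setT (fun p : vec d.+1 * vec d.+1 => F p.1 p.2) ->
    measurable_fun setT (fun x : n.-tuple (vec d.+1) => dpp_density F x).
  move=> mF; rewrite /dpp_density; apply: measurable_funM => //.
  have := measurable_kernel_det mF [::] (q := n).
  by under eq_fun do rewrite /= kernel_detE.
transitivity (\int[power_measure sigma n]_x
    ((\sum_(i < n) \sum_(j < n | i != j) phi (tnth x i) (tnth x j)) * dpp_density K x)%:E)%E.
  (* Almost surely all points lie on the sphere, so kernel and distance may be exchanged for their
     cut-offs. *)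
  rewrite /expected_riesz2; apply: ae_eq_integral => //.
  - apply/measurable_EFinP; apply: measurable_funM.
      exact: (measurable_pair_sum (phi := fun x y : vec d.+1 => euclid_dist x y ^- 2)
        measurable_inv_dist).
    apply: mdens.
    under eq_fun do rewrite isotropic_kernelE; exact: mkernel.
  - apply/measurable_EFinP; apply: measurable_funM; last exact: mdens.
    exact: (measurable_pair_sum (phi := phi)).
  - apply: (ae_power_measure (S := @unit_sphere R d)) => [||x x1 _].
    + exact: measurable_unit_sphere.
    + exact: sphere_measure_unit1.
    + congr (_ * _)%:E.
        apply: eq_bigr => i _; apply: eq_bigr => j _.
        by rewrite /phi sphere_restrict_unit//; exact: x1.
      rewrite /dpp_density; congr (_ * \det _); apply/matrixP => i j; rewrite !mxE.
      by rewrite isotropic_kernelE /K sphere_restrict_unit//; exact: x1.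
rewrite (@dpp_pair_expectation _ _ _ sigma K _ n mK K_bounded K_repro K_trace phi
  _ mphi phi_ge0 phiC phi_bounded n1).
congr EFin.
(* The two-point determinant as a polynomial in the inner product, the diagonal of [K] being [n] on
   the sphere. *)
pose q : {poly R} := (n%:R ^+ 2)%:P - kernel_poly * kernel_poly.
pose c := 2^-1 * weight_mean m q.
have inner t : \int[sigma]_s (phi t s * (K t t * K s s - K t s * K s t)) =
    c * \1_(@unit_sphere R d) t.
  have [t1|/eqP t1] := eqVneq (enorm t) 1; last first.
    rewrite (sphere_indic0 t1) mulr0 (_ : (fun s => _) = fun=> 0).
      by rewrite Rintegral_cst// mul0r.
    by apply/funext => s; rewrite /phi /sphere_restrict (sphere_indic0 t1) mul0r mulr0 mul0r.
  rewrite sphere_indic1// mulr1 /c -[RHS]/(fine (2^-1 * weight_mean m q)%:E) -(phi_poly q t1).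
  rewrite /Rintegral; congr fine; apply: eq_sphere_integral.
  - have mKp (f g : vec d.+1 -> vec d.+1) : measurable_fun setT f -> measurable_fun setT g ->
        measurable_fun setT (fun s => K (f s) (g s)).
      by move=> mf mg; apply: (measurableT_comp mK (g := fun s => (f s, g s)));
        exact: measurable_fun_pair.
    apply: measurable_funM; first exact: (measurableT_comp mphi (measurable_pair1 t)).
    by apply: measurable_funB; apply: measurable_funM => //; exact: mKp.
  - apply: measurable_funM; last exact: measurable_horner_dot.
    exact: (measurableT_comp mphi (measurable_pair1 t)).
  - move=> s s1; rewrite !K_diag !sphere_indic1// !mulr1 /K !sphere_restrict_unit//.
    by rewrite /kernel (dotC s) /q hornerD hornerN hornerM hornerC expr2.
rewrite (funext inner) (_ : \int[sigma]_t _ = c).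
  rewrite /c /q linearB /= weight_mean_kernel -alg_polyC linearZ /= weight_mean1//.
  by rewrite -mulrBl mulrCA mulrC.
rewrite [RHS](_ : c = \int[sigma]_t c); last first.
  by rewrite Rintegral_cst// [X in fine X]probability_setT mulr1.
rewrite /Rintegral; congr fine; apply: eq_sphere_integral => //.
- by apply: measurable_funM => //; exact: measurable_sphere_indic.
- by move=> y y1; rewrite sphere_indic1// mulr1.
Qed.

End projection_kernel.

Lemma ltn_bin_addl (m i j : nat) : (0 < m)%N -> (i < j)%N -> ('C(i + m, m) < 'C(j + m, m))%N.
Proof.
case: m => // m _; elim: j => // j IH; rewrite ltnS leq_eqVlt addSn binS => /orP[/eqP ->|/IH ij].
  by rewrite -[X in (X < _)%N]addn0 ltn_add2l bin_gt0; lia.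
by rewrite (leq_trans ij)// leq_addr.
Qed.

(** * Comparison of projection kernels *)

Section projection_sequences.
Context {R : realType}.
Variable m : nat.
Hypothesis m_gt0 : (0 < m)%N.
Local Notation d := m.+2.
Local Notation h i := ('C(i + m, m)%:R : R).

Let h_gt0 i : 0 < h i.
Proof. by rewrite ltr0n bin_gt0 leq_addl. Qed.

Let h_incr : {homo (fun i => h i) : i j / (i < j)%N >-> i < j}.
Proof. by move=> i j ij; rewrite ltr_nat ltn_bin_addl. Qed.

Lemma projection_coef_ge1 k : 1 <= projection_coef d k :> R.
Proof.
rewrite projection_coefE ler_pdivlMr ?ltr_wpDl// mul1r.
by have := ler0n R k; lra.
Qed.

(** Rests on [h (minn i j) * h (maxn i j) = h i * h j]. *)
Lemma min_energyE N (a : nat -> R) :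
  \sum_(i < N) \sum_(j < N) a i * a j * h (minn i j) =
  weighted_energy (fun i => h i) N (fun i => a i * h i).
Proof.
apply: eq_bigr => i _; apply: eq_bigr => j _.
have hn0 k : h k != 0 by rewrite gt_eqF.
have [ij|ji] := leqP i j.
  by rewrite mulrACA mulrA mulfK// -mulrA.
by rewrite mulrACA [h i * _]mulrC mulrA mulfK.
Qed.

(** The trace is stated for every range beyond the support, so that two sequences can be summed over
    a common one. *)
Lemma isotropic_projectionE n (c : nat -> R) : isotropic_projection d n c ->
  exists N, [/\ forall k, c k = projection_coef d k \/ c k = 0,
    forall k, (N <= k)%N -> c k = 0 &
    forall M, (N <= M)%N -> \sum_(k < M) c k * h k = n%:R].
Proof.
move=> [cP /finite_seqP[s cs] cn].
have supp k : (\max_(i <- s) i < k)%N -> c k = 0.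
  move=> sk; apply/eqP; apply: contraTT sk => ck; rewrite -leqNgt.
  by apply: leq_bigmax_seq => //; have : [set k | c k != 0] k by []; rewrite cs.
exists (\max_(i <- s) i).+1; split => // M sM.
rewrite -cn (@limn_series_finite _ _ M) => [|k Mk]; last first.
  by rewrite supp ?mul0r// (leq_trans sM).
apply: eq_bigr => k _; congr (_ * _%:R).
by rewrite -[LHS]bin_sub ?leq_addl// addnK; congr 'C(_, _); lia.
Qed.

Let coef_ge0 (c : nat -> R) : (forall k, c k = projection_coef d k \/ c k = 0) ->
  forall k, 0 <= c k.
Proof.
by move=> cP k; have [->|->//] := cP k; exact: le_trans ler01 (projection_coef_ge1 k).
Qed.

(** Covers the case that [expected_riesz2E] excludes. Nonzero coefficients are at least 1 and
    [h k >= 2] for [k > 0], so a trace of at most 1 leaves room for degree 0 only, and two such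
    sequences coincide. *)
Lemma projection_trace_le1 n (c : nat -> R) : (n <= 1)%N -> isotropic_projection d n c ->
  c = fun k => if k == 0%N then n%:R else 0.
Proof.
move=> n1 /isotropic_projectionE[N [cP _ cn]].
have c0 := coef_ge0 cP.
have cS k : (0 < k)%N -> c k = 0.
  move=> k0; have [ck|//] := cP k.
  have hk : 2 <= h k by rewrite -[2]/(2%:R) ler_nat -(binn m) -[X in ('C(X, m) < _)%N]add0n ltn_bin_addl.
  have kN : (k < maxn N k.+1)%N by rewrite leq_max leqnn orbT.
  have := cn _ (leq_maxl N k.+1); rewrite (bigD1 (Ordinal kN)) //= => cnE.
  have := projection_coef_ge1 k; rewrite -ck => ck1.
  have : 0 <= \sum_(i < maxn N k.+1 | i != Ordinal kN) c i * h i.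
    by apply: sumr_ge0 => i _; rewrite mulr_ge0.
  have : (n%:R : R) <= 1 by rewrite -[1]/(1%:R) ler_nat.
  rewrite -cnE; nra.
move: cn => /(_ N.+1 (leqnSn N)) cn.
apply/funext => -[|k] /=; last exact: cS.
move: cn; rewrite big_ord_recl /= big1 ?addr0 => [|i _]; last by rewrite cS ?mul0r.
by rewrite add0n binn mulr1.
Qed.

Lemma lt_expected_riesz2 n (a b : nat -> R) :
  isotropic_projection d n a -> isotropic_projection d n b -> gap_condition a b ->
  a <> b -> (expected_riesz2 d n a < expected_riesz2 d n b)%E.
Proof.
move=> pa pb gap ab.
have [n1|n1] := leqP n 1.
  by case: ab; rewrite (projection_trace_le1 n1 pa) (projection_trace_le1 n1 pb).
have [Na [aP aN an]] := isotropic_projectionE pa.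
have [Nb [bP bN bn]] := isotropic_projectionE pb.
pose N := maxn Na Nb.
have {}aN k : (N <= k)%N -> a k = 0 by rewrite geq_max => /andP[/aN].
have {}bN k : (N <= k)%N -> b k = 0 by rewrite geq_max => /andP[_ /bN].
have {}an := an N (leq_maxl _ _); have {}bn := bn N (leq_maxr _ _).
have [a0 b0] := (coef_ge0 aP, coef_ge0 bP).
rewrite (expected_riesz2E m_gt0 aP aN an n1) (expected_riesz2E m_gt0 bP bN bn n1).
rewrite lte_fin ltr_pM2l; last by rewrite !mulr_gt0 ?invr_gt0 ?ltr0n// ltr_wpDl.
rewrite ltrD2l ltrN2 !min_energyE.
have exa : exists k, a k != 0.
  apply: contrapT => /forallNP na; move: an; rewrite big1 => [/eqP|k _].
    by rewrite eq_sym pnatr_eq0; case: (n) n1.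
  by have /negP := na k; rewrite negbK => /eqP ->; rewrite mul0r.
have leN k : a k != 0 -> (k <= N)%N.
  by apply: contraNT; rewrite -ltnNge => /ltnW /aN ->.
(* The last index carrying mass of [a]; it exists since the trace is not zero. *)
have [J aJ maxJ] := ex_maxnP exa leN.
have b_le k : b k <= projection_coef d k.
  by have [->//|->] := bP k; exact: le_trans ler01 (projection_coef_ge1 k).
apply: (lt_weighted_energy h_gt0 h_incr (J := J)).
- by move=> i; rewrite mulr_ge0.
- by move=> i; rewrite mulr_ge0.
- by rewrite an bn.
(* Up to [J], either [a i] is the only nonzero value allowed, which bounds [b i], or [a i = 0] with
   [i < J] and the gap condition gives [b i = 0]. *)
- move=> i; rewrite leq_eqVlt => iJ; rewrite ler_pM2r//.
  have [->//|ai0] := aP i.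
  case/orP: iJ => [/eqP iJ|iJ]; first by move: aJ; rewrite -iJ ai0 eqxx.
  by rewrite (gap i J) ?a0// lt_neqAle eq_sym aJ a0.
- move=> i Ji; apply/eqP; rewrite mulf_eq0; apply/orP; left.
  by apply: contraTT Ji => /maxJ; rewrite -leqNgt.
- apply: contrapT => nex; apply: ab; apply/funext => i.
  have [iN|Ni] := ltnP i N; last by rewrite aN// bN.
  apply/eqP; apply/negP => /negP abi; apply: nex; exists i => //.
  by rewrite (inj_eq (mulIf _))// gt_eqF.
Qed.

Lemma le_expected_riesz2 n (a b : nat -> R) :
  isotropic_projection d n a -> isotropic_projection d n b -> gap_condition a b ->
  (expected_riesz2 d n a <= expected_riesz2 d n b)%E.
Proof.
move=> pa pb gap; have [->//|/eqP ab] := eqVneq a b.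
exact/ltW/lt_expected_riesz2.
Qed.

Local Notation B L := ('C(L + m.+1, m.+1)%:R : R).

Let harmonic_dimE L : harmonic_dim d L = (2 * L%:R + m%:R + 2) / (m%:R + 2) * B L.
Proof.
rewrite /harmonic_dim -[(m.+2)%:R]natr1 -[(m.+1)%:R]natr1 -!addrA -[1 + 1]/2.
congr (_ * _%:R); rewrite -[RHS]bin_sub ?leq_addl// addnK; congr 'C(_, _); lia.
Qed.

Let m2_neq0 : (m%:R + 2 : R) != 0.
Proof. by rewrite -natrD pnatr_eq0 addn2. Qed.

Lemma harmonic_sum L : \sum_(k < L.+1) projection_coef d k * h k = harmonic_dim d L :> R.
Proof.
have m1 : (m%:R + 1 : R) != 0 by rewrite natr1 pnatr_eq0.
elim: L => [|L IH].
  rewrite big_ord_recl big_ord0 harmonic_dimE projection_coefE /= !add0n !binn.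
  by field; rewrite m1 m2_neq0.
rewrite big_ord_recr /= IH !harmonic_dimE projection_coefE.
have L1 : (L%:R + 1 : R) != 0 by rewrite natr1 pnatr_eq0.
have r1 : B L.+1 = (L%:R + m%:R + 2) / (L%:R + 1) * B L.
  apply: (mulfI L1); rewrite mulrA mulrCA divff// mulr1.
  have := congr1 (GRing.natmul (1 : R)) (bin_rising L m.+1).
  by rewrite !natrM -!natr1 natrD -natr1 => ->; ring.
have r2 : h L.+1 = (m%:R + 1) / (L%:R + 1) * B L.
  apply: (mulfI L1); rewrite mulrA mulrCA divff// mulr1.
  rewrite binSr (_ : (L.+1 + m = L + m.+1)%N); last lia.
  by rewrite natrD -natr1; ring.
rewrite r1 r2 -!natr1; field.
by rewrite m1 m2_neq0 L1.
Qed.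

(** Exhibits [pi_L] as a natural number. The two terms count the monomials in [d] variables of
    degree at most [L] and at most [L - 1]; their sum is the dimension of the polynomials of degree
    at most [L] on the sphere. *)
Lemma harmonic_dim_nat L :
  harmonic_dim d L = ('C(L + m.+2, m.+2) + 'C(L + m.+1, m.+2))%:R :> R.
Proof.
rewrite harmonic_dimE natrD; apply: (mulfI m2_neq0).
have r1 : (m%:R + 2) * 'C(L + m.+2, m.+2)%:R = (L%:R + m%:R + 2) * B L.
  have := congr1 (GRing.natmul (1 : R)) (mul_bin_diag (L + m.+2) m.+1).
  rewrite (_ : (L + m.+2).-1 = (L + m.+1)%N); last lia.
  by rewrite !natrM -[(m.+2)%:R]natr1 -[(m.+1)%:R]natr1 -addrA -[1 + 1]/2 => <-; rewrite natrD -!natr1; ring.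
have r2 : (m%:R + 2) * 'C(L + m.+1, m.+2)%:R = L%:R * B L.
  have := @binSr R (L + m.+1) m.+1.
  by rewrite natrD addrK -[(m.+1)%:R]natr1 -addrA -[1 + 1]/2 => ->.
by rewrite mulrDr r1 r2; field; rewrite m2_neq0.
Qed.

Lemma harmonic_projection L (n : nat) : n%:R = harmonic_dim d L :> R ->
  isotropic_projection d n (harmonic_coef d L : nat -> R).
Proof.
move=> nE; have supp k : (L < k)%N -> harmonic_coef d L k = 0 :> R.
  by rewrite /harmonic_coef ltnNge => /negbTE ->.
split=> [k||].
- by rewrite /harmonic_coef; case: ifP => _; [left|right].
- apply: (@sub_finite_set _ _ `I_L.+1); last exact: finite_II.
  by move=> k /=; apply: contraNT; rewrite -leqNgt => /supp ->.
- rewrite (@limn_series_finite _ _ L.+1) => [|k Lk]; last by rewrite supp ?mul0r.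
  rewrite nE -harmonic_sum; apply: eq_bigr => k _.
  rewrite /harmonic_coef -ltnS ltn_ord; congr (_ * _%:R).
  by rewrite -[RHS]bin_sub ?leq_addl// addnK; congr 'C(_, _); lia.
Qed.

Lemma harmonic_gap L (b : nat -> R) : gap_condition (harmonic_coef d L) b.
Proof.
move=> i j ij; rewrite /harmonic_coef; case: (leqP i L) => [_ ai0|Li _].
  by have := projection_coef_ge1 i; rewrite ai0 ler10.
by rewrite leqNgt (ltn_trans Li ij) ltxx.
Qed.

End projection_sequences.

Theorem theorem7 (R : realType) (d : nat) (d_ge3 : (3 <= d)%N) :
  (forall (n : nat) (a b : nat -> R),
     isotropic_projection d n a -> isotropic_projection d n b ->
     gap_condition a b ->
     (expected_riesz2 d n a <= expected_riesz2 d n b)%E /\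
     (a <> b -> (expected_riesz2 d n a < expected_riesz2 d n b)%E)) /\
  (forall L : nat, exists n : nat,
     [/\ n%:R = harmonic_dim d L :> R,
         isotropic_projection d n (harmonic_coef d L : nat -> R)
       & forall b : nat -> R, isotropic_projection d n b ->
           gap_condition (harmonic_coef d L) b /\
           (expected_riesz2 d n (harmonic_coef d L) <= expected_riesz2 d n b)%E]).
Proof.
(* Writing [d = m + 2] turns [3 <= d] into [0 < m]. *)
case: d d_ge3 => [|[|m]]// m_gt0; rewrite !ltnS in m_gt0.
split=> [n a b pa pb gap|L].
  by split; [exact: le_expected_riesz2|exact: lt_expected_riesz2].
exists ('C(L + m.+2, m.+2) + 'C(L + m.+1, m.+2))%N.
have pL := harmonic_projection m_gt0 (esym (@harmonic_dim_nat R m m_gt0 L)).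
split=> // [|b pb]; first by rewrite harmonic_dim_nat.
by split; [exact: harmonic_gap|apply: le_expected_riesz2 => //; exact: harmonic_gap].
Qed.
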